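(* Let $N\in\mathbb{N}$ and $p\in[1,\infty)$. Then $\mathcal{AW}_p$ is a metric on $\mathrm{FP}_p$, and $(\mathrm{FP}_p,\mathcal{AW}_p)$ is the completion of $(\mathcal{P}_p(\mathbb{R}^N),\mathcal{AW}_p)$, where $\mathcal{P}_p(\mathbb{R}^N)$ is regarded as a subset of $\mathrm{FP}_p$ by associating to $\mu\in\mathcal{P}_p(\mathbb{R}^N)$ the class of the filtered process $(\mathbb{R}^N,\mathcal{B}(\mathbb{R}^N),\mu,(\mathcal{F}_t)_{t=1}^N,(X_t)_{t=1}^N)$ with $X_t(\omega)=\omega(t)$ and $\mathcal{F}_t=\sigma(X_s:s\le t)$.
   Context: A filtered process is a tuple $\mathbb{X}=(\Omega^{\mathbb X},\mathcal{F}^{\mathbb X},\mathbb{P}^{\mathbb X},(\mathcal{F}^{\mathbb X}_t)_{t=1}^N,(X_t)_{t=1}^N)$ consisting of a probability space, a filtration on it, and a real-valued process $X=(X_t)_{t=1}^N$ adapted to the filtration. $\mathcal{FP}_p$ is the class of all filtered processes with $\mathbb{E}[\|X\|_p^p]=\mathbb{E}[\sum_{t=1}^N|X_t|^p]<\infty$. $\mathcal{P}_p(\mathbb{R}^N)$ is the set of Borel probabilities on $\mathbb{R}^N$ with finite $p$-th moment. A coupling of $\mathbb X,\mathbb Y$ is a probability $\pi$ on $(\Omega^{\mathbb X}\times\Omega^{\mathbb Y},\mathcal{F}^{\mathbb X}\otimes\mathcal{F}^{\mathbb Y})$ with marginals $\mathbb{P}^{\mathbb X},\mathbb{P}^{\mathbb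 Y}$. Identify $\mathcal{F}^{\mathbb X}_t$ and $\mathcal{F}^{\mathbb Y}_t$ with the corresponding $\sigma$-algebras on the product space. $\pi$ is causal from $\mathbb X$ to $\mathbb Y$ if, for every $1\le t\le N$, under $\pi$ the $\sigma$-algebras $\mathcal{F}^{\mathbb X}_N$ and $\mathcal{F}^{\mathbb Y}_t$ are conditionally independent given $\mathcal{F}^{\mathbb X}_t$; it is anticausal if the same holds with the roles of $\mathbb X$ and $\mathbb Y$ exchanged; it is bicausal if it is both. $\mathrm{Cpl}_{\mathrm{bc}}(\mathbb X,\mathbb Y)$ denotes the set of bicausal couplings and $$\mathcal{AW}_p^p(\mathbb X,\mathbb Y):=\inf_{\pi\in\mathrm{Cpl}_{\mathrm{bc}}(\mathbb X,\mathbb Y)}\mathbb{E}_\pi[\|X-Y\|_p^p].$$ $\mathrm{FP}_p$ is the set of equivalence classes of $\mathcal{FP}_p$ obtained by identifying $\mathbb X,\mathbb Y$ whenever $\mathcal{AW}_p(\mathbb X,\mathbb Y)=0$. *)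

(* Defs.v *)
From HB Require Import structures.
From mathcomp Require Import all_boot all_order all_algebra.
From mathcomp Require Import all_classical all_reals all_analysis.

Set Implicit Arguments.
Unset Strict Implicit.
Unset Printing Implicit Defensive.

Import Order.TTheory GRing.Theory Num.Theory.
Import numFieldNormedType.Exports.

Local Open Scope classical_set_scope.
Local Open Scope ring_scope.

(** ** Filtered processes *)

(* The times 1, ..., N are encoded by the elements 0, ..., N - 1 of 'I_N. *)
Record filtered_process (R : realType) (N : nat) := FilteredProcess {
  fp_display : measure_display;
  fp_space : measurableType fp_display;
  fp_prob : probability fp_space R;
  fp_filtration : 'I_N -> set (set fp_space);
  fp_process : 'I_N -> fp_space -> R;
  fp_sigma_algebra : forall t, sigma_algebra setT (fp_filtration t);
  fp_sub_measurable : forall t, fp_filtration t `<=` measurable;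
  fp_filtration_le : forall s t : 'I_N,
    (s <= t)%N -> fp_filtration s `<=` fp_filtration t;
  fp_adapted : forall t,
    preimage_set_system setT (fp_process t) measurable `<=` fp_filtration t
}.

Arguments fp_filtration {R N} f _ _.
Arguments fp_process {R N} f _ _.
Arguments fp_prob {R N} f.

(** ** Conditional independence *)

Definition is_cond_prob (R : realType) d (T : measurableType d)
    (P : probability T R) (G : set (set T)) (A : set T) (f : T -> R) : Prop :=
  [/\ preimage_set_system setT f measurable `<=` G,
      P.-integrable setT (EFin \o f) &
      forall C, G C -> (\int[P]_(w in C) (f w)%:E = P (A `&` C))%E].

Definition cond_independent (R : realType) d (T : measurableType d)
    (P : probability T R) (F1 F2 G : set (set T)) : Prop :=
  forall A B, F1 A -> F2 B ->
    exists f g h : T -> R,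
      [/\ is_cond_prob P G A f, is_cond_prob P G B g,
          is_cond_prob P G (A `&` B) h &
          {ae P, forall w, h w = f w * g w}].

(** ** Bicausal couplings and the adapted Wasserstein distance *)

Section adapted_wasserstein.
Context (R : realType) (N : nat).
Implicit Types X Y : filtered_process R N.

Definition coupling_space X Y := (fp_space X * fp_space Y)%type.

Definition filtration_fst X Y (t : 'I_N) : set (set (coupling_space X Y)) :=
  preimage_set_system setT fst (fp_filtration X t).

Definition filtration_snd X Y (t : 'I_N) : set (set (coupling_space X Y)) :=
  preimage_set_system setT snd (fp_filtration Y t).

Arguments filtration_fst : clear implicits.
Arguments filtration_snd : clear implicits.

Definition is_coupling X Y (pi : probability (coupling_space X Y) R) : Prop :=
  (forall A, measurable A -> pi (fst @^-1` A) = fp_prob X A) /\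
  (forall B, measurable B -> pi (snd @^-1` B) = fp_prob Y B).

(* The index [last], constrained by [last.+1 = N], is the terminal time. *)
Definition causal X Y (pi : probability (coupling_space X Y) R) : Prop :=
  forall t last : 'I_N, last.+1 = N ->
    cond_independent pi (filtration_fst X Y last) (filtration_snd X Y t)
      (filtration_fst X Y t).

Definition anticausal X Y (pi : probability (coupling_space X Y) R) : Prop :=
  forall t last : 'I_N, last.+1 = N ->
    cond_independent pi (filtration_snd X Y last) (filtration_fst X Y t)
      (filtration_snd X Y t).

Definition Cpl_bc X Y : set (probability (coupling_space X Y) R) :=
  [set pi | [/\ is_coupling pi, causal pi & anticausal pi]].

Arguments Cpl_bc : clear implicits.

Definition transport_cost (p : R) X Y
    (pi : probability (coupling_space X Y) R) : \bar R :=
  'E_pi[(fun w => \sum_(t < N)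
           `|fp_process X t w.1 - fp_process Y t w.2| `^ p)%R]%E.

Definition AW (p : R) X Y : \bar R :=
  (ereal_inf [set transport_cost p pi | pi in Cpl_bc X Y] `^ p^-1)%E.

End adapted_wasserstein.

(** ** The space of (classes of) filtered processes with finite p-th moment *)

Record FPp (R : realType) (N : nat) (p : R) := MkFPp {
  FPp_process :> filtered_process R N;
  FPp_moment : ('E_(fp_prob FPp_process)[(fun w => \sum_(t < N)
                  `|fp_process FPp_process t w| `^ p)%R] < +oo)%E
}.

Section quotient.
Context (R : realType) (N : nat) (p : R).

Definition FP_class_of (X : FPp N p) : FPp N p -> Prop :=
  fun Y => AW p X Y = 0%E.

Definition FP : Type :=
  {C : FPp N p -> Prop | exists X, C = FP_class_of X}.

Definition FP_class (X : FPp N p) : FP :=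
  exist _ (FP_class_of X) (ex_intro _ X erefl).

Definition FP_repr (C : FP) : FPp N p := projT1 (cid (proj2_sig C)).

Definition AW_FP (C D : FP) : \bar R := AW p (FP_repr C) (FP_repr D).

End quotient.

(** ** Laws on R^N as filtered processes *)

Section canonical_process.
Context (R : realType) (N : nat).

(* The product sigma-algebra of the library on [N.-tuple R] is the Borel
   sigma-algebra of R^N. *)
Definition path_space := N.-tuple R.

Definition coordinate (t : 'I_N) (w : path_space) : R := tnth w t.

Definition canonical_filtration (t : 'I_N) : set (set path_space) :=
  <<s \bigcup_(s in [set s : 'I_N | (s <= t)%N])
        preimage_set_system setT (coordinate s) measurable >>.

Lemma canonical_sigma_algebra t : sigma_algebra setT (canonical_filtration t).
Proof. exact: smallest_sigma_algebra. Qed.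

Lemma canonical_sub_measurable t : canonical_filtration t `<=` measurable.
Proof.
apply: smallest_sub; first exact: sigma_algebra_measurable.
move=> _ [s _ [B mB <-]].
exact: (@measurable_tnth _ _ N s measurableT B mB).
Qed.

Lemma canonical_filtration_le (s t : 'I_N) :
  (s <= t)%N -> canonical_filtration s `<=` canonical_filtration t.
Proof.
move=> st; apply: sub_smallest2r; first exact: smallest_sigma_algebra.
by move=> A [u us uA]; exists u => //=; exact: leq_trans st.
Qed.

Lemma canonical_adapted t :
  preimage_set_system setT (coordinate t) measurable `<=`
  canonical_filtration t.
Proof. by move=> A tA; apply: sub_gen_smallest; exists t => /=. Qed.

Definition canonical_process (mu : probability path_space R) :
    filtered_process R N :=
  FilteredProcess mu canonical_sigma_algebra canonical_sub_measurable
    canonical_filtration_le canonical_adapted.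

Record Pp (p : R) := MkPp {
  Pp_law :> probability path_space R;
  Pp_moment : ('E_Pp_law[(fun w => \sum_(t < N)
                 `|tnth w t| `^ p)%R] < +oo)%E
}.

Definition Pp_to_FPp (p : R) (mu : Pp p) : FPp N p :=
  @MkFPp R N p (canonical_process mu) (Pp_moment mu).

Definition Pp_to_FP (p : R) (mu : Pp p) : FP N p := FP_class (Pp_to_FPp mu).

(* A library measure is a function on all subsets, whose values on
   non-measurable sets are unconstrained; Borel probabilities are therefore
   compared on measurable sets only. *)
Definition same_law (mu nu : probability path_space R) : Prop :=
  forall A, measurable A -> mu A = nu A.

End canonical_process.

(** ** Metrics and completions *)

(* [FP] lives in too large a universe to carry the library's metric
   structures, whence these predicates on extended-real valued distances. *)
Section metric.
Context (R : realType) (T : Type) (d : T -> T -> \bar R).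

Definition is_metric : Prop :=
  [/\ forall x y, (d x y \is a fin_num) && (0 <= d x y)%E,
      forall x y, d x y = 0%E <-> x = y,
      forall x y, d x y = d y x &
      forall x y z, (d x z <= d x y + d y z)%E].

Definition cauchy_sequence (u : nat -> T) : Prop :=
  forall e : R, 0 < e -> exists k, forall m n, (k <= m)%N -> (k <= n)%N ->
    (d (u m) (u n) < e%:E)%E.

Definition converges_to (u : nat -> T) (l : T) : Prop :=
  d (u n) l @[n --> \oo] --> 0%E.

Definition is_complete : Prop :=
  forall u, cauchy_sequence u -> exists l, converges_to u l.

Definition is_dense (A : T -> Prop) : Prop :=
  forall x (e : R), 0 < e -> exists2 a, A a & (d x a < e%:E)%E.

(* [T] is the completion of its subset [A] endowed with the restriction of
   the metric [d]. *)
Definition is_completion_of (A : T -> Prop) : Prop :=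
  [/\ is_metric, is_complete & is_dense A].

End metric.

(* Main.v *)
Require Import Defs.
From HB Require Import structures.
From mathcomp Require Import all_boot all_order all_algebra.
From mathcomp Require Import all_classical all_reals all_analysis.
From mathcomp Require Import measurable_realfun ring lra.

Set Implicit Arguments.
Unset Strict Implicit.
Unset Printing Implicit Defensive.
Set SsrOldRewriteGoalsOrder.

Import Order.TTheory GRing.Theory Num.Theory.
Import numFieldNormedType.Exports.

Local Open Scope classical_set_scope.
Local Open Scope ring_scope.

(** A finite model is a finitely supported law on R^N, and a process is within c
    of it if it carries weights, functions of its terminal sigma-algebra, that
    describe a bicausal coupling with the model of cost at most c^p.  Weights are
    transported along a bicausal coupling by conditional expectation, and two
    processes near the same model are coupled bicausally by the density
    sum_i k_i (x) k'_i / m_i.  Once every process is near some model, reflexivity,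
    symmetry and the triangle inequality follow, and models are dense laws.

    To approximate X, one builds backward in time finite-valued, F_t-measurable
    states that encode a rounding of X_t and of the conditional law of the next
    state.  As this law is only encoded approximately, the path of states is
    killed with a small probability, so that the surviving path is exactly Markov
    for the encoded law.

    For completeness, a Cauchy sequence is replaced by models f_k with summable
    distances.  Consecutive models are coupled by matrices, which are the
    transitions of a Markov chain (Y_k) realised on [0, 1).  The limit process is
    lim Y_k, with F_t generated by the coordinates up to t of all the Y_k: the
    Markov property makes the joint law of the whole chain bicausal with each
    Y_k. *)

(** * Densities and sub-sigma-algebras *)

(** The sample spaces are arbitrary, so regular conditional probabilities need not exist, and two
    couplings cannot be glued along a common process by disintegration. This is why the triangle
    inequality passes through a model near the middle process and not through the middle process
    itself. Bicausality is an exact condition, and rounding conditional laws destroys it. Killing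
    the path converts the rounding error into transport cost and leaves the causality identities
    exact. Conditional statements are mostly phrased as equalities of integrals over the sets of a
    sigma-algebra; versions of conditional expectations are corrected on null sets so that weights
    sum to one everywhere. In the completeness proof, consecutive models are at distance at most
    [4^-k]: multiplying the k-th step by [2^k] still leaves a summable series of costs, and a finite
    value of that series forces geometric convergence of the individual path. *)

Section density.
Local Open Scope ereal_scope.
Context d (T : measurableType d) (R : realType) (mu : {measure set T -> \bar R}).
Context (f : T -> R).

(** The proofs of positivity and measurability are arguments so that the measure structure can be
    declared on [mdensity] itself. *)
Definition mdensity (f0 : forall x, (0 <= f x)%R)
    (mf : measurable_fun setT f) (A : set T) : \bar R :=
  \int[mu]_(x in A) (f x)%:E.

Hypotheses (f0 : forall x, (0 <= f x)%R) (mf : measurable_fun setT f).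

Let mdensity0 : mdensity f0 mf set0 = 0.
Proof. by rewrite /mdensity integral_set0. Qed.

Let mdensity_ge0 A : 0 <= mdensity f0 mf A.
Proof. by apply: integral_ge0 => x _; rewrite lee_fin. Qed.

Let mdensity_sigma_additive : semi_sigma_additive (mdensity f0 mf).
Proof.
move=> F mF tF mUF; rewrite /mdensity; apply: cvg_toP.
  apply: ereal_nondecreasing_is_cvgn => m n mn.
  apply: lee_sum_nneg_natr => // k _ _.
  by apply: integral_ge0 => x _; rewrite lee_fin.
rewrite ge0_integral_bigcup//=.
- by apply/measurable_EFinP; exact: measurable_funTS.
- by move=> x _; rewrite lee_fin.
Qed.

HB.instance Definition _ := isMeasure.Build _ _ _ (mdensity f0 mf)
  mdensity0 mdensity_ge0 mdensity_sigma_additive.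

Import HBNNSimple.

(** Monotone convergence along simple functions approximating [g] reduces both sides to indicators,
    where the identity is the definition of [mdensity]. *)
Lemma integral_mdensity D (g : T -> \bar R) : measurable D ->
  (forall x, 0 <= g x) -> measurable_fun setT g ->
  \int[mdensity f0 mf]_(x in D) g x = \int[mu]_(x in D) (g x * (f x)%:E).
Proof.
move=> mD g0 mg'; have mg : measurable_fun D g := measurable_funTS mg'.
pose h := nnsfun_approx mD mg.
have mfE : measurable_fun setT (EFin \o f) by exact/measurable_EFinP.
have -> : \int[mdensity f0 mf]_(x in D) g x =
    lim (\int[mdensity f0 mf]_(x in D) (EFin \o h n) x @[n --> \oo]).
  have fE x : D x -> g x = lim ((EFin \o h n) x @[n --> \oo]).
    by move=> Ex; apply/esym/cvg_lim => //; exact: cvg_nnsfun_approx.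
  under eq_integral => x /[!inE] /fE -> //.
  apply: monotone_convergence => //.
  - move=> n; apply/measurable_EFinP.
    by apply: (measurable_funS measurableT) => //; exact/measurable_funP.
  - by move=> n x Ex //=; rewrite lee_fin.
  - by move=> x Ex a b ab; rewrite lee_fin; exact/lefP/nd_nnsfun_approx.
have -> : \int[mu]_(x in D) (g x * (f x)%:E) =
    lim (\int[mu]_(x in D) ((EFin \o h n) x * (f x)%:E) @[n --> \oo]).
  have fg x : D x ->
      g x * (f x)%:E = lim (((EFin \o h n) x * (f x)%:E) @[n --> \oo]).
    move=> Ex; apply/esym/cvg_lim => //; apply: cvgeZr => //.
    exact: cvg_nnsfun_approx.
  under eq_integral => x /[!inE] /fg -> //.
  apply: monotone_convergence => [//| | |].
  - move=> n; apply/emeasurable_funM; apply/measurable_funTS => //.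
    exact/measurable_EFinP.
  - by move=> n x Ex /=; rewrite mule_ge0 ?lee_fin.
  - move=> x Ex a b ab/=; rewrite lee_wpmul2r ?lee_fin//.
    exact/lefP/nd_nnsfun_approx.
suff suf n : \int[mu]_(x in D) ((EFin \o h n) x * (f x)%:E) =
    \int[mdensity f0 mf]_(x in D) (EFin \o h n) x.
  by under [in RHS]eq_fun do rewrite suf.
transitivity (\int[mdensity f0 mf]_(x in D)
   (\sum_(y \in range (h n)) (y * \1_(h n @^-1` [set y]) x)%:E)); last first.
  by apply: eq_integral => t tE; rewrite /= fimfunE -fsumEFin.
have indich m r : measurable_fun D (fun x => (r * \1_(h m @^-1` [set r]) x)%:E).
  by apply: (measurable_comp measurableT) => //; exact: measurable_funM.
rewrite ge0_integral_fsum//; last by move=> m y Ey; exact: nnfun_muleindic_ge0.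
transitivity (\int[mu]_(x in D) (\sum_(y \in range (h n))
    (y * \1_(h n @^-1` [set y]) x)%:E * (f x)%:E)).
  under [RHS]eq_integral => x xE.
    rewrite -ge0_mule_fsuml => [|y]; last exact: nnfun_muleindic_ge0.
    rewrite fsumEFin // -(fimfunE _ x); over.
  by [].
rewrite ge0_integral_fsum//; last 2 first.
  - by move=> y; apply: emeasurable_funM => //; apply: measurable_funTS.
  - move=> m y Ey; rewrite mule_ge0//; last by rewrite lee_fin.
    by rewrite EFinM nnfun_muleindic_ge0.
apply: eq_fsbigr => r rhn.
under [RHS]eq_integral do rewrite EFinM.
rewrite integralZl_indic_nnsfun => //.
under eq_integral do rewrite EFinM -muleA.
rewrite ge0_integralZl//.
- under eq_integral do rewrite muleC.
  rewrite (eq_integral ((EFin \o f) \_ (h n @^-1` [set r]))); last first.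
    by move=> x xE; rewrite epatch_indic.
  by rewrite -integral_mkcondr integral_indic// setIC.
- apply: emeasurable_funM; first exact/measurable_EFinP.
  exact/measurable_funTS.
- by move=> t Et; rewrite mule_ge0 ?lee_fin.
- by move: rhn; rewrite inE => -[t _ <-]; rewrite lee_fin.
Qed.

End density.

(* measurability with respect to a sub-sigma-algebra, in the form of [is_cond_prob] *)
Definition Gmeas (R : realType) T (G : set (set T)) (f : T -> R) : Prop :=
  preimage_set_system setT f measurable `<=` G.

Section sub_sigma_algebra.
Local Open Scope ereal_scope.
Context (R : realType) d (T : measurableType d) (G : set (set T)).
Hypothesis sG : sigma_algebra setT G.

(** Makes the closure properties of measurable functions available for [Gmeas]: the measurable sets
    of the generated type are exactly [G]. *)
Lemma GmeasP (f : T -> R) :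
  Gmeas G f <-> measurable_fun (setT : set (g_sigma_algebraType G)) f.
Proof.
split=> [h _ B mB|h _ [B mB <-]].
  by rewrite /measurable /= sigma_algebra_id//; apply: h; exists B.
by have := h measurableT B mB; rewrite [X in X -> _]/measurable /= sigma_algebra_id.
Qed.

Lemma sub_measurable_Gset (A : set T) :
  G A -> measurable (A : set (g_sigma_algebraType G)).
Proof. by rewrite [in X in _ -> X]/measurable /= sigma_algebra_id. Qed.

Lemma Gset_sub_measurable (A : set T) :
  measurable (A : set (g_sigma_algebraType G)) -> G A.
Proof. by rewrite [in X in X -> _]/measurable /= sigma_algebra_id. Qed.

Hypothesis GM : G `<=` measurable.

Lemma Gmeas_measurable (f : T -> R) : Gmeas G f -> measurable_fun setT f.
Proof. by move=> h _ B mB; apply: GM; apply: h; exists B. Qed.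

Lemma measurable_to_Gtype :
  measurable_fun setT ((fun x => x) : T -> g_sigma_algebraType G).
Proof. by move=> _ B mB; rewrite setTI; apply/GM/Gset_sub_measurable. Qed.

Context (P : {measure set T -> \bar R}).

(* Both sides are integrals of [g] with respect to measures that agree on [G]. *)
Lemma integral_Gmeas_mulr (phi psi : T -> R) (g : T -> R) (D : set T) :
  (forall x, (0 <= phi x)%R) -> (forall x, (0 <= psi x)%R) ->
  measurable_fun setT phi -> measurable_fun setT psi ->
  (forall A, G A -> \int[P]_(x in A) (phi x)%:E = \int[P]_(x in A) (psi x)%:E) ->
  (forall x, (0 <= g x)%R) -> Gmeas G g -> G D ->
  \int[P]_(x in D) (g x * phi x)%:E = \int[P]_(x in D) (g x * psi x)%:E.
Proof.
move=> phi0 psi0 mphi mpsi phipsi g0 Gg GD.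
have mg := Gmeas_measurable Gg.
have mgE : measurable_fun setT (EFin \o g) by exact/measurable_EFinP.
have mGg : measurable_fun (setT : set (g_sigma_algebraType G)) (EFin \o g).
  exact/measurable_EFinP/GmeasP.
under eq_integral do rewrite EFinM.
under [RHS]eq_integral do rewrite EFinM.
rewrite -(integral_mdensity P phi0 mphi (GM GD) (g := EFin \o g))//.
rewrite -(integral_mdensity P psi0 mpsi (GM GD) (g := EFin \o g))//.
pose fM : {mfun T >-> g_sigma_algebraType G} := HB.pack
  ((fun x => x) : T -> g_sigma_algebraType G)
  (isMeasurableFun.Build _ _ _ _ _ measurable_to_Gtype).
pose m1 := pushforward (mdensity P phi0 mphi) fM.
pose m2 := pushforward (mdensity P psi0 mpsi) fM.
have mD := sub_measurable_Gset GD.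
transitivity (\int[m1]_(x in (D : set (g_sigma_algebraType G))) (g x)%:E).
  rewrite [RHS]ge0_integral_pushforward//; first exact: measurable_funTS.
  by move=> x _; rewrite lee_fin.
transitivity (\int[m2]_(x in (D : set (g_sigma_algebraType G))) (g x)%:E).
  apply: eq_measure_integral => A mA _.
  by rewrite /m1 /m2 /pushforward /= /mdensity; apply: phipsi; exact: Gset_sub_measurable.
rewrite [LHS]ge0_integral_pushforward//; first exact: measurable_funTS.
by move=> x _; rewrite lee_fin.
Qed.

End sub_sigma_algebra.

(** * Conditional expectation and independence *)

Section trace_measure.
Local Open Scope ereal_scope.
Context (R : realType) d (T : measurableType d) (G : set (set T)).

(** The restriction of [m] to [G]. On this measurable type every measurable function is
    [G]-measurable, so a Radon-Nikodym derivative taken there is a conditional expectation. *)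
Definition trace_measure (sG : sigma_algebra setT G) (GM : G `<=` measurable)
    (m : set T -> \bar R) (A : set (g_sigma_algebraType G)) : \bar R :=
  m A.

Hypotheses (sG : sigma_algebra setT G) (GM : G `<=` measurable).

Section measure.
Variable m : {measure set T -> \bar R}.

Let trace_measure0 : trace_measure sG GM m set0 = 0.
Proof. by rewrite /trace_measure measure0. Qed.

Let trace_measure_ge0 A : 0 <= trace_measure sG GM m A.
Proof. exact: measure_ge0. Qed.

Let trace_measure_sigma_additive : semi_sigma_additive (trace_measure sG GM m).
Proof.
move=> F mF tF mUF; apply: measure_semi_sigma_additive => //.
- by move=> i; apply/GM/(Gset_sub_measurable sG).
- by apply/GM/(Gset_sub_measurable sG).
Qed.

HB.instance Definition _ := isMeasure.Build _ _ _ (trace_measure sG GM m)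
  trace_measure0 trace_measure_ge0 trace_measure_sigma_additive.

Lemma ge0_integral_trace D (g : T -> \bar R) : G D ->
  (forall x, 0 <= g x) -> measurable_fun (setT : set (g_sigma_algebraType G)) g ->
  \int[trace_measure sG GM m]_(x in (D : set (g_sigma_algebraType G))) g x =
  \int[m]_(x in D) g x.
Proof.
move=> GD g0 mg.
have mD := sub_measurable_Gset sG GD.
rewrite -(ge0_integral_pushforward (measurable_to_Gtype sG GM) m mD)//.
exact: measurable_funTS.
Qed.

Lemma integrable_trace (g : T -> \bar R) :
  measurable_fun (setT : set (g_sigma_algebraType G)) g ->
  m.-integrable setT g ->
  (trace_measure sG GM m).-integrable setT g.
Proof.
move=> mg ig; apply/integrableP; split => //.
rewrite ge0_integral_trace//; last exact: measurableT_comp.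
  by case/integrableP : ig.
by apply: (Gset_sub_measurable sG).
Qed.

Lemma integral_trace D (g : T -> \bar R) : G D ->
  measurable_fun (setT : set (g_sigma_algebraType G)) g -> m.-integrable D g ->
  \int[trace_measure sG GM m]_(x in (D : set (g_sigma_algebraType G))) g x =
  \int[m]_(x in D) g x.
Proof.
move=> GD mg ig; have mD := sub_measurable_Gset sG GD.
by rewrite -(integral_pushforward (measurable_to_Gtype sG GM) (mu := m) mg).
Qed.

End measure.

Section finite.
Variable m : {finite_measure set T -> \bar R}.

Let trace_measure_finite : fin_num_fun (trace_measure sG GM m).
Proof.
by move=> A mA; apply: fin_num_measure; apply/GM/(Gset_sub_measurable sG).
Qed.

HB.instance Definition _ :=
  @Measure_isFinite.Build _ _ _ (trace_measure sG GM m) trace_measure_finite.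

End finite.

End trace_measure.

Section cond_expectation.
Local Open Scope ereal_scope.
Context (R : realType) d (T : measurableType d) (G : set (set T)).
Hypotheses (sG : sigma_algebra setT G) (GM : G `<=` measurable).
Variable P : probability T R.

Lemma Gset_setT : G setT.
Proof. by apply: (Gset_sub_measurable sG). Qed.

Lemma Gset_setC A : G A -> G (~` A).
Proof.
move=> /(sub_measurable_Gset sG) mA; apply: (Gset_sub_measurable sG).
exact: measurableC.
Qed.

Lemma Gset_setI A B : G A -> G B -> G (A `&` B).
Proof.
move=> /(sub_measurable_Gset sG) mA /(sub_measurable_Gset sG) mB.
exact/(Gset_sub_measurable sG)/measurableI.
Qed.

Lemma ge0_integrable_le1 (m : {finite_measure set T -> \bar R}) (f : T -> R) D :
  measurable D -> measurable_fun setT f ->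
  (forall x, (0 <= f x <= 1)%R) -> m.-integrable D (EFin \o f).
Proof.
move=> mD mf f01; apply: (@le_integrable _ _ _ m D mD (EFin \o f) (cst 1)) => //.
- by apply/measurable_EFinP; exact: measurable_funTS.
- move=> x _ /=; have /andP[f0 f1] := f01 x.
  by rewrite ger0_norm// normr1 lee_fin.
- exact: finite_measure_integrable_cst.
Qed.

(** Uniqueness of the conditional expectation. On the trace space the hypothesis concerns all
    measurable sets, and a null set of the trace is a null set of [P]. *)
Lemma Gmeas_ae_unique (f g : T -> R) : Gmeas G f -> Gmeas G g ->
  P.-integrable setT (EFin \o f) -> P.-integrable setT (EFin \o g) ->
  (forall A, G A -> \int[P]_(x in A) (f x)%:E = \int[P]_(x in A) (g x)%:E) ->
  {ae P, forall x, f x = g x}.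
Proof.
move=> Gf Gg intf intg fg.
have mf : measurable_fun (setT : set (g_sigma_algebraType G)) (EFin \o f).
  exact/measurable_EFinP/GmeasP.
have mg : measurable_fun (setT : set (g_sigma_algebraType G)) (EFin \o g).
  exact/measurable_EFinP/GmeasP.
have [N [mN N0 subN]] : ae_eq (trace_measure sG GM P) setT (EFin \o f) (EFin \o g).
  apply: integral_ae_eq => //; first exact: integrable_trace.
  move=> E _ mE; have GE : G E by exact: (Gset_sub_measurable sG).
  have mE' := GM GE.
  rewrite !integral_trace//; first exact: fg.
    by apply: (integrableS measurableT).
  by apply: (integrableS measurableT).
exists N; split => //.
- exact/GM/(Gset_sub_measurable sG).
- move=> x /= fgx; apply: subN => /= h; apply: fgx.
  by have [] := h Logic.I.
Qed.

(** The Radon-Nikodym derivative, on [G], of the measure of density [phi]; boundedness of [phi]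
    makes this measure finite. *)
Lemma cond_expectation1 (phi : T -> R) : measurable_fun setT phi ->
  (forall x, (0 <= phi x <= 1)%R) ->
  exists f : T -> R, [/\ Gmeas G f, forall x, (0 <= f x)%R,
    P.-integrable setT (EFin \o f) &
    forall A, G A -> \int[P]_(x in A) (f x)%:E = \int[P]_(x in A) (phi x)%:E].
Proof.
move=> mphi phi01.
have phi0 x : (0 <= phi x)%R by case/andP: (phi01 x).
have finphi : fin_num_fun (mdensity P phi0 mphi).
  move=> A mA; rewrite /mdensity; apply: integrable_fin_num => //.
  exact: ge0_integrable_le1.
pose nu : {finite_measure set T -> \bar R} := HB.pack (mdensity P phi0 mphi)
  (Measure_isFinite.Build _ _ _ (mdensity P phi0 mphi) finphi).
have dom : trace_measure sG GM nu `<< trace_measure sG GM P.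
  apply/null_content_dominatesP => A mA /=; rewrite /trace_measure => PA0.
  rewrite /nu /= /mdensity; apply: null_set_integral => //.
  + exact/GM/(Gset_sub_measurable sG).
  + by apply/measurable_EFinP; exact: measurable_funTS.
have [f0 [f0ge0 f0fin intf0 f0E]] := radon_nikodym_sigma_finite dom.
have mf0 : measurable_fun (setT : set (g_sigma_algebraType G)) f0.
  exact: measurable_int intf0.
have fE x : (fine (f0 x))%:E = f0 x by rewrite fineK.
have Gf : Gmeas G (fine \o f0).
  apply/GmeasP => //; apply/measurable_EFinP.
  by apply: (eq_measurable_fun f0) => // x _; rewrite /= fE.
have f0A A : G A ->
    \int[P]_(x in A) (fine (f0 x))%:E = \int[P]_(x in A) (phi x)%:E.
  move=> GA; under eq_integral do rewrite fE.
  rewrite -(@ge0_integral_trace _ _ _ _ sG GM P)//.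
  by rewrite -f0E//; exact: (sub_measurable_Gset sG).
exists (fine \o f0); split => //.
- by move=> x; rewrite /= fine_ge0.
- apply/integrableP; split.
    apply/measurable_EFinP; exact: Gmeas_measurable Gf.
  under eq_integral do rewrite /= ger0_norm ?fine_ge0//.
  rewrite (f0A setT Gset_setT).
  have : P.-integrable setT (EFin \o phi) by exact: ge0_integrable_le1.
  move=> /(integrable_fin_num measurableT) /=.
  by rewrite fin_numE => /andP[_]; rewrite ltey.
Qed.


(** The point is that the conditional expectations sum to 1 everywhere and not only almost surely,
    as the field [wt_sum1] of a weight demands. *)
Lemma cond_expectation_partition (I : finType) (phi : I -> T -> R) :
  (forall i, measurable_fun setT (phi i)) -> (forall i x, (0 <= phi i x)%R) ->
  (forall x, (\sum_i phi i x = 1)%R) ->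
  exists f : I -> T -> R, [/\ forall i, Gmeas G (f i),
    forall i x, (0 <= f i x)%R, forall x, (\sum_i f i x = 1)%R &
    forall i A, G A ->
      \int[P]_(x in A) (f i x)%:E = \int[P]_(x in A) (phi i x)%:E].
Proof.
move=> mphi phi0 phi1.
have phi01 i x : (0 <= phi i x <= 1)%R.
  by rewrite phi0/= -(phi1 x) (bigD1 i)//= lerDl sumr_ge0.
have [i0 _] : exists i0 : I, true.
  apply: contrapT => noI; have := phi1 point; rewrite big1.
    by move=> /esym/eqP; rewrite oner_eq0.
  by move=> i _; exfalso; apply: noI; exists i.
have /choice[f0 f0P] := fun i => cond_expectation1 (mphi i) (phi01 i).
pose S x := (\sum_i f0 i x)%R.
have mGf0 i : measurable_fun (setT : set (g_sigma_algebraType G)) (f0 i).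
  by apply/GmeasP => //; have [] := f0P i.
have GS : Gmeas G S by apply/GmeasP => //; exact: measurable_sum.
have f00 i x : (0 <= f0 i x)%R by have [] := f0P i.
have mf0 i : measurable_fun setT (f0 i).
  by have [h _ _ _] := f0P i; exact: Gmeas_measurable h.
have SE x : (S x)%:E = \sum_i (f0 i x)%:E by rewrite sumEFin.
have intS : P.-integrable setT (EFin \o S).
  apply: (eq_integrable measurableT (fun x => \sum_i (f0 i x)%:E)) => //.
    by move=> x _; rewrite /= SE.
  by apply: integrable_sum => // i _; have [] := f0P i.
have S1 : {ae P, forall x, S x = cst 1%R x}.
  apply: Gmeas_ae_unique => //.
  - by apply/GmeasP => //; exact: measurable_cst.
  - exact: finite_measure_integrable_cst.
  move=> A GA; have mA := GM GA.
  under eq_integral do rewrite SE.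
  rewrite ge0_integral_sum//; last 2 first.
    by move=> i; apply/measurable_EFinP; exact: measurable_funTS.
    by move=> i x _; rewrite lee_fin.
  rewrite (eq_bigr (fun i => \int[P]_(x in A) (phi i x)%:E)); last first.
    by move=> i _; have [_ _ _ ->] := f0P i.
  rewrite -ge0_integral_sum//; last 2 first.
    by move=> i; apply/measurable_EFinP; exact: measurable_funTS.
    by move=> i x _; rewrite lee_fin.
  by apply: eq_integral => x _; rewrite sumEFin phi1.
(* On the null set where the versions do not sum to 1, which belongs to [G], all the mass is given
   to [i0]; no integral changes. *)
exists (fun i x => if S x == 1%R then f0 i x else (i == i0)%:R).
have mGf i : measurable_fun (setT : set (g_sigma_algebraType G))
    (fun x => if S x == 1%R then f0 i x else (i == i0)%:R).
  apply: measurable_fun_ifT => //.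
  by apply: measurable_fun_eqr => //; exact/GmeasP.
split => [i|i x|x|i A GA].
- exact/GmeasP.
- by case: ifP.
- have [//|_] := eqVneq (S x) 1%R.
  by rewrite (bigD1 i0)//= eqxx big1 ?addr0// => i /negbTE->.
- have mA := GM GA; have [_ _ _ <-//] := f0P i.
  apply: ge0_ae_eq_integral => //.
  + apply/measurable_EFinP/measurable_funTS.
    by apply: (Gmeas_measurable GM); exact/GmeasP.
  + by apply/measurable_EFinP; exact: measurable_funTS.
  + by move=> x _; rewrite lee_fin; case: ifP.
  + by move=> x _; rewrite lee_fin.
  + case: S1 => N [mN N0 subN]; exists N; split => //.
    move=> x /= h; apply: subN => /= Sx; apply: h => _.
    by rewrite Sx eqxx.
Qed.

(** The case of the partition [phi], [1 - phi], which yields the bounds 0 and 1 everywhere. *)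
Lemma cond_expectation (phi : T -> R) : measurable_fun setT phi ->
  (forall x, (0 <= phi x <= 1)%R) ->
  exists f : T -> R, [/\ Gmeas G f, forall x, (0 <= f x <= 1)%R &
    forall A, G A -> \int[P]_(x in A) (f x)%:E = \int[P]_(x in A) (phi x)%:E].
Proof.
move=> mphi phi01.
have [||x|f [Gf f0 f1 fE]] := @cond_expectation_partition bool
  (fun b x => if b then phi x else (1 - phi x)%R).
- by case=> //; exact: measurable_funB.
- by case=> x; have /andP[? ?] := phi01 x; rewrite ?subr_ge0.
- by rewrite big_bool/= addrC subrK.
exists (f true); split => //; last by move=> A /(fE true).
by move=> x; rewrite f0/= -(f1 x) big_bool/= lerDl.
Qed.

End cond_expectation.

Section conditional_independence.
Local Open Scope ereal_scope.
Context (R : realType) d (T : measurableType d) (P : probability T R).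
Variables F1 F2 G : set (set T).
Hypotheses (sF1 : sigma_algebra setT F1) (F1M : F1 `<=` measurable).
Hypotheses (sF2 : sigma_algebra setT F2) (F2M : F2 `<=` measurable).
Hypotheses (sG : sigma_algebra setT G) (GM : G `<=` measurable).

Lemma integral_mul_indic (f : T -> R) A D : measurable A -> measurable D ->
  \int[P]_(x in D) (f x * \1_A x)%:E = \int[P]_(x in D `&` A) (f x)%:E.
Proof.
move=> mA mD; rewrite integral_mkcondr.
by apply: eq_integral => x _; rewrite EFinM epatch_indic.
Qed.

Let indic01 (A : set T) x : (0 <= (\1_A x : R) <= 1)%R.
Proof. by rewrite indicE; case: (x \in A); rewrite !lexx ler01. Qed.

Lemma integral_indic_setI A B : measurable A -> measurable B ->
  \int[P]_(x in B) (\1_A x)%:E = P (A `&` B).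
Proof. by move=> mA mB; rewrite integral_indic. Qed.

(** With [f] and [g] the conditional probabilities of [A] and [B] given [G], one has P(A and B) =
    E[f g] = E[f 1_B]: on the sets of [F2], [f] integrates like the indicator of [A]. *)
Lemma cond_independent_integral_set A B : cond_independent P F1 F2 G ->
  F1 A -> F2 B -> forall f, Gmeas G f -> (forall x, (0 <= f x <= 1)%R) ->
  (forall C, G C -> \int[P]_(x in C) (f x)%:E = P (A `&` C)) ->
  P (A `&` B) = \int[P]_(x in B) (f x)%:E.
Proof.
move=> ci FA FB f Gf f01 fE.
have mA := F1M FA; have mB := F2M FB.
have mf := Gmeas_measurable GM Gf.
have [g [Gg g01 gE]] := cond_expectation sG GM P (measurable_indic mB) (indic01 B).
have mg := Gmeas_measurable GM Gg.
have f0 x : (0 <= f x)%R by case/andP: (f01 x).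
have g0 x : (0 <= g x)%R by case/andP: (g01 x).
(* The versions supplied by [ci] need not be bounded; they agree almost surely with [f] and [g],
   which are. *)
have [f' [g' [h [[Gf' intf' f'E] [Gg' intg' g'E] [Gh inth hE] hfg]]]] := ci A B FA FB.
have ff' : {ae P, forall x, f x = f' x}.
  apply: (Gmeas_ae_unique sG GM) => //; first exact: ge0_integrable_le1.
  by move=> C GC; rewrite fE// f'E.
have gg' : {ae P, forall x, g x = g' x}.
  apply: (Gmeas_ae_unique sG GM) => //; first exact: ge0_integrable_le1.
  by move=> C GC; rewrite gE// g'E// integral_indic_setI//; exact: GM.
have GT := Gset_setT sG.
have -> : P (A `&` B) = \int[P]_x (h x)%:E by rewrite hE// setIT.
transitivity (\int[P]_x (f x * g x)%:E).
  apply: ae_eq_integral => //.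
  + by case/integrableP : inth.
  + by apply/measurable_EFinP; exact: measurable_funM.
  + apply: filterS3 hfg ff' gg' => x /= -> -> -> //.
rewrite (integral_Gmeas_mulr sG GM (phi := g) (psi := \1_B) (g := f) (D := setT) (P := P))//.
by rewrite integral_mul_indic// setTI.
Qed.

(** The conditional expectation [g] of [s] given [G] also integrates like [s] on [F1]: if [f] is the
    conditional probability of [A] given [G], then E[s 1_A] = E[s f] = E[g f] = E[g 1_A], and only
    the first equality uses conditional independence. *)
Lemma cond_independent_integral : cond_independent P F1 F2 G ->
  forall s, Gmeas F2 s -> (forall x, (0 <= s x <= 1)%R) ->
  exists g, [/\ Gmeas G g, forall x, (0 <= g x <= 1)%R &
    forall A, F1 A -> \int[P]_(x in A) (s x)%:E = \int[P]_(x in A) (g x)%:E].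
Proof.
move=> ci s Fs s01; have ms := Gmeas_measurable F2M Fs.
have [g [Gg g01 gE]] := cond_expectation sG GM P ms s01.
have mg := Gmeas_measurable GM Gg.
exists g; split => // A FA; have mA := F1M FA.
have [f [Gf f01 fE]] := cond_expectation sG GM P (measurable_indic mA) (indic01 A).
have mf := Gmeas_measurable GM Gf.
have s0 x : (0 <= s x)%R by case/andP: (s01 x).
have f0 x : (0 <= f x)%R by case/andP: (f01 x).
have g0 x : (0 <= g x)%R by case/andP: (g01 x).
have GT := Gset_setT sG.
rewrite -[A]setTI -!integral_mul_indic//.
transitivity (\int[P]_x (s x * f x)%:E).
  apply: (integral_Gmeas_mulr sF2 F2M (phi := \1_A) (psi := f)) => //.
    move=> B FB; rewrite integral_indic_setI//; last exact: F2M.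
    apply: cond_independent_integral_set => // C GC.
    by rewrite fE// integral_indic_setI//; exact: GM.
  exact: Gset_setT sF2.
transitivity (\int[P]_x (f x * g x)%:E).
  under eq_integral do rewrite mulrC.
  by apply: (integral_Gmeas_mulr sG GM (phi := s) (psi := g)) => // B GB; rewrite gE.
under eq_integral do rewrite mulrC.
by apply: (integral_Gmeas_mulr sG GM (phi := f) (psi := \1_A)).
Qed.

(** A converse criterion: if [g] integrates like the indicator of [B] on all of [F1], then the
    conditional probability of [A] and [B] given [G] is [g] times that of [A]. *)
Lemma cond_independentP : G `<=` F1 ->
  (forall B, F2 B -> exists g, [/\ Gmeas G g, forall x, (0 <= g x)%R,
    P.-integrable setT (EFin \o g) &
    forall A, F1 A -> P (A `&` B) = \int[P]_(x in A) (g x)%:E]) ->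
  cond_independent P F1 F2 G.
Proof.
move=> GF H A B FA FB; have [g [Gg g0 ig gE]] := H B FB.
have mA := F1M FA; have mB := F2M FB.
have [f [Gf f01 fE]] := cond_expectation sG GM P (measurable_indic mA) (indic01 A).
have mf := Gmeas_measurable GM Gf.
have mg := Gmeas_measurable GM Gg.
have f0 x : (0 <= f x)%R by case/andP: (f01 x).
have Gh : Gmeas G (fun x => (g x * f x)%R).
  by apply/GmeasP => //; apply: measurable_funM; exact/GmeasP.
exists f, g, (fun x => (g x * f x)%R); split.
- split => //; first exact: ge0_integrable_le1.
  by move=> C GC; rewrite fE// integral_indic_setI//; exact: GM.
- split => //.
  by move=> C GC; rewrite setIC (gE C)//; exact: GF.
- split => //.
    apply: le_integrable ig => //.
      by apply/measurable_EFinP; exact: Gmeas_measurable Gh.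
    move=> x _ /=; rewrite normrM lee_fin ler_piMr//.
    by rewrite ger0_norm//; case/andP: (f01 x).
  move=> C GC; have mC := GM GC.
  rewrite (integral_Gmeas_mulr sG GM (phi := f) (psi := \1_A))//.
  have FCA : F1 (C `&` A) by apply: (Gset_setI sF1) => //; exact: GF.
  rewrite integral_mul_indic// -(gE _ FCA); congr (P _).
  by rewrite -setIA [LHS]setIC.
- by apply: aeW => x; rewrite mulrC.
Qed.

End conditional_independence.

(** * The cost of a pair of paths *)

Section minkowski.
Context (R : realType) (p : R).
Hypothesis p_ge1 : 1 <= p.

Let p_gt0 : 0 < p. Proof. exact: lt_le_trans ltr01 p_ge1. Qed.

Lemma powRVr (x r : R) : 0 <= x -> x^-1 `^ r = (x `^ r)^-1.
Proof. by move=> x0; rewrite -powR_inv1// powRAC powR_inv1// powR_ge0. Qed.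

(** Convexity of the power at [a + b = l (a / l) + (1 - l) (b / (1 - l))]. The bound is linear in
    the p-th powers, hence can be integrated; Minkowski's inequality is recovered by choosing [l]
    afterwards. *)
Lemma powR_convex_comb (l a b : R) : 0 < l < 1 -> 0 <= a -> 0 <= b ->
  (a + b) `^ p <= l `^ (1 - p) * a `^ p + (1 - l) `^ (1 - p) * b `^ p.
Proof.
move=> /andP[l0 l1] a0 b0.
have l1' : 0 < 1 - l by rewrite subr_gt0.
have powE (m c : R) : 0 < m -> 0 <= c ->
    m `^ (1 - p) * c `^ p = m * (c / m) `^ p.
  move=> m0 c0; rewrite powRM ?invr_ge0 ?(ltW m0)// powRVr ?ltW//.
  rewrite powRB ?(gt_eqF m0) ?implybT// powRr1 ?ltW//.
  by rewrite mulrAC -!mulrA.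
rewrite powE// powE//.
have := convex_powR p_ge1 (Itv01 (ltW l0) (ltW l1)) (x := a / l) (y := b / (1 - l)).
rewrite !inE /= !in_itv/= !divr_ge0 ?(ltW l0) ?(ltW l1')//= => /(_ isT isT).
rewrite !convRE/= /unstable.onem.
have divK (m c : R) : 0 < m -> m * (c / m) = c.
  by move=> m0; rewrite mulrC divfK ?gt_eqF.
move=> H; have -> : a + b = l * (a / l) + (1 - l) * (b / (1 - l)).
  by rewrite !divK.
exact: H.
Qed.

Definition pcost (N : nat) (x y : 'I_N -> R) : R :=
  \sum_(t < N) `|x t - y t| `^ p.

Lemma pcost_ge0 N (x y : 'I_N -> R) : 0 <= pcost x y.
Proof. by apply: sumr_ge0 => t _; exact: powR_ge0. Qed.

Lemma pcostC N (x y : 'I_N -> R) : pcost x y = pcost y x.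
Proof. by apply: eq_bigr => t _; rewrite distrC. Qed.

Lemma pcost_triangle N (l : R) (x y z : 'I_N -> R) : 0 < l < 1 ->
  pcost x z <= l `^ (1 - p) * pcost x y + (1 - l) `^ (1 - p) * pcost y z.
Proof.
move=> l01; rewrite /pcost !mulr_sumr -big_split/=; apply: ler_sum => t _.
apply: le_trans (powR_convex_comb l01 (normr_ge0 _) (normr_ge0 _)).
apply: ge0_ler_powR; rewrite ?nnegrE ?addr_ge0//; first exact: ltW.
by rewrite (le_trans _ (ler_normD _ _))// addrA subrK.
Qed.

(* the weight [a / (a + b)] is optimal in [pcost_triangle] *)
Lemma minkowski_comb (A B C : \bar R) (a b : R) : 0 < a -> 0 < b ->
  (0 <= A)%E -> (0 <= B)%E ->
  (forall l, 0 < l < 1 ->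
    (C <= (l `^ (1 - p))%:E * A + ((1 - l) `^ (1 - p))%:E * B)%E) ->
  (A <= (a `^ p)%:E)%E -> (B <= (b `^ p)%:E)%E -> (C <= ((a + b) `^ p)%:E)%E.
Proof.
move=> a0 b0 A0 B0 H Aa Bb.
have ab0 : 0 < a + b by exact: addr_gt0.
have l01 : 0 < a / (a + b) < 1.
  by rewrite divr_gt0//= ltr_pdivrMr// mul1r ltrDl.
apply: (le_trans (H _ l01)).
have -> : 1 - a / (a + b) = b / (a + b) by field; rewrite gt_eqF.
have key (c : R) : 0 < c ->
    (c / (a + b)) `^ (1 - p) * c `^ p = c * (a + b) `^ (p - 1).
  move=> c0; rewrite powRM ?invr_ge0 ?ltW// powRVr ?ltW// -powRN opprB.
  by rewrite mulrAC -powRD ?(gt_eqF c0) ?implybT// subrK powRr1 ?ltW.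
apply: (@le_trans _ _ (((a / (a + b)) `^ (1 - p) * a `^ p +
   (b / (a + b)) `^ (1 - p) * b `^ p)%:E)).
  rewrite EFinD !EFinM; apply: leeD; apply: lee_wpmul2l => //;
  by rewrite lee_fin powR_ge0.
by rewrite !key// -mulrDl lee_fin (mulr_powRB1 (ltW ab0) p_gt0).
Qed.

End minkowski.

(** * Finite models of a process *)

Section finite_models.
Context (R : realType) (n : nat).
Local Notation N := n.+1.

Record fmodel := FModel {
  fm_idx : finType;
  fm_pt : fm_idx -> N.-tuple R;
  fm_wt : fm_idx -> R;
  fm_inj : injective fm_pt;
  fm_ge0 : forall i, 0 <= fm_wt i;
  fm_sum : \sum_i fm_wt i = 1
}.

Definition past (t : 'I_N) (x : N.-tuple R) : {ffun 'I_N -> R} :=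
  [ffun s : 'I_N => if (s <= t)%N then tnth x s else 0].

Lemma pastP t x y : past t x = past t y <->
  forall s : 'I_N, (s <= t)%N -> tnth x s = tnth y s.
Proof.
split=> [/ffunP h s st|h]; first by have := h s; rewrite !ffunE st.
by apply/ffunP => s; rewrite !ffunE; case: ifP => // /h.
Qed.

Definition same_past (f : fmodel) (t : 'I_N) (i j : fm_idx f) : bool :=
  past t (fm_pt i) == past t (fm_pt j).

(* [k i w] is the conditional probability, given [w], that a coupling of [f] and
   [X] assigns the path [fm_pt i]; [wt_adapted] and [wt_causal] are its
   causality in the two directions. *)
Record is_weight (f : fmodel) (X : filtered_process R N)
    (k : fm_idx f -> fp_space X -> R) : Prop := IsWeight {
  wt_meas : forall i, Gmeas (fp_filtration X ord_max) (k i);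
  wt_ge0 : forall i w, 0 <= k i w;
  wt_sum1 : forall w, \sum_i k i w = 1;
  wt_mass : forall i, (\int[fp_prob X]_w (k i w)%:E = (fm_wt i)%:E)%E;
  wt_adapted : forall t i, exists s : fp_space X -> R,
    [/\ Gmeas (fp_filtration X t) s, forall w, 0 <= s w <= 1 &
      forall A, fp_filtration X ord_max A ->
        (\int[fp_prob X]_(w in A) (\sum_(j | same_past t i j) k j w)%:E =
         \int[fp_prob X]_(w in A) (s w)%:E)%E];
  wt_causal : forall t i B, fp_filtration X t B ->
    ((\sum_(j | same_past t i j) fm_wt j)%:E * \int[fp_prob X]_(w in B) (k i w)%:E =
     (fm_wt i)%:E * \int[fp_prob X]_(w in B) (\sum_(j | same_past t i j) k j w)%:E)%E
}.

Definition fp_path (X : filtered_process R N) (w : fp_space X) : 'I_N -> R :=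
  fun t => fp_process X t w.

Definition weight_cost (p : R) (f : fmodel) (X : filtered_process R N)
    (k : fm_idx f -> fp_space X -> R) : \bar R :=
  (\sum_i \int[fp_prob X]_w (k i w * pcost p (tnth (fm_pt i)) (fp_path w))%:E)%E.

Definition near_model (p : R) (f : fmodel) (X : filtered_process R N) (c : R) :=
  exists2 k : fm_idx f -> fp_space X -> R, is_weight k & (weight_cost p k <= (c `^ p)%:E)%E.

End finite_models.

Section image_integral.
Local Open Scope ereal_scope.
Context (R : realType) d (T : measurableType d) d' (S : measurableType d').
Variables (m : {measure set T -> \bar R}) (m' : {measure set S -> \bar R}).
Variable q : T -> S.
Hypothesis mq : measurable_fun setT q.
Hypothesis mm' : forall A, measurable A -> m (q @^-1` A) = m' A.

Lemma ge0_integral_image (B : set S) (g : S -> \bar R) : measurable B ->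
  measurable_fun setT g -> (forall x, 0 <= g x) ->
  \int[m]_(w in q @^-1` B) g (q w) = \int[m']_(x in B) g x.
Proof.
move=> mB mg g0; rewrite -(ge0_integral_pushforward mq m)//; last exact: measurable_funTS.
by apply: eq_measure_integral => A mA _; exact: mm'.
Qed.

Lemma ge0_integral_imageT (g : S -> \bar R) :
  measurable_fun setT g -> (forall x, 0 <= g x) ->
  \int[m]_w g (q w) = \int[m']_x g x.
Proof. by move=> mg g0; rewrite -(ge0_integral_image measurableT mg g0) preimage_setT. Qed.

End image_integral.

Section factor.
Context (R : realType) (T S : Type) (q : T -> S) (r : S -> T).
Hypothesis rK : cancel r q.

Lemma preimage_section_inj (A B : set S) : q @^-1` A = q @^-1` B -> A = B.
Proof.
move=> AB; apply/seteqP; split => x Ax.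
  by have : (q @^-1` A) (r x) by [rewrite /preimage/= rK]; rewrite AB /preimage/= rK.
by have : (q @^-1` B) (r x) by [rewrite /preimage/= rK]; rewrite -AB /preimage/= rK.
Qed.

(** The level set of [f] through [w] is a preimage under [q], so [f] is constant on the fibres of
    [q] and factors through the section [r]. *)
Lemma Gmeas_factor (F : set (set S)) (f : T -> R) :
  Gmeas (preimage_set_system setT q F) f ->
  Gmeas F (f \o r) /\ forall w, f w = f (r (q w)).
Proof.
move=> Gf.
have fE w : f w = f (r (q w)).
  have [B FB BE] : preimage_set_system setT q F (f @^-1` [set f w]).
    by apply: Gf; exists [set f w] => //; rewrite setTI.
  have : (f @^-1` [set f w]) w by [].
  rewrite -BE setTI /preimage/= => Bw.
  have : (f @^-1` [set f w]) (r (q w)) by rewrite -BE setTI /preimage/= rK.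
  by [].
split => // _ [C mC <-]; rewrite setTI.
have [B FB BE] : preimage_set_system setT q F (f @^-1` C).
  by apply: Gf; exists C => //; rewrite setTI.
suff <- : B = (f \o r) @^-1` C by [].
apply: preimage_section_inj; move: BE; rewrite setTI => ->.
by apply/seteqP; split => w; rewrite /preimage/= -fE.
Qed.

Lemma Gmeas_comp (F : set (set S)) (g : S -> R) :
  Gmeas F g -> Gmeas (preimage_set_system setT q F) (g \o q).
Proof.
move=> Gg _ [C mC <-]; exists (g @^-1` C); last by rewrite !setTI.
by apply: Gg; exists C => //; rewrite setTI.
Qed.

End factor.

Section filtrations.
Context (R : realType) (n : nat) (X Y : filtered_process R n.+1).
Variable pi : probability (coupling_space X Y) R.

Local Notation F1 t := (filtration_fst (Y := Y) t : set (set (coupling_space X Y))).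
Local Notation F2 t := (filtration_snd (X := X) t : set (set (coupling_space X Y))).

Lemma filtration_fst_sigma_algebra t : sigma_algebra setT (F1 t).
Proof. exact: sigma_algebra_preimage (fp_sigma_algebra X t). Qed.

Lemma filtration_snd_sigma_algebra t : sigma_algebra setT (F2 t).
Proof. exact: sigma_algebra_preimage (fp_sigma_algebra Y t). Qed.

Lemma filtration_fst_measurable t : F1 t `<=` measurable.
Proof.
move=> _ [B FB <-]; apply: measurable_fst => //.
exact: (fp_sub_measurable FB).
Qed.

Lemma filtration_snd_measurable t : F2 t `<=` measurable.
Proof.
move=> _ [B FB <-]; apply: measurable_snd => //.
exact: (fp_sub_measurable FB).
Qed.

End filtrations.

Section process_measurability.
Context (R : realType) (n : nat) (X : filtered_process R n.+1).

Lemma fp_process_Gmeas t : Gmeas (fp_filtration X t) (fp_process X t).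
Proof. exact: fp_adapted. Qed.
Arguments fp_process_Gmeas : clear implicits.

Lemma Gmeas_sub (s t : 'I_n.+1) (f : fp_space X -> R) : (s <= t)%N ->
  Gmeas (fp_filtration X s) f -> Gmeas (fp_filtration X t) f.
Proof. by move=> st Gf; apply: subset_trans Gf _; exact: fp_filtration_le. Qed.

Lemma Gmeas_last (t : 'I_n.+1) (f : fp_space X -> R) :
  Gmeas (fp_filtration X t) f -> Gmeas (fp_filtration X ord_max) f.
Proof. by apply: Gmeas_sub; rewrite -ltnS. Qed.

Lemma fp_Gmeas_measurable t (f : fp_space X -> R) :
  Gmeas (fp_filtration X t) f -> measurable_fun setT f.
Proof. by apply: Gmeas_measurable => A /fp_sub_measurable. Qed.

Lemma fp_process_measurable t : measurable_fun setT (fp_process X t).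
Proof. exact: fp_Gmeas_measurable (fp_process_Gmeas t). Qed.

Lemma measurable_pcost (p : R) d (T : measurableType d) (u v : 'I_n.+1 -> T -> R) :
  (forall t, measurable_fun setT (u t)) -> (forall t, measurable_fun setT (v t)) ->
  measurable_fun setT (fun w => pcost p (u^~ w) (v^~ w)).
Proof.
move=> mu mv; apply: measurable_sum => t.
apply: (measurableT_comp (measurable_powR p)).
apply: measurableT_comp => //.
exact: measurable_funB.
Qed.

Lemma Gmeas_pcost (p : R) (z : 'I_n.+1 -> R) :
  Gmeas (fp_filtration X ord_max) (fun w => pcost p z (fp_path w)).
Proof.
have sG := fp_sigma_algebra X ord_max.
apply/(GmeasP sG); apply: measurable_sum => t.
apply: (measurableT_comp (measurable_powR p)).
apply: measurableT_comp => //.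
apply: measurable_funB; first exact: measurable_cst.
apply/(GmeasP sG); exact: Gmeas_last (fp_process_Gmeas t).
Qed.

End process_measurability.

Arguments wt_meas {R n f X k} _ i _ _.

Section weight_measurability.
Context (R : realType) (n : nat) (f : fmodel R n) (X : filtered_process R n.+1).
Variable k : fm_idx f -> fp_space X -> R.
Hypothesis wk : is_weight k.

Lemma wt_measurable i : measurable_fun setT (k i).
Proof. exact: fp_Gmeas_measurable (wt_meas wk i). Qed.

Lemma wt_le1 i w : 0 <= k i w <= 1.
Proof.
rewrite wt_ge0//= -(wt_sum1 wk w) (bigD1 i)//= lerDl.
by apply: sumr_ge0 => j _; exact: wt_ge0.
Qed.

Lemma wt_sum_ge0 (Q : pred (fm_idx f)) w : 0 <= \sum_(j | Q j) k j w.
Proof. by apply: sumr_ge0 => j _; exact: wt_ge0. Qed.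

Lemma wt_sum_le1 (Q : pred (fm_idx f)) w : 0 <= \sum_(j | Q j) k j w <= 1.
Proof.
rewrite wt_sum_ge0/= -(wt_sum1 wk w) [leRHS](bigID Q)/= lerDl.
exact: wt_sum_ge0.
Qed.

Lemma wt_sum_Gmeas (Q : pred (fm_idx f)) :
  Gmeas (fp_filtration X ord_max) (fun w => \sum_(j | Q j) k j w).
Proof.
have sG := fp_sigma_algebra X ord_max.
under [X in Gmeas _ X]eq_fun do rewrite big_mkcond.
apply/(GmeasP sG); apply: measurable_sum => j.
by case: (Q j); [apply/(GmeasP sG); exact: wt_meas|exact: measurable_cst].
Qed.

Arguments wt_sum_Gmeas : clear implicits.

Lemma wt_sum_measurable (Q : pred (fm_idx f)) :
  measurable_fun setT (fun w => \sum_(j | Q j) k j w).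
Proof. exact: fp_Gmeas_measurable (wt_sum_Gmeas Q). Qed.

Lemma integral_wt_sum (Q : pred (fm_idx f)) A : measurable A ->
  (\int[fp_prob X]_(w in A) (\sum_(j | Q j) k j w)%:E =
   \sum_(j | Q j) \int[fp_prob X]_(w in A) (k j w)%:E)%E.
Proof.
move=> mA; under eq_integral do rewrite -sumEFin big_mkcond.
rewrite ge0_integral_sum//; last 2 first.
- move=> j; case: (Q j) => //; apply/measurable_EFinP/measurable_funTS.
  exact: wt_measurable.
- by move=> j w _; case: (Q j) => //; rewrite lee_fin wt_ge0.
rewrite [RHS]big_mkcond; apply: eq_bigr => j _; case: (Q j) => //.
by rewrite integral0.
Qed.

End weight_measurability.

(** * Transport of weights along a bicausal coupling *)

Section transfer.
Local Open Scope ereal_scope.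
Context (R : realType) (n : nat) (p : R) (p_ge1 : (1 <= p)%R).
Variables (f : fmodel R n) (X Y : filtered_process R n.+1).
Variables (k : fm_idx f -> fp_space X -> R) (wk : is_weight k).
Variables (pi : probability (coupling_space X Y) R) (bc : Cpl_bc pi).

Let pi_fst A : measurable A -> pi (fst @^-1` A) = fp_prob X A.
Proof. by case: bc => [[h _] _ _]; exact: h. Qed.

Let pi_snd A : measurable A -> pi (snd @^-1` A) = fp_prob Y A.
Proof. by case: bc => [[_ h] _ _]; exact: h. Qed.

Let mfst : measurable_fun setT (fst : coupling_space X Y -> fp_space X).
Proof. exact: measurable_fst. Qed.

Let msnd : measurable_fun setT (snd : coupling_space X Y -> fp_space Y).
Proof. exact: measurable_snd. Qed.

Let sfst t := @filtration_fst_sigma_algebra R n X Y t.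
Let ssnd t := @filtration_snd_sigma_algebra R n X Y t.
Let Mfst t := @filtration_fst_measurable R n X Y t.
Let Msnd t := @filtration_snd_measurable R n X Y t.

Let rfst (x : fp_space X) : coupling_space X Y := (x, point).
Let rsnd (y : fp_space Y) : coupling_space X Y := (point, y).

Lemma transfer_weight : exists h : fm_idx f -> fp_space Y -> R,
  is_weight h /\ forall i B, fp_filtration Y ord_max B ->
    \int[fp_prob Y]_(y in B) (h i y)%:E =
    \int[pi]_(w in snd @^-1` B) (k i w.1)%:E.
Proof.
have mk i : measurable_fun setT (fun w : coupling_space X Y => k i w.1).
  exact: measurableT_comp (wt_measurable wk i) mfst.
have [//|i w|w|g [Gg g0 g1 gE]] := cond_expectation_partition (ssnd ord_max)
  (@Msnd ord_max) pi (phi := fun i (w : coupling_space X Y) => k i w.1).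
- exact: wt_ge0.
- exact: wt_sum1.
pose h i y := g i (rsnd y).
have Gh i : Gmeas (fp_filtration Y ord_max) (h i).
  by have [] := @Gmeas_factor R _ _ snd rsnd (fun=> erefl) _ _ (Gg i).
have hg i w : g i w = h i w.2.
  by have [_ ->] := @Gmeas_factor R _ _ snd rsnd (fun=> erefl) _ _ (Gg i).
have h0 i y : (0 <= h i y)%R by exact: g0.
have mh i : measurable_fun setT (h i) := fp_Gmeas_measurable (Gh i).
have hE i B : fp_filtration Y ord_max B ->
    \int[fp_prob Y]_(y in B) (h i y)%:E =
    \int[pi]_(w in snd @^-1` B) (k i w.1)%:E.
  move=> FB; rewrite -gE; last by exists B => //; rewrite setTI.
  under [RHS]eq_integral do rewrite hg.
  rewrite (ge0_integral_image msnd pi_snd (g := EFin \o h i))//.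
  - exact: fp_sub_measurable FB.
  - exact/measurable_EFinP.
  - by move=> y; rewrite lee_fin.
have hE' : forall (Q : pred (fm_idx f)) (B : set (fp_space Y)), fp_filtration Y ord_max B ->
    \int[fp_prob Y]_(y in B) (\sum_(j | Q j) h j y)%:E =
    \int[pi]_(w in snd @^-1` B) (\sum_(j | Q j) k j w.1)%:E.
  move=> Q B FB; have mB := fp_sub_measurable FB.
  have mB' : measurable (snd @^-1` B : set (coupling_space X Y)).
    by rewrite -[X in measurable X]setTI; exact: msnd.
  under eq_integral do rewrite -sumEFin big_mkcond.
  under [RHS]eq_integral do rewrite -sumEFin big_mkcond.
  rewrite !ge0_integral_sum//.
  - by apply: eq_bigr => j _; case: (Q j); rewrite ?integral0// hE.
  - move=> j; case: (Q j) => //; apply/measurable_EFinP; exact: measurable_funTS.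
  - by move=> j w _; case: (Q j) => //; rewrite lee_fin wt_ge0.
  - move=> j; case: (Q j) => //; apply/measurable_EFinP; exact: measurable_funTS.
  - by move=> j w _; case: (Q j) => //; rewrite lee_fin.
exists h; split => //; split => //.
- by move=> y; rewrite -[RHS](g1 (rsnd y)).
- move=> i; rewrite hE; last exact: Gset_setT (fp_sigma_algebra Y _).
  rewrite preimage_setT (ge0_integral_imageT mfst pi_fst (g := EFin \o k i)).
  + exact: wt_mass.
  + exact/measurable_EFinP/wt_measurable.
  + by move=> x; rewrite lee_fin wt_ge0.
- move=> t i; have [s [Gs s01 sE]] := wt_adapted wk t i.
  have s0 x : (0 <= s x)%R by case/andP: (s01 x).
  have ms := fp_Gmeas_measurable Gs.
  have aes : {ae fp_prob X, forall x, (\sum_(j | same_past t i j) k j x)%R = s x}.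
    apply: (Gmeas_ae_unique (fp_sigma_algebra X ord_max)).
    + by move=> A /fp_sub_measurable.
    + exact: wt_sum_Gmeas.
    + exact: Gmeas_last Gs.
    + apply: ge0_integrable_le1 => //; first exact: wt_sum_measurable.
      exact: wt_sum_le1.
    + exact: ge0_integrable_le1.
    + exact: sE.
  (* The class sum is almost surely the function [s] of the past of [X]; by anticausality, the
     conditional expectation of [s] given the whole of [Y] only uses the past of [Y]. *)
  case: bc => _ _ /(_ t ord_max erefl) ac.
  have [u [Gu u01 uE]] := cond_independent_integral (@Msnd ord_max)
    (sfst t) (@Mfst t) (ssnd t) (@Msnd t) ac (Gmeas_comp (q := fst) Gs)
    (fun w => s01 w.1).
  have [Gur ur] := @Gmeas_factor R _ _ snd rsnd (fun=> erefl) _ _ Gu.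
  exists (u \o rsnd); split => //; first by move=> y; exact: u01.
  move=> B FB; have mB := fp_sub_measurable FB.
  have mB' : measurable (snd @^-1` B : set (coupling_space X Y)).
    by rewrite -[X in measurable X]setTI; exact: msnd.
  rewrite hE'//.
  transitivity (\int[pi]_(w in snd @^-1` B) (s w.1)%:E).
    apply: ge0_ae_eq_integral => //.
    + apply/measurable_EFinP; apply: measurable_funTS.
      exact: measurableT_comp (wt_sum_measurable wk _) mfst.
    + apply/measurable_EFinP; apply: measurable_funTS.
      exact: measurableT_comp ms mfst.
    + by move=> w _; rewrite lee_fin wt_sum_ge0.
    + by move=> w _; rewrite lee_fin.
    + case: aes => M [mM M0 subM]; exists (fst @^-1` M); split.
      * by rewrite -[X in measurable X]setTI; exact: mfst.
      * exact: etrans (pi_fst mM) M0.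
      * move=> w /= ne; apply: subM => /= e; apply: ne => _; congr (_%:E).
        exact: e.
  rewrite uE; last by exists B => //; rewrite setTI.
  under eq_integral do rewrite ur.
  rewrite (ge0_integral_image msnd pi_snd (g := EFin \o (u \o rsnd)))//.
  + by apply/measurable_EFinP; exact: fp_Gmeas_measurable Gur.
  + by move=> y; rewrite lee_fin; case/andP: (u01 (rsnd y)).
- move=> t i B FB.
  have FB' : fp_filtration Y ord_max B.
    by apply: (fp_filtration_le _ FB); rewrite -ltnS.
  have mB := fp_sub_measurable FB.
  have mB' : measurable (snd @^-1` B : set (coupling_space X Y)).
    by rewrite -[X in measurable X]setTI; exact: msnd.
  rewrite hE'// hE//.
  have i01 (w : coupling_space X Y) : (0 <= (\1_(snd @^-1` B) w : R) <= 1)%R.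
    by rewrite indicE; case: (w \in _); rewrite !lexx ler01.
  have Gi : Gmeas (filtration_snd (X := X) t) (\1_(snd @^-1` B) : coupling_space X Y -> R).
    apply/(GmeasP (ssnd t)); apply: measurable_indic.
    by apply: (sub_measurable_Gset (ssnd t)); exists B => //; rewrite setTI.
  (* By causality, the conditional probability [u] of the event [B] of the past of [Y], given the
     whole of [X], only uses the past of [X]. *)
  case: bc => _ /(_ t ord_max erefl) ca _.
  have [u [Gu u01 uE]] := cond_independent_integral (@Mfst ord_max)
    (ssnd t) (@Msnd t) (sfst t) (@Mfst t) ca Gi i01.
  have [Gur ur] := @Gmeas_factor R (coupling_space X Y) (fp_space X) fst rfst
    (fun=> erefl) _ _ Gu.
  have mu := Gmeas_measurable (@Mfst t) Gu.
  have u0 w : (0 <= u w)%R by case/andP: (u01 w).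
  have i0 (w : coupling_space X Y) : (0 <= (\1_(snd @^-1` B) w : R))%R by case/andP: (i01 w).
  have key (l : fp_space X -> R) : Gmeas (fp_filtration X ord_max) l ->
      (forall x, (0 <= l x)%R) ->
      \int[pi]_(w in snd @^-1` B) (l w.1)%:E =
      \int[fp_prob X]_x (u (rfst x) * l x)%:E.
    move=> Gl l0; rewrite -[snd @^-1` B]setTI -integral_mul_indic//.
    transitivity (\int[pi]_w ((l \o fst) w * u w)%:E).
      apply: (integral_Gmeas_mulr (sfst ord_max) (@Mfst ord_max)
        (phi := \1_(snd @^-1` B)) (psi := u) (g := l \o fst)) => //.
      + by move=> w; exact: l0.
      + exact: Gmeas_comp.
      + exact: Gset_setT (sfst ord_max).
    rewrite -(ge0_integral_imageT mfst pi_fst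
      (g := fun x => (u (rfst x) * l x)%:E)); last 2 first.
    + apply/measurable_EFinP; apply: measurable_funM.
        exact: fp_Gmeas_measurable Gur.
      exact: fp_Gmeas_measurable Gl.
    + by move=> x; rewrite lee_fin mulr_ge0.
    by apply: eq_integral => w _; rewrite /= ur mulrC.
  rewrite (key (k i)); [|exact: wt_meas|exact: wt_ge0].
  rewrite (key (fun x => \sum_(j | same_past t i j) k j x)%R);
    [|exact: wt_sum_Gmeas|exact: wt_sum_ge0].
  set M := (\sum_(j | _) fm_wt j)%R.
  have M0 : (0 <= M)%R by apply: sumr_ge0 => j _; exact: fm_ge0.
  have mur := fp_Gmeas_measurable Gur.
  rewrite -!ge0_integralZl_EFin//; last 5 first.
  + by move=> x _; rewrite lee_fin mulr_ge0// wt_sum_ge0.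
  + by apply/measurable_EFinP; apply: measurable_funM => //; exact: wt_sum_measurable.
  + exact: fm_ge0.
  + by move=> x _; rewrite lee_fin mulr_ge0// wt_ge0.
  + by apply/measurable_EFinP; apply: measurable_funM => //; exact: wt_measurable.
  under eq_integral do rewrite -EFinM mulrCA.
  under [RHS]eq_integral do rewrite -EFinM mulrCA.
  (* The identity [wt_causal] of [k] holds on the sets of the past of [X], hence also against the
     weight [u], which is measurable for that past. *)
  apply: (integral_Gmeas_mulr (fp_sigma_algebra X t)
    (@fp_sub_measurable R n.+1 X t)
    (phi := fun x => (M * k i x)%R)
    (psi := fun x => (fm_wt i * \sum_(j | same_past t i j) k j x)%R)
    (g := u \o rfst)) => //.
  + by move=> x; rewrite mulr_ge0// wt_ge0.
  + by move=> x; rewrite mulr_ge0// ?fm_ge0// wt_sum_ge0.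
  + by apply: measurable_funM => //; exact: wt_measurable.
  + by apply: measurable_funM => //; exact: wt_sum_measurable.
  + move=> A FA; have mA := fp_sub_measurable FA.
    under eq_integral do rewrite EFinM.
    under [RHS]eq_integral do rewrite EFinM.
    rewrite !ge0_integralZl_EFin//; first exact: wt_causal.
    * by move=> x _; rewrite lee_fin wt_sum_ge0.
    * by apply/measurable_EFinP/measurable_funTS; exact: wt_sum_measurable.
    * exact: fm_ge0.
    * by move=> x _; rewrite lee_fin wt_ge0.
    * by apply/measurable_EFinP/measurable_funTS; exact: wt_measurable.
  + by move=> x; exact: u0.
  + exact: Gset_setT (fp_sigma_algebra X t).
Qed.

End transfer.

Section integral_minkowski.
Local Open Scope ereal_scope.
Context (R : realType) (p : R) (p_ge1 : (1 <= p)%R).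
Context d (T : measurableType d) (m : {measure set T -> \bar R}).

(** The pointwise domination is required for every [l]; it is integrated first, and [l] is chosen
    last by [minkowski_comb]. *)
Lemma integral_minkowski (F K D : T -> R) (a b : R) : (0 < a)%R -> (0 < b)%R ->
  measurable_fun setT F -> measurable_fun setT K -> measurable_fun setT D ->
  (forall w, (0 <= F w)%R) -> (forall w, (0 <= K w)%R) -> (forall w, (0 <= D w)%R) ->
  (forall l w, (0 < l < 1)%R ->
    (F w <= l `^ (1 - p) * K w + (1 - l) `^ (1 - p) * D w)%R) ->
  \int[m]_w (K w)%:E <= (a `^ p)%:E -> \int[m]_w (D w)%:E <= (b `^ p)%:E ->
  \int[m]_w (F w)%:E <= ((a + b) `^ p)%:E.
Proof.
move=> a0 b0 mF mK mD F0 K0 D0 H Ka Db.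
apply: (minkowski_comb p_ge1 a0 b0 _ _ _ Ka Db).
- by apply: integral_ge0 => w _; rewrite lee_fin.
- by apply: integral_ge0 => w _; rewrite lee_fin.
move=> l l01; rewrite -!ge0_integralZl_EFin ?powR_ge0//; last 4 first.
- by move=> w _; rewrite lee_fin.
- exact/measurable_EFinP.
- by move=> w _; rewrite lee_fin.
- exact/measurable_EFinP.
rewrite -ge0_integralD//; last 4 first.
- by move=> w _; rewrite -EFinM lee_fin mulr_ge0// powR_ge0.
- by apply/measurable_EFinP; exact: measurable_funM.
- by move=> w _; rewrite -EFinM lee_fin mulr_ge0// powR_ge0.
- by apply/measurable_EFinP; exact: measurable_funM.
apply: ge0_le_integral => //.
- by move=> w _; rewrite lee_fin.
- exact/measurable_EFinP.
- apply/measurable_EFinP.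
  by apply: measurable_funD; exact: measurable_funM.
- by move=> w _; rewrite lee_fin H.
Qed.

End integral_minkowski.

Section weight_cost.
Local Open Scope ereal_scope.
Context (R : realType) (n : nat) (p : R) (p_ge1 : (1 <= p)%R).

Lemma transport_costE (X Y : filtered_process R n.+1)
    (pi : probability (coupling_space X Y) R) :
  transport_cost p pi =
  \int[pi]_w (pcost p (fp_path w.1) (fp_path w.2))%:E.
Proof. by rewrite /transport_cost unlock. Qed.

Lemma fp_path_measurable (X : filtered_process R n.+1) t :
  measurable_fun setT (fun w : fp_space X => fp_path w t).
Proof. exact: fp_process_measurable. Qed.

Lemma measurable_cost_coupling (X Y : filtered_process R n.+1) :
  measurable_fun setT
    (fun w : coupling_space X Y => pcost p (fp_path w.1) (fp_path w.2)).
Proof.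
apply: measurable_pcost => t; apply: measurableT_comp.
- exact: fp_path_measurable.
- exact: measurable_fst.
- exact: fp_path_measurable.
- exact: measurable_snd.
Qed.

Lemma measurable_cost_model (z : 'I_n.+1 -> R) (X : filtered_process R n.+1) :
  measurable_fun setT (fun w : fp_space X => pcost p z (fp_path w)).
Proof. exact: fp_Gmeas_measurable (@Gmeas_pcost _ _ X p z). Qed.

Arguments measurable_cost_model : clear implicits.

Context (f : fmodel R n).

Lemma weight_costE (X : filtered_process R n.+1) (k : fm_idx f -> fp_space X -> R) :
  is_weight k ->
  weight_cost p k =
  \int[fp_prob X]_w (\sum_i k i w * pcost p (tnth (fm_pt i)) (fp_path w))%:E.
Proof.
move=> wk; rewrite /weight_cost -ge0_integral_sum//.
- by apply: eq_integral => w _; rewrite sumEFin.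
- move=> i; apply/measurable_EFinP; apply: measurable_funM.
    exact: wt_measurable.
  exact: measurable_cost_model.
- by move=> i w _; rewrite lee_fin mulr_ge0 ?wt_ge0// pcost_ge0.
Qed.

Variables X Y : filtered_process R n.+1.

(** The path of [Y] is measurable for its terminal sigma-algebra, so in the cost of the transferred
    weight [h i] may be replaced by [k i] under [pi]. Minkowski's inequality then passes through the
    path of [X]. *)
Lemma near_model_transfer (pi : probability (coupling_space X Y) R) (a b : R) :
  (0 < a)%R -> (0 < b)%R -> near_model p f X a -> Cpl_bc pi ->
  transport_cost p pi <= (b `^ p)%:E -> near_model p f Y (a + b).
Proof.
move=> a0 b0 [k wk ka] bc cb.
have [h [wh hE]] := transfer_weight wk bc.
exists h => //.
have pi_fst A : measurable A -> pi (fst @^-1` A) = fp_prob X A.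
  by case: bc => [[e _] _ _]; exact: e.
have pi_snd A : measurable A -> pi (snd @^-1` A) = fp_prob Y A.
  by case: bc => [[_ e] _ _]; exact: e.
have mfst : measurable_fun setT (fst : coupling_space X Y -> fp_space X).
  exact: measurable_fst.
have msnd : measurable_fun setT (snd : coupling_space X Y -> fp_space Y).
  exact: measurable_snd.
have mk i : measurable_fun setT (fun w : coupling_space X Y => k i w.1).
  exact: measurableT_comp (wt_measurable wk i) mfst.
have mc i : measurable_fun setT
    (fun w : coupling_space X Y => pcost p (tnth (fm_pt (f := f) i)) (fp_path w.2)).
  exact: measurableT_comp (measurable_cost_model (tnth (fm_pt i)) Y) msnd.
have mc1 i : measurable_fun setT
    (fun w : coupling_space X Y => pcost p (tnth (fm_pt (f := f) i)) (fp_path w.1)).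
  exact: measurableT_comp (measurable_cost_model (tnth (fm_pt i)) X) mfst.
have -> : weight_cost p h = \int[pi]_w
    (\sum_i k i w.1 * pcost p (tnth (fm_pt i)) (fp_path w.2))%:E.
  under [RHS]eq_integral do rewrite -sumEFin.
  rewrite ge0_integral_sum//; last 2 first.
  - by move=> i; apply/measurable_EFinP; exact: measurable_funM.
  - by move=> i w _; rewrite lee_fin mulr_ge0 ?(wt_ge0 wk)// pcost_ge0.
  apply: eq_bigr => i _.
  rewrite -(ge0_integral_imageT msnd pi_snd
    (g := fun y => (h i y * pcost p (tnth (fm_pt i)) (fp_path y))%:E)); last 2 first.
  - apply/measurable_EFinP; apply: measurable_funM.
      exact: wt_measurable.
    exact: measurable_cost_model.
  - by move=> y; rewrite lee_fin mulr_ge0 ?(wt_ge0 wh)// pcost_ge0.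
  under eq_integral do rewrite mulrC.
  under [RHS]eq_integral do rewrite mulrC.
  have sG := @filtration_snd_sigma_algebra R n X Y ord_max.
  have MG := @filtration_snd_measurable R n X Y ord_max.
  apply: (integral_Gmeas_mulr sG MG (phi := fun w => h i w.2)
    (psi := fun w => k i w.1)
    (g := fun w => pcost p (tnth (fm_pt i)) (fp_path w.2))).
  - by move=> w; exact: wt_ge0.
  - by move=> w; exact: wt_ge0.
  - exact: measurableT_comp (wt_measurable wh i) msnd.
  - exact: mk.
  - move=> _ [B FB <-]; rewrite setTI -hE//.
    rewrite (ge0_integral_image msnd pi_snd (g := EFin \o h i))//.
    + exact: fp_sub_measurable FB.
    + exact/measurable_EFinP/wt_measurable.
    + by move=> y; rewrite lee_fin wt_ge0.
  - by move=> w; exact: pcost_ge0.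
  - exact: Gmeas_comp (@Gmeas_pcost _ _ Y p _).
  - exact: Gset_setT.
apply: (integral_minkowski p_ge1 a0 b0
  (K := fun w : coupling_space X Y =>
    (\sum_i k i w.1 * pcost p (tnth (fm_pt i)) (fp_path w.1))%R)
  (D := fun w : coupling_space X Y => pcost p (fp_path w.1) (fp_path w.2))).
- by apply: measurable_sum => i; exact: measurable_funM.
- by apply: measurable_sum => i; exact: measurable_funM.
- exact: measurable_cost_coupling.
- by move=> w; apply: sumr_ge0 => i _; rewrite mulr_ge0 ?(wt_ge0 wk)// pcost_ge0.
- by move=> w; apply: sumr_ge0 => i _; rewrite mulr_ge0 ?(wt_ge0 wk)// pcost_ge0.
- by move=> w; exact: pcost_ge0.
- move=> l w l01.
  have -> : pcost p (fp_path w.1) (fp_path w.2) =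
      (\sum_i k i w.1 * pcost p (fp_path w.1) (fp_path w.2))%R.
    by rewrite -mulr_suml wt_sum1// mul1r.
  rewrite !mulr_sumr.
  rewrite -big_split/=; apply: ler_sum => i _.
  rewrite mulrCA [X in (_ + X)%R]mulrCA -mulrDr ler_wpM2l ?(wt_ge0 wk)//.
  exact: pcost_triangle.
- rewrite [leLHS](ge0_integral_imageT mfst pi_fst
    (g := fun x => (\sum_i k i x * pcost p (tnth (fm_pt i)) (fp_path x))%:E)).
  + by rewrite -weight_costE.
  + apply/measurable_EFinP; apply: measurable_sum => i; apply: measurable_funM.
      exact: wt_measurable.
    exact: measurable_cost_model.
  + move=> x; rewrite lee_fin; apply: sumr_ge0 => i _.
    by rewrite mulr_ge0 ?(wt_ge0 wk)// pcost_ge0.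
- by rewrite -transport_costE.
Qed.

End weight_cost.

(** * Gluing along a common model *)

Section image_integrable.
Context (R : realType) d (T : measurableType d) d' (S : measurableType d').
Variables (m : {measure set T -> \bar R}) (m' : {measure set S -> \bar R}).
Variable q : T -> S.
Hypothesis mq : measurable_fun setT q.
Hypothesis mm' : forall A, measurable A -> m (q @^-1` A) = m' A.

Lemma ge0_integrable_image (c : S -> R) : (forall x, 0 <= c x) ->
  m'.-integrable setT (EFin \o c) -> m.-integrable setT (EFin \o (c \o q)).
Proof.
move=> c0 /integrableP[/measurable_EFinP mc ic]; apply/integrableP; split.
  by apply/measurable_EFinP; exact: measurableT_comp mc mq.
under eq_integral do rewrite /= ger0_norm//.
rewrite [ltLHS](ge0_integral_imageT mq mm' (g := EFin \o c)).
- by move: ic; under eq_integral do rewrite /= ger0_norm//.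
- exact/measurable_EFinP.
- by move=> x; rewrite lee_fin.
Qed.

End image_integrable.

Section product_integral.
Local Open Scope ereal_scope.
Context (R : realType) d (T : measurableType d) d' (S : measurableType d').
Variables (P : probability T R) (Q : probability S R).

Lemma integral_prod_mul (u : T -> R) (v : S -> R) :
  measurable_fun setT u -> measurable_fun setT v ->
  (forall x, (0 <= u x)%R) -> (forall y, (0 <= v y)%R) ->
  \int[P \x Q]_w (u w.1 * v w.2)%:E = (\int[P]_x (u x)%:E) * (\int[Q]_y (v y)%:E).
Proof.
move=> mu mv u0 v0.
have iv0 : 0 <= \int[Q]_y (v y)%:E by apply: integral_ge0 => y _; rewrite lee_fin.
have mF : measurable_fun setT (fun w : T * S => (u w.1 * v w.2)%:E).
  apply/measurable_EFinP; apply: measurable_funM.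
    exact: measurableT_comp mu (@measurable_fst _ _ _ _).
  exact: measurableT_comp mv (@measurable_snd _ _ _ _).
rewrite fubini_tonelli1//; last by move=> w; rewrite lee_fin mulr_ge0.
rewrite muleC -ge0_integralZl//; last 2 first.
- exact/measurable_EFinP.
- by move=> x _; rewrite lee_fin.
apply: eq_integral => x _; rewrite /fubini_F /=.
under eq_integral do rewrite EFinM.
rewrite ge0_integralZl_EFin//; first by rewrite muleC.
- by move=> y _; rewrite lee_fin.
- exact/measurable_EFinP.
Qed.

Lemma integral_prod_rect (u : T -> R) (v : S -> R) A B :
  measurable A -> measurable B ->
  measurable_fun setT u -> measurable_fun setT v ->
  (forall x, (0 <= u x)%R) -> (forall y, (0 <= v y)%R) ->
  \int[P \x Q]_(w in A `*` B) (u w.1 * v w.2)%:E =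
  (\int[P]_(x in A) (u x)%:E) * (\int[Q]_(y in B) (v y)%:E).
Proof.
move=> mA mB mu mv u0 v0.
have -> : \int[P]_(x in A) (u x)%:E = \int[P]_x (u x * \1_A x)%:E.
  by rewrite integral_mul_indic// setTI.
have -> : \int[Q]_(x in B) (v x)%:E = \int[Q]_x (v x * \1_B x)%:E.
  by rewrite integral_mul_indic// setTI.
rewrite -integral_prod_mul//.
- rewrite integral_mkcond; apply: eq_integral => w _.
  rewrite patchE; case: ifPn => wAB.
    have [wA wB] : A w.1 /\ B w.2 by exact: set_mem wAB.
    by rewrite !indicE !mem_set//= !mulr1.
  rewrite notin_setE/= in wAB; rewrite !indicE.
  case: (boolP (w.1 \in A)) => [|_]; last by rewrite mulr0 mul0r.
  case: (boolP (w.2 \in B)) => [|_]; last by rewrite !mulr0.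
  by rewrite !inE => wB wA; exfalso; apply: wAB.
- by apply: measurable_funM => //; exact: measurable_indic.
- by apply: measurable_funM => //; exact: measurable_indic.
- by move=> x; rewrite mulr_ge0.
- by move=> x; rewrite mulr_ge0.
Qed.

End product_integral.

Section weight_mass.
Local Open Scope ereal_scope.
Context (R : realType) (n : nat) (f : fmodel R n) (X : filtered_process R n.+1).
Variable k : fm_idx f -> fp_space X -> R.
Hypothesis wk : is_weight k.

(** The joint mass of the event [A] and the path [fm_pt i] under the coupling described by [k]. *)
Definition wt_on (A : set (fp_space X)) (i : fm_idx f) : R :=
  fine (\int[fp_prob X]_(w in A) (k i w)%:E).

Lemma wt_onE A i : measurable A ->
  \int[fp_prob X]_(w in A) (k i w)%:E = (wt_on A i)%:E.
Proof.
move=> mA; rewrite fineK// integrable_fin_num//.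
by apply: ge0_integrable_le1 => //; [exact: wt_measurable|exact: wt_le1].
Qed.

Lemma wt_on_ge0 A i : (0 <= wt_on A i)%R.
Proof.
by apply: fine_ge0; apply: integral_ge0 => w _; rewrite lee_fin wt_ge0.
Qed.

Lemma wt_on_le A i : measurable A -> (wt_on A i <= fm_wt i)%R.
Proof.
move=> mA; rewrite -lee_fin -wt_onE// -(wt_mass wk).
apply: ge0_subset_integral => //.
- by apply/measurable_EFinP; exact: wt_measurable.
- by move=> w _; rewrite lee_fin wt_ge0.
Qed.

Lemma wt_on_eq0 A i : measurable A -> fm_wt i = 0%R -> wt_on A i = 0%R.
Proof.
by move=> mA mi0; apply/eqP; rewrite eq_le wt_on_ge0 andbT -mi0 wt_on_le.
Qed.

Lemma wt_on_sum Q A : measurable A ->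
  \int[fp_prob X]_(w in A) (\sum_(j | Q j) k j w)%:E = (\sum_(j | Q j) wt_on A j)%:E.
Proof.
move=> mA; rewrite integral_wt_sum// -sumEFin.
by apply: eq_bigr => j _; rewrite wt_onE.
Qed.

Lemma wt_on_total A : measurable A -> (\sum_i wt_on A i)%:E = fp_prob X A.
Proof.
move=> mA; rewrite -(wt_on_sum predT)//.
under eq_integral do rewrite (wt_sum1 wk).
by rewrite integral_cst// mul1e.
Qed.

Lemma wt_on_causal t i B : fp_filtration X t B ->
  ((\sum_(j | same_past t i j) fm_wt j) * wt_on B i =
   fm_wt i * \sum_(j | same_past t i j) wt_on B j)%R.
Proof.
move=> FB; have mB := fp_sub_measurable FB.
by apply: EFin_inj; rewrite !EFinM -wt_onE// -wt_on_sum//; exact: wt_causal.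
Qed.

End weight_mass.

Section glue.
Local Open Scope ereal_scope.
Context (R : realType) (n : nat) (f : fmodel R n).

Lemma same_past_eq t (i j : fm_idx f) :
  same_past t i j -> same_past t i =1 same_past t j.
Proof. by rewrite /same_past => /eqP e l; rewrite e. Qed.

Lemma same_past_refl t (i : fm_idx f) : same_past t i i.
Proof. exact: eqxx. Qed.

Lemma same_past_sym t (i j : fm_idx f) : same_past t i j = same_past t j i.
Proof. exact: eq_sym. Qed.

(* the class function [v] is the conditional mass of [C] given the past of [i] *)
Lemma glue_causal (X Y : filtered_process R n.+1)
    (k : fm_idx f -> fp_space X -> R) (h : fm_idx f -> fp_space Y -> R) t C :
  is_weight k -> is_weight h -> fp_filtration Y t C ->
  exists c : fp_space X -> R, [/\ Gmeas (fp_filtration X t) c,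
    forall w, (0 <= c w)%R, (fp_prob X).-integrable setT (EFin \o c) &
    forall A, fp_filtration X ord_max A ->
      (\sum_i (fm_wt i)^-1 * (wt_on k A i * wt_on h C i))%:E =
      \int[fp_prob X]_(w in A) (c w)%:E].
Proof.
move=> wk wh FC; have mC := fp_sub_measurable FC.
have /choice[s sP] := fun i => wt_adapted wk t i.
pose M i := (\sum_(j | same_past t i j) fm_wt (f := f) j)%R.
pose v i := ((M i)^-1 * \sum_(j | same_past t i j) wt_on h C j)%R.
(* The size of the class of [i]. In the sum over [i] defining the witness, a class occurs once for
   each of its members, and division by [z i] corrects this. *)
pose z (i : fm_idx f) : R := (\sum_(j | same_past t i j) 1)%R.
have z0 i : (0 < z i)%R.
  by rewrite /z (bigD1 i) ?same_past_refl//= ltr_pwDl// sumr_ge0.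
have M0 i : (0 <= M i)%R by apply: sumr_ge0 => j _; exact: fm_ge0.
have v0 i : (0 <= v i)%R.
  by rewrite mulr_ge0 ?invr_ge0// sumr_ge0// => j _; exact: wt_on_ge0.
have vE i j : same_past t i j -> v i = v j.
  by move=> ij; rewrite /v /M !(eq_bigl _ _ (same_past_eq ij)).
have zE i j : same_past t i j -> z i = z j.
  by move=> ij; rewrite /z (eq_bigl _ _ (same_past_eq ij)).
(* This is [wt_causal] for [h]: the conditional mass of [C] given the path [i] depends on the past
   of [i] only. *)
have hv i : wt_on h C i = (fm_wt i * v i)%R.
  have := wt_on_causal wh i FC; rewrite -/(M i) /v.
  have [Mi0 _|Mi0 e] := eqVneq (M i) 0%R.
    have mi0 : fm_wt i = 0%R.
      apply/eqP; rewrite eq_le fm_ge0 andbT -Mi0 /M (bigD1 i) ?same_past_refl//=.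
      by rewrite lerDl sumr_ge0// => j _; exact: fm_ge0.
    by rewrite (wt_on_eq0 wh mC mi0) mi0 mul0r.
  by apply: (mulfI Mi0); rewrite e mulrCA mulVKf.
exists (fun w => \sum_i v i / z i * s i w)%R.
have ms i : measurable_fun setT (s i).
  by have [Gs _ _] := sP i; exact: fp_Gmeas_measurable Gs.
have s0 i w : (0 <= s i w)%R by have [_ /(_ w)/andP[]] := sP i.
have vz0 i : (0 <= v i / z i)%R by rewrite divr_ge0// ltW.
have sG := fp_sigma_algebra X t.
split.
- apply/(GmeasP sG); apply: measurable_sum => i; apply: measurable_funM => //.
  by apply/(GmeasP sG); have [] := sP i.
- by move=> w; apply: sumr_ge0 => i _; rewrite mulr_ge0.
- rewrite (_ : _ \o _ = fun w => \sum_i (v i / z i)%:E * (s i w)%:E); last first.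
    by apply/funext => w /=; rewrite -sumEFin; apply: eq_bigr => i _; rewrite EFinM.
  apply: integrable_sum => // i _; apply: integrableZl => //.
  by apply: ge0_integrable_le1 => //; have [] := sP i.
- move=> A FA; have mA := fp_sub_measurable FA.
  under [RHS]eq_integral do rewrite -sumEFin.
  rewrite ge0_integral_sum//; last 2 first.
  + move=> i; apply/measurable_EFinP; apply: measurable_funTS.
    exact: measurable_funM.
  + by move=> i w _; rewrite lee_fin mulr_ge0.
  transitivity (\sum_i (v i / z i * \sum_(j | same_past t i j) wt_on k A j)%:E);
      last first.
    apply: eq_bigr => i _; under [RHS]eq_integral do rewrite EFinM.
    rewrite ge0_integralZl_EFin//; last 2 first.
    * by move=> w _; rewrite lee_fin.
    * by apply/measurable_EFinP; exact: measurable_funTS.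
    by have [_ _ <-//] := sP i; rewrite wt_on_sum// EFinM.
  rewrite sumEFin; congr (_%:E).
  under [RHS]eq_bigr do rewrite mulr_sumr.
  rewrite (exchange_big_dep xpredT)//=; apply: eq_bigr => j _.
  rewrite -mulr_suml (eq_bigr (fun=> v j / z j * 1)%R); last first.
    by move=> i ij; rewrite mulr1 (vE _ _ ij) (zE _ _ ij).
  rewrite -mulr_sumr (eq_bigl (same_past t j)); last first.
    by move=> i; rewrite same_past_sym.
  rewrite -/(z j) divfK ?gt_eqF// hv.
  have [mj0|mj0] := eqVneq (fm_wt j) 0%R.
    by rewrite (wt_on_eq0 wk mA mj0) mul0r mulr0 mulr0.
  by rewrite mulrCA mulKf// mulrC.
Qed.

Variables X Y : filtered_process R n.+1.
Variables (k : fm_idx f -> fp_space X -> R) (h : fm_idx f -> fp_space Y -> R).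
Hypotheses (wk : is_weight k) (wh : is_weight h).

Let mfst : measurable_fun setT (fst : coupling_space X Y -> fp_space X).
Proof. exact: measurable_fst. Qed.

Let msnd : measurable_fun setT (snd : coupling_space X Y -> fp_space Y).
Proof. exact: measurable_snd. Qed.

(** The two processes are made independent given the model path. Since [0^-1] is 0, model paths of
    mass 0 drop out; their weights have integral 0 anyway. *)
Definition glue_density (w : coupling_space X Y) : R :=
  (\sum_i (fm_wt i)^-1 * (k i w.1 * h i w.2))%R.

Let wtV0 (i : fm_idx f) : (0 <= (fm_wt i)^-1)%R.
Proof. by rewrite invr_ge0 fm_ge0. Qed.

Lemma glue_density_ge0 w : (0 <= glue_density w)%R.
Proof.
by apply: sumr_ge0 => i _; rewrite !mulr_ge0 ?(wt_ge0 wk) ?(wt_ge0 wh).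
Qed.

Let mkh i : measurable_fun setT (fun w : coupling_space X Y => k i w.1 * h i w.2)%R.
Proof.
apply: measurable_funM.
  exact: measurableT_comp (wt_measurable wk i) mfst.
exact: measurableT_comp (wt_measurable wh i) msnd.
Qed.

Lemma measurable_glue_density : measurable_fun setT glue_density.
Proof. by apply: measurable_sum => i; exact: measurable_funM. Qed.

Definition glue_measure : set (coupling_space X Y) -> \bar R :=
  mdensity (fp_prob X \x fp_prob Y) glue_density_ge0 measurable_glue_density.

HB.instance Definition _ := Measure.on glue_measure.

Lemma glue_measure_rect A B : measurable A -> measurable B ->
  glue_measure (A `*` B) = (\sum_i (fm_wt i)^-1 * (wt_on k A i * wt_on h B i))%:E.
Proof.
move=> mA mB; rewrite /glue_measure /mdensity.
have mAB : measurable (A `*` B) by exact: measurableX.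
under eq_integral do rewrite /glue_density -sumEFin.
rewrite ge0_integral_sum//; last 2 first.
- by move=> i; apply/measurable_EFinP; apply: measurable_funTS; exact: measurable_funM.
- by move=> i w _; rewrite lee_fin !mulr_ge0 ?(wt_ge0 wk) ?(wt_ge0 wh).
rewrite -sumEFin; apply: eq_bigr => i _.
under eq_integral do rewrite EFinM.
rewrite ge0_integralZl_EFin//; last 2 first.
- by move=> w _; rewrite lee_fin mulr_ge0 ?(wt_ge0 wk) ?(wt_ge0 wh).
- by apply/measurable_EFinP; exact: measurable_funTS.
rewrite (integral_prod_rect _ _ mA mB (u := k i) (v := h i)).
- by rewrite !wt_onE// !EFinM.
- exact: wt_measurable.
- exact: wt_measurable.
- exact: wt_ge0.
- exact: wt_ge0.
Qed.

Lemma glue_measure_fst A : measurable A -> glue_measure (fst @^-1` A) = fp_prob X A.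
Proof.
move=> mA; rewrite (_ : _ @^-1` _ = A `*` setT); last first.
  by apply/seteqP; split => w //= [].
rewrite glue_measure_rect// -(wt_on_total wk mA); congr (_%:E).
apply: eq_bigr => i _; have -> : wt_on h setT i = fm_wt i.
  by apply: EFin_inj; rewrite -wt_onE// wt_mass.
have [mi0|mi0] := eqVneq (fm_wt i) 0%R.
  by rewrite (wt_on_eq0 wk mA mi0) mul0r mulr0.
by rewrite mulrCA mulVf// mulr1.
Qed.

Lemma glue_measure_snd B : measurable B -> glue_measure (snd @^-1` B) = fp_prob Y B.
Proof.
move=> mB; rewrite (_ : _ @^-1` _ = setT `*` B); last first.
  by apply/seteqP; split => w //= [].
rewrite glue_measure_rect// -(wt_on_total wh mB); congr (_%:E).
apply: eq_bigr => i _; have -> : wt_on k setT i = fm_wt i.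
  by apply: EFin_inj; rewrite -wt_onE// wt_mass.
have [mi0|mi0] := eqVneq (fm_wt i) 0%R.
  by rewrite (wt_on_eq0 wh mB mi0) !mulr0.
by rewrite mulKf.
Qed.

Let glue_measure_setT : glue_measure setT = 1.
Proof.
by rewrite -(preimage_setT (@fst (fp_space X) (fp_space Y))) glue_measure_fst// probability_setT.
Qed.

HB.instance Definition _ := Measure_isProbability.Build _ _ _ glue_measure glue_measure_setT.

(** The density is symmetric in the two processes, so [glue_causal] serves in both directions; its
    function [c] is the one asked for by [cond_independentP], first on rectangles and hence on all
    the sets concerned. *)
Lemma glue_bicausal : Cpl_bc (glue_measure : probability (coupling_space X Y) R).
Proof.
split.
- by split; [exact: glue_measure_fst|exact: glue_measure_snd].
- move=> t last lastE; have -> : last = ord_max by apply: val_inj => /=; case: lastE.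
  apply: cond_independentP.
  + exact: filtration_fst_sigma_algebra.
  + exact: filtration_fst_measurable.
  + exact: filtration_snd_measurable.
  + exact: filtration_fst_sigma_algebra.
  + exact: filtration_fst_measurable.
  + move=> _ [A FA <-]; exists A => //.
    by apply: (fp_filtration_le _ FA); rewrite -ltnS.
  + move=> _ [C FC <-]; rewrite setTI; have mC := fp_sub_measurable FC.
    have [c [Gc c0 ic cE]] := glue_causal wk wh FC.
    have mc := fp_Gmeas_measurable Gc.
    exists (c \o fst); split.
    * exact: Gmeas_comp.
    * by move=> w; exact: c0.
    * exact: (ge0_integrable_image mfst glue_measure_fst).
    * move=> _ [A FA <-]; rewrite setTI; have mA := fp_sub_measurable FA.
      rewrite [RHS](ge0_integral_image mfst glue_measure_fst mA (g := EFin \o c)).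
      - by rewrite -cE// -glue_measure_rect.
      - exact/measurable_EFinP.
      - by move=> x; rewrite lee_fin.
- move=> t last lastE; have -> : last = ord_max by apply: val_inj => /=; case: lastE.
  apply: cond_independentP.
  + exact: filtration_snd_sigma_algebra.
  + exact: filtration_snd_measurable.
  + exact: filtration_fst_measurable.
  + exact: filtration_snd_sigma_algebra.
  + exact: filtration_snd_measurable.
  + move=> _ [A FA <-]; exists A => //.
    by apply: (fp_filtration_le _ FA); rewrite -ltnS.
  + move=> _ [C FC <-]; rewrite setTI; have mC := fp_sub_measurable FC.
    have [c [Gc c0 ic cE]] := glue_causal wh wk FC.
    have mc := fp_Gmeas_measurable Gc.
    exists (c \o snd); split.
    * exact: Gmeas_comp.
    * by move=> w; exact: c0.
    * exact: (ge0_integrable_image msnd glue_measure_snd).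
    * move=> _ [A FA <-]; rewrite setTI; have mA := fp_sub_measurable FA.
      rewrite [RHS](ge0_integral_image msnd glue_measure_snd mA (g := EFin \o c)).
      - rewrite -cE// setIC; rewrite -[LHS]/(glue_measure (C `*` A)).
        rewrite glue_measure_rect//; congr (_%:E).
        by apply: eq_bigr => i _; rewrite [X in (_ * X)%R]mulrC.
      - exact/measurable_EFinP.
      - by move=> x; rewrite lee_fin.
Qed.

End glue.

Section glue_cost.
Local Open Scope ereal_scope.
Context (R : realType) (n : nat) (p : R) (p_ge1 : (1 <= p)%R).
Variables (f : fmodel R n) (X Y : filtered_process R n.+1).

(** Inside the sum over [i], the two paths are compared through [fm_pt i]. In each resulting term
    the variable that does not enter the cost integrates to [fm_wt i], which cancels the inverse
    mass. *)
Lemma near_model_glue (a b : R) : (0 < a)%R -> (0 < b)%R ->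
  near_model p f X a -> near_model p f Y b ->
  exists2 pi : probability (coupling_space X Y) R,
    Cpl_bc pi & transport_cost p pi <= ((a + b) `^ p)%:E.
Proof.
move=> a0 b0 [k wk ka] [h wh hb].
exists (glue_measure wk wh); first exact: glue_bicausal.
have mfst : measurable_fun setT (fst : coupling_space X Y -> fp_space X).
  exact: measurable_fst.
have msnd : measurable_fun setT (snd : coupling_space X Y -> fp_space Y).
  exact: measurable_snd.
have wtV0 (i : fm_idx f) : (0 <= (fm_wt i)^-1)%R by rewrite invr_ge0 fm_ge0.
pose cX (i : fm_idx f) (x : fp_space X) := pcost p (tnth (fm_pt i)) (fp_path x).
pose cY (i : fm_idx f) (y : fp_space Y) := pcost p (tnth (fm_pt i)) (fp_path y).
have mcX i : measurable_fun setT (cX i) by exact: measurable_cost_model.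
have mcY i : measurable_fun setT (cY i) by exact: measurable_cost_model.
have mkX i : measurable_fun setT (k i) by exact: wt_measurable.
have mhY i : measurable_fun setT (h i) by exact: wt_measurable.
have cX0 i x : (0 <= cX i x)%R by exact: pcost_ge0.
have cY0 i y : (0 <= cY i y)%R by exact: pcost_ge0.
have k0 i x : (0 <= k i x)%R by exact: wt_ge0.
have h0 i y : (0 <= h i y)%R by exact: wt_ge0.
have m1 (u : fp_space X -> R) : measurable_fun setT u ->
    measurable_fun setT (fun w : coupling_space X Y => u w.1).
  by move=> mu; exact: measurableT_comp mu mfst.
have m2 (u : fp_space Y -> R) : measurable_fun setT u ->
    measurable_fun setT (fun w : coupling_space X Y => u w.2).
  by move=> mu; exact: measurableT_comp mu msnd.
have mkc i : measurable_fun setT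
    (fun w : coupling_space X Y => (k i w.1 * cX i w.1)%R).
  by apply: measurable_funM; exact: m1.
have mhc i : measurable_fun setT
    (fun w : coupling_space X Y => (h i w.2 * cY i w.2)%R).
  by apply: measurable_funM; exact: m2.
rewrite transport_costE integral_mdensity//; last 2 first.
- by move=> w; rewrite lee_fin pcost_ge0.
- by apply/measurable_EFinP; exact: measurable_cost_coupling.
under eq_integral do rewrite -EFinM.
(* Only an inequality, because of the convention [0^-1 = 0]. *)
have le_mass (i : fm_idx f) (I : \bar R) : 0 <= I ->
    ((fm_wt i)^-1)%:E * (I * (fm_wt i)%:E) <= I.
  move=> I0; have [->|mi0] := eqVneq (fm_wt i) 0%R; first by rewrite mule0 mule0.
  by rewrite muleCA -EFinM mulVf// mule1.
apply: (integral_minkowski p_ge1 a0 b0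
  (K := fun w : coupling_space X Y =>
    (\sum_i (fm_wt i)^-1 * (k i w.1 * cX i w.1 * h i w.2))%R)
  (D := fun w : coupling_space X Y =>
    (\sum_i (fm_wt i)^-1 * (k i w.1 * (h i w.2 * cY i w.2)))%R)).
- apply: measurable_funM; first exact: measurable_cost_coupling.
  exact: measurable_glue_density.
- apply: measurable_sum => i; apply: measurable_funM => //.
  by apply: measurable_funM; [exact: mkc|exact: m2].
- apply: measurable_sum => i; apply: measurable_funM => //.
  by apply: measurable_funM; [exact: m1|exact: mhc].
- by move=> w; rewrite mulr_ge0 ?pcost_ge0// glue_density_ge0.
- by move=> w; apply: sumr_ge0 => i _; rewrite !mulr_ge0.
- by move=> w; apply: sumr_ge0 => i _; rewrite !mulr_ge0.
- move=> l w l01; rewrite /glue_density !mulr_sumr -big_split/=.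
  apply: ler_sum => i _.
  have H := pcost_triangle p_ge1 (fp_path w.1) (tnth (fm_pt i)) (fp_path w.2) l01.
  pose c := ((fm_wt i)^-1 * (k i w.1 * h i w.2))%R.
  have c0 : (0 <= c)%R by rewrite !mulr_ge0.
  rewrite (pcostC _ (fp_path w.1) (tnth (fm_pt i))) in H.
  rewrite [leLHS](_ : _ =
    (c * pcost p (fp_path w.1) (fp_path w.2))%R); last by rewrite /c; ring.
  apply: le_trans (ler_wpM2l c0 H) _.
  by rewrite le_eqVlt; apply/orP; left; apply/eqP; rewrite /c /cX /cY; ring.
- under eq_integral do rewrite -sumEFin.
  rewrite ge0_integral_sum//; last 2 first.
  + move=> i; apply/measurable_EFinP; apply: measurable_funM => //.
    by apply: measurable_funM; [exact: mkc|exact: m2].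
  + by move=> i w _; rewrite lee_fin !mulr_ge0.
  apply: le_trans ka; rewrite /weight_cost; apply: lee_sum => i _.
  under eq_integral do rewrite EFinM.
  rewrite ge0_integralZl_EFin//; last 2 first.
  + by move=> w _; rewrite lee_fin !mulr_ge0.
  + apply/measurable_EFinP.
    by apply: measurable_funM; [exact: mkc|exact: m2].
  rewrite (integral_prod_mul _ _ (u := fun x => (k i x * cX i x)%R) (v := h i))//.
  + by rewrite (wt_mass wh); apply: le_mass; apply: integral_ge0 => x _; rewrite lee_fin mulr_ge0.
  + exact: measurable_funM.
  + by move=> x; rewrite mulr_ge0.
- under eq_integral do rewrite -sumEFin.
  rewrite ge0_integral_sum//; last 2 first.
  + move=> i; apply/measurable_EFinP; apply: measurable_funM => //.
    by apply: measurable_funM; [exact: m1|exact: mhc].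
  + by move=> i w _; rewrite lee_fin !mulr_ge0.
  apply: le_trans hb; rewrite /weight_cost; apply: lee_sum => i _.
  under eq_integral do rewrite EFinM.
  rewrite ge0_integralZl_EFin//; last 2 first.
  + by move=> w _; rewrite lee_fin !mulr_ge0.
  + apply/measurable_EFinP.
    by apply: measurable_funM; [exact: m1|exact: mhc].
  rewrite (integral_prod_mul _ _ (u := k i) (v := fun y => (h i y * cY i y)%R))//.
  + rewrite (wt_mass wk) [X in _ * X]muleC; apply: le_mass.
    by apply: integral_ge0 => x _; rewrite lee_fin mulr_ge0.
  + exact: measurable_funM.
  + by move=> x; rewrite mulr_ge0.
Qed.

End glue_cost.

Section adapted_wasserstein_metric.
Local Open Scope ereal_scope.
Context (R : realType) (n : nat) (p : R) (p_ge1 : (1 <= p)%R).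
Implicit Types X Y Z : filtered_process R n.+1.

Let p_gt0 : (0 < p)%R. Proof. exact: lt_le_trans ltr01 p_ge1. Qed.

Lemma AW_ge0 X Y : 0 <= AW p X Y.
Proof. exact: poweR_ge0. Qed.

Let powK (c : R) : (0 <= c)%R -> ((c `^ p)%:E `^ p^-1 = c%:E).
Proof.
by move=> c0; rewrite poweR_EFin -powRrM mulfV ?gt_eqF// powRr1.
Qed.

Let inf_ge0 X Y : 0 <= ereal_inf [set transport_cost p pi | pi in @Cpl_bc R n.+1 X Y].
Proof.
apply: le_ereal_inf_tmp => _ [pi _ <-]; rewrite transport_costE.
by apply: integral_ge0 => w _; rewrite lee_fin pcost_ge0.
Qed.

Lemma AW_le X Y (pi : probability (coupling_space X Y) R) (c : R) :
  (0 <= c)%R -> Cpl_bc pi -> transport_cost p pi <= (c `^ p)%:E -> AW p X Y <= c%:E.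
Proof.
move=> c0 bc cost; rewrite -powK//; apply: gt0_ler_poweR.
- by rewrite invr_ge0 ltW.
- by rewrite in_itv/= inf_ge0 leey.
- by rewrite in_itv/= lee_fin powR_ge0 leey.
- by apply: ge_ereal_inf; exists (transport_cost p pi) => //; exists pi.
Qed.

Lemma AW_lt X Y (c : R) : AW p X Y < c%:E ->
  exists2 pi : probability (coupling_space X Y) R,
    Cpl_bc pi & transport_cost p pi <= (c `^ p)%:E.
Proof.
move=> AWc; have c0 : (0 < c)%R by rewrite -lte_fin; exact: le_lt_trans (AW_ge0 X Y) AWc.
have [|le_inf] := ltP (ereal_inf [set transport_cost p pi | pi in @Cpl_bc R n.+1 X Y])
    (c `^ p)%:E.
  by move=> /ereal_inf_lt[_ [pi bc <-] cost]; exists pi => //; exact: ltW.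
have : c%:E <= AW p X Y.
  rewrite -(powK (ltW c0)) /AW; apply: gt0_ler_poweR => //.
  - by rewrite invr_ge0 ltW.
  - by rewrite in_itv/= lee_fin powR_ge0 leey.
  - by rewrite in_itv/= inf_ge0 leey.
by rewrite leNgt AWc.
Qed.

Lemma near_model_AW (f : fmodel R n) X Y (a b : R) : (0 < a)%R -> (0 < b)%R ->
  near_model p f X a -> near_model p f Y b -> AW p X Y <= (a + b)%:E.
Proof.
move=> a0 b0 fX fY; have [pi bc cost] := near_model_glue p_ge1 a0 b0 fX fY.
by apply: AW_le bc cost; rewrite addr_ge0// ltW.
Qed.

Lemma near_model_lt (f : fmodel R n) X Y (a b : R) : (0 < a)%R ->
  near_model p f X a -> AW p X Y < b%:E -> near_model p f Y (a + b).
Proof.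
move=> a0 fX AWb.
have b0 : (0 < b)%R by rewrite -lte_fin; exact: le_lt_trans (AW_ge0 X Y) AWb.
have [pi bc cost] := AW_lt AWb.
exact: (near_model_transfer p_ge1 a0 b0 fX bc cost).
Qed.

End adapted_wasserstein_metric.

(** * Models as laws *)

Section canonical_filtration_past.
Context (R : realType) (n : nat).
Implicit Types (t : 'I_n.+1) (x y : path_space R n.+1).

(** The sets saturated for equality of pasts form a sigma-algebra, and it contains the
    generators. *)
Lemma canonical_filtration_past t (B : set (path_space R n.+1)) x y :
  canonical_filtration (R := R) t B -> past t x = past t y -> B x -> B y.
Proof.
move=> tB; pose C := [set B : set (path_space R n.+1) |
  forall x y, past t x = past t y -> B x -> B y].
suff : C B by move=> CB; exact: CB.
apply: tB; split.
  split => //.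
  - move=> A CA u v uv [_ Au]; split => // Av; apply: Au.
    exact: CA (esym uv) Av.
  - by move=> F CF u v uv [k _ Fu]; exists k => //; exact: CF uv Fu.
move=> A [s /= st [D mD <-]] u v /pastP uv [_ Du]; split => //.
by move: Du; rewrite /preimage/= /coordinate uv.
Qed.

Lemma past_last x y : past ord_max x = past ord_max y -> x = y.
Proof. by move=> /pastP h; apply: eq_from_tnth => s; apply: h; rewrite -ltnS. Qed.

Lemma canonical_filtration_class t x :
  canonical_filtration t [set y | past t y = past t x].
Proof.
have sG := @canonical_sigma_algebra R n.+1 t.
apply: (Gset_sub_measurable sG).
rewrite (_ : [set y | _] =
    \bigcap_(s in [set s : 'I_n.+1 | (s <= t)%N]) (coordinate s @^-1` [set tnth x s])).
  apply: fin_bigcap_measurable; first exact: finite_finset.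
  move=> s /= st; apply: (sub_measurable_Gset sG).
  apply: (canonical_filtration_le st).
  by apply: canonical_adapted; exists [set tnth x s] => //; rewrite setTI.
by apply/seteqP; split => y /pastP.
Qed.

End canonical_filtration_past.

Section finite_law.
Local Open Scope ereal_scope.
Context (R : realType) (n : nat) (f : fmodel R n).
Local Notation T := (path_space R n.+1).

Let atom (i : fm_idx f) : {measure set T -> \bar R} :=
  mscale (NngNum (fm_ge0 i)) \d_(fm_pt i : T).

(** A sum of weighted Dirac measures, built along a list so that integrals are computed by
    induction. *)
Fixpoint atoms (s : seq (fm_idx f)) : {measure set T -> \bar R} :=
  if s is i :: s' then measure_add (atom i) (atoms s') else mzero.

Lemma atomsE s (A : set T) :
  atoms s A = \sum_(i <- s) (fm_wt i * \1_A (fm_pt i : T))%:E.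
Proof.
elim: s => [|i s ih]; first by rewrite big_nil.
have -> : atoms (i :: s) A = atom i A + atoms s A by exact: measure_addE.
by rewrite big_cons -ih /atom /= /mscale/= diracE EFinM.
Qed.

Lemma ge0_integral_atoms s (A : set T) (g : T -> R) : measurable A ->
  measurable_fun setT g -> (forall x, (0 <= g x)%R) ->
  \int[atoms s]_(x in A) (g x)%:E =
  (\sum_(i <- s) fm_wt i * \1_A (fm_pt i : T) * g (fm_pt i))%:E.
Proof.
move=> mA mg g0; have mgA : measurable_fun A (EFin \o g).
  by apply/measurable_EFinP; exact: measurable_funTS.
elim: s => [|i s ih]; first by rewrite big_nil integral_measure_zero.
rewrite big_cons /= ge0_integral_measure_add//.
- rewrite ih ge0_integral_mscale//=.
  rewrite (integral_dirac (fm_pt i : T) mA mgA) diracE /=.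
  by rewrite EFinD !EFinM muleA.
- by move=> x _; rewrite lee_fin.
- by move=> x _; rewrite lee_fin.
Qed.

Definition fm_law : set T -> \bar R := atoms (index_enum (fm_idx f)).

HB.instance Definition _ := Measure.on fm_law.

Let fm_law_setT : fm_law setT = 1.
Proof.
rewrite /fm_law atomsE sumEFin -(fm_sum f); congr (_%:E).
by apply: eq_bigr => i _; rewrite indicT mulr1.
Qed.

HB.instance Definition _ := Measure_isProbability.Build _ _ _ fm_law fm_law_setT.

Lemma ge0_integral_fm_law (A : set T) (g : T -> R) : measurable A ->
  measurable_fun setT g -> (forall x, (0 <= g x)%R) ->
  \int[fm_law]_(x in A) (g x)%:E =
  (\sum_(i : fm_idx f) fm_wt i * \1_A (fm_pt i : T) * g (fm_pt i))%:E.
Proof. exact: ge0_integral_atoms. Qed.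

Definition fm_process : filtered_process R n.+1 :=
  canonical_process (fm_law : probability (path_space R n.+1) R).

Lemma fm_idx_inhabited : exists i : fm_idx f, true.
Proof.
apply: contrapT => noI; have := fm_sum f; rewrite big1.
  by move=> /esym/eqP; rewrite oner_eq0.
by move=> i _; exfalso; apply: noI; exists i.
Qed.

(** The weights of the identity coupling, of cost 0; this is where injectivity of [fm_pt] identifies
    a model path with its index. *)
Lemma near_model_self (p c : R) : (1 <= p)%R -> (0 < c)%R -> near_model p f fm_process c.
Proof.
move=> p1 c0; have [i0 _] := fm_idx_inhabited.
(* [u j] is the indicator of the j-th path. Off the model paths, a null set, the weight goes to
   [i0], because weights must sum to 1 everywhere. *)
pose u (j : fm_idx f) (x : T) : R := ((fm_pt j : T) == x)%:R.
pose k (i : fm_idx f) (x : fp_space fm_process) : R :=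
  (u i x + (i == i0)%:R * (1 - \sum_j u j x))%R.
have delta1 (l : fm_idx f) : (\sum_(j : fm_idx f) (j == l)%:R = 1 :> R)%R.
  by rewrite (bigD1 l)//= eqxx big1 ?addr0// => j /negbTE ->.
have u0 j x : (0 <= u j x)%R by rewrite /u; case: (_ == _).
have uE j l : u j (fm_pt l) = (j == l)%:R.
  by rewrite /u (inj_eq (@fm_inj _ _ f)).
have su1 x : (\sum_j u j x <= 1)%R.
  have [[l lx]|nl] := pselect (exists l : fm_idx f, (fm_pt l : T) = x).
    rewrite -lx (eq_bigr (fun j => (j == l)%:R)); last by move=> j _; rewrite uE.
    by rewrite delta1.
  rewrite big1// => j _; rewrite /u; case: eqP => // e; exfalso.
  by apply: nl; exists j.
have kE i l : k i (fm_pt l) = (i == l)%:R.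
  rewrite /k uE (eq_bigr (fun j => (j == l)%:R)); last by move=> j _; rewrite uE.
  by rewrite delta1 subrr mulr0 addr0.
have k0 i x : (0 <= k i x)%R by rewrite addr_ge0// mulr_ge0// subr_ge0.
have sG := @canonical_sigma_algebra R n.+1 ord_max.
have mu j : measurable_fun (setT : set (g_sigma_algebraType (canonical_filtration ord_max))) (u j).
  rewrite (_ : u j = \1_[set fm_pt j : T]).
    apply: measurable_indic; apply: (sub_measurable_Gset sG).
    rewrite (_ : [set _] = [set y | past ord_max y = past ord_max (fm_pt j)]).
      exact: canonical_filtration_class.
    by apply/seteqP; split => y; [move=> ->|exact: past_last].
  apply/funext => x; rewrite /u indicE; congr ((nat_of_bool _)%:R).
  by apply/idP/idP => [/eqP ->|/set_mem ->//]; exact: mem_set.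
have Gk i : Gmeas (fp_filtration fm_process ord_max) (k i).
  apply/(GmeasP sG); apply: measurable_funD; first exact: mu.
  apply: measurable_funM => //; apply: measurable_funB => //.
  exact: measurable_sum.
have mk i : measurable_fun setT (k i) := fp_Gmeas_measurable (Gk i).
have int_k A i : measurable A ->
    \int[fp_prob fm_process]_(x in A) (k i x)%:E = (fm_wt i * \1_A (fm_pt i : T))%:E.
  move=> mA; rewrite [LHS]ge0_integral_fm_law//; congr (_%:E).
  rewrite (bigD1 i)//= kE eqxx mulr1 big1 ?addr0// => l li.
  by rewrite kE eq_sym (negbTE li) mulr0.
have int_sk A (Q : pred (fm_idx f)) : measurable A ->
    \int[fp_prob fm_process]_(x in A) (\sum_(j | Q j) k j x)%:E =
    (\sum_(j | Q j) fm_wt j * \1_A (fm_pt j : T))%:E.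
  move=> mA; rewrite -sumEFin.
  under eq_integral do rewrite -sumEFin big_mkcond.
  rewrite ge0_integral_sum//.
  + rewrite [RHS]big_mkcond; apply: eq_bigr => j _.
    by case: (Q j); rewrite ?integral0// int_k.
  + move=> j; case: (Q j) => //.
    by apply/measurable_EFinP; exact: measurable_funTS.
  + by move=> j x _; case: (Q j) => //; rewrite lee_fin.
exists k.
  split => //.
  - move=> x; rewrite big_split/= -mulr_suml delta1 mul1r.
    by rewrite addrC subrK.
  - by move=> i; rewrite int_k// indicT mulr1.
  - move=> t i; exists (\1_[set y : T | past t y = past t (fm_pt i)]).
    have Gc := @canonical_filtration_class R n t (fm_pt i).
    split.
    + apply/(GmeasP (@canonical_sigma_algebra R n.+1 t)); apply: measurable_indic.
      exact: (sub_measurable_Gset (@canonical_sigma_algebra R n.+1 t)).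
    + by move=> x; rewrite indicE; case: (_ \in _); rewrite lexx ler01.
    + move=> A FA; have mA : measurable A by exact: fp_sub_measurable FA.
      have mi : measurable_fun setT
          (\1_[set y : T | past t y = past t (fm_pt i)] : T -> R).
        by apply: measurable_indic; exact: (canonical_sub_measurable Gc).
      have i0' (x : T) : (0 <= (\1_[set y : T | past t y = past t (fm_pt i)] x : R))%R.
        by rewrite indicE; case: (_ \in _).
      rewrite int_sk// [RHS]ge0_integral_fm_law//.
      congr (_%:E); rewrite big_mkcond; apply: eq_bigr => j _.
      rewrite [X in (_ = _ * X)%R]indicE.
      have -> : ((fm_pt j : T) \in [set y | past t y = past t (fm_pt i)]) = same_past t i j.
        apply/idP/idP => [/set_mem/= e|/eqP e]; last exact/mem_set.
        by rewrite /same_past e.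
      by case: ifP => _; rewrite ?mulr1// mulr0.
  - move=> t i B FB; have mB : measurable B by exact: fp_sub_measurable FB.
    rewrite int_k// int_sk// -!EFinM; congr (_%:E).
    rewrite mulrCA mulr_suml; congr (_ * _)%R; apply: eq_bigr => j /eqP ij.
    congr (_ * _)%R; rewrite !indicE; congr ((nat_of_bool _)%:R).
    apply/idP/idP; rewrite !inE => h.
    + exact: canonical_filtration_past FB ij h.
    + exact: canonical_filtration_past FB (esym ij) h.
rewrite /weight_cost big1 ?lee_fin ?powR_ge0// => i _.
rewrite [LHS]ge0_integral_fm_law//.
- rewrite big1// => l _; rewrite kE; case: eqP => [->|_]; last by rewrite mul0r mulr0.
  rewrite mul1r /pcost big1 ?mulr0// => s _.
  by rewrite subrr normr0 powR0// gt_eqF// (lt_le_trans ltr01).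
- apply: measurable_funM; first exact: mk.
  exact: (@measurable_cost_model R n p (tnth (fm_pt i)) fm_process).
- by move=> x; rewrite mulr_ge0// pcost_ge0.
Qed.

End finite_law.

(** * Approximation by models *)

Section discrete_functions.
Context (R : realType) d (T : measurableType d) (G : set (set T)).
Hypothesis sG : sigma_algebra setT G.

Lemma Gmeas_nat_fun (u : T -> nat) (F : nat -> R) :
  (forall v, G [set w | u w = v]) -> Gmeas G (F \o u).
Proof.
move=> Gu _ [C mC <-]; rewrite setTI; apply: (Gset_sub_measurable sG).
rewrite (_ : _ @^-1` _ = \bigcup_(v in [set v | C (F v)]) [set w | u w = v]).
  by apply: bigcup_measurable => v _; exact: (sub_measurable_Gset sG).
by apply/seteqP; split => w /= => [h|[v Cv uv]]; [exists (u w)|rewrite uv].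
Qed.

(** Finitely many bounded integer functions are packed into one state, numbered from 1: the value 0
    is reserved for a killed path. *)
Lemma finite_code (I : finType) (u : I -> T -> nat) (b : nat) :
  (forall i w, (u i w <= b)%N) -> (forall i v, G [set w | u i w = v]) ->
  exists K (S : T -> nat), [/\ forall w, (0 < S w < K)%N,
    forall v, G [set w | S w = v] &
    forall i w w', S w = S w' -> u i w = u i w'].
Proof.
move=> ub Gu.
pose c w : {ffun I -> 'I_b.+1} := [ffun i => inord (u i w)].
have cE i w : c w i = u i w :> nat by rewrite ffunE inordK// ltnS.
pose S w := (enum_rank (c w)).+1.
exists #|{ffun I -> 'I_b.+1}|.+1, S; split.
- by move=> w; rewrite /S /= ltnS; exact: ltn_ord.
- move=> v; apply: (Gset_sub_measurable sG).
  have [[w0 w0v]|nv] := pselect (exists w, S w = v).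
    rewrite (_ : [set _ | _] =
        \bigcap_(i in [set: I]) [set w | u i w = u i w0]).
      apply: fin_bigcap_measurable => [|i _]; first exact: finite_finset.
      exact: (sub_measurable_Gset sG).
    apply/seteqP; split => w /=.
      rewrite -w0v /S => -[/val_inj/enum_rank_inj cw] i _ /=.
      by rewrite -!cE cw.
    move=> h; rewrite -w0v /S; congr (_.+1); congr (nat_of_ord (enum_rank _)).
    by apply/ffunP => i; apply: val_inj; rewrite /= !cE; exact: h.
  rewrite (_ : [set _ | _] = set0)//; apply/seteqP; split => w //= Sw.
  by apply: nv; exists w.
- by move=> i w w'; rewrite /S => -[/val_inj/enum_rank_inj cw]; rewrite -!cE cw.
Qed.

Lemma truncn_fiber (x : T -> R) (v : nat) : (forall w, 0 <= x w) -> Gmeas G x ->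
  G [set w | Num.truncn (x w) = v].
Proof.
move=> x0 Gx.
rewrite (_ : [set _ | _] = x @^-1` `[v%:R, v.+1%:R[%classic).
  by apply: Gx; exists `[v%:R, v.+1%:R[%classic => //; rewrite setTI.
apply/seteqP; split => w /=; rewrite in_itv/=.
  by move=> <-; exact: truncn_itv.
by move=> /truncn_def.
Qed.

End discrete_functions.

(** * Backward construction of the states *)

Section coding_step.
Local Open Scope ereal_scope.
Context (R : realType) d (T : measurableType d) (P : probability T R).
Variables (G H : set (set T)).
Hypotheses (sG : sigma_algebra setT G) (GM : G `<=` measurable).
Hypotheses (sH : sigma_algebra setT H) (HM : H `<=` measurable) (GH : G `<=` H).

(* The next state [S'] is thinned by the survival probability [alpha], so that
   its surviving conditional law given [G] is a function [l] of the state [S]. *)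
Definition survival (S S' : T -> nat) (delta : R) (alpha : T -> R)
    (l : nat -> nat -> R) (l0 : nat -> R) : Prop :=
  [/\ Gmeas H alpha, forall w, (0 <= alpha w <= 1)%R,
    \int[P]_w (1 - alpha w)%:E <= delta%:E,
    forall B v, G B -> \int[P]_(w in B) ((S' w == v)%:R * alpha w)%:E =
                       \int[P]_(w in B) (l (S w) v)%:E &
    forall B, G B -> \int[P]_(w in B) (1 - alpha w)%:E =
                     \int[P]_(w in B) (l0 (S w))%:E].

(** The conditional probabilities [p v] of the next state are rounded down to multiples [q v] of
    [1/m], and [S] records [g] together with these multiples. Keeping the value [v] with probability
    [q v / p v] leaves it exactly the conditional mass [q v], a function of [S]. *)
Lemma coding_step (S' : T -> nat) (K' : nat) (g : T -> nat) (b : nat) (delta : R) :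
  (0 < delta)%R -> (forall w, (S' w < K')%N) -> (forall v, H [set w | S' w = v]) ->
  (forall w, (g w <= b)%N) -> (forall v, G [set w | g w = v]) ->
  exists K (S : T -> nat) (alpha : T -> R) (l : nat -> nat -> R) (l0 : nat -> R),
  [/\ forall w, (0 < S w < K)%N, forall v, G [set w | S w = v],
      forall w w', S w = S w' -> g w = g w',
      survival S S' delta alpha l l0 &
      (forall j v, (0 <= l j v)%R) /\ (forall j, (0 <= l0 j)%R)].
Proof.
move=> delta0 S'K HS' gb Gg.
pose phi (v : 'I_K') w : R := (S' w == v)%:R.
have phi0 v w : (0 <= phi v w)%R by rewrite /phi; case: (_ == _).
have Hphi v : Gmeas H (phi v).
  exact: (Gmeas_nat_fun sH (F := fun k => (k == v)%:R)).
have mphi v : measurable_fun setT (phi v) := Gmeas_measurable HM (Hphi v).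
have phi1 w : (\sum_v phi v w = 1)%R.
  rewrite (bigD1 (Ordinal (S'K w)))//= /phi eqxx big1 ?addr0// => v.
  by rewrite -val_eqE/= eq_sym => /negbTE ->.
have [p [Gp p0 p1 pE]] := cond_expectation_partition sG GM P mphi phi0 phi1.
have mp v : measurable_fun setT (p v) := Gmeas_measurable GM (Gp v).
have p01 v w : (0 <= p v w <= 1)%R.
  by rewrite p0/= -(p1 w) (bigD1 v)//= lerDl sumr_ge0.
(* Rounding loses at most [1/m] for each of the [K'] values, hence a death probability of at most
   [K'/m <= delta]. *)
pose m := (Num.truncn (K'%:R / delta)).+1.
have m0 : (0 < m%:R :> R)%R by rewrite ltr0n.
have Km : (K'%:R / m%:R <= delta)%R.
  rewrite ler_pdivrMr// mulrC -ler_pdivrMr//.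
  by apply/ltW; have /andP[] := truncn_itv (divr_ge0 (ler0n R K') (ltW delta0)).
pose dig v w := Num.truncn (m%:R * p v w).
have mp0 v w : (0 <= m%:R * p v w)%R by rewrite mulr_ge0.
have Gdig v k : G [set w | dig v w = k].
  apply: truncn_fiber => //.
  apply/(GmeasP sG); apply: measurable_funM; first exact: measurable_cst.
  exact/(GmeasP sG).
have digm v w : (dig v w <= m)%N.
  rewrite -(ler_nat R); apply: (@le_trans _ _ (m%:R * p v w)%R).
    by have /andP[] := truncn_itv (mp0 v w).
  by rewrite ler_piMr//; case/andP: (p01 v w).
(* [None] stands for [g] and [Some v] for the digit of the v-th probability. *)
have [|[v|] k|K [S [S0 GS Sd]]] := @finite_code _ _ _ sG (option 'I_K')
    (fun o => if o is Some v then dig v else g) (maxn b m).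
- by case=> [v|] w; rewrite leq_max ?digm ?gb ?orbT.
- exact: Gdig.
- exact: Gg.
pose q v w : R := ((dig v w)%:R / m%:R)%R.
have q0 v w : (0 <= q v w)%R by rewrite divr_ge0.
have qp v w : (q v w <= p v w)%R.
  rewrite ler_pdivrMr// mulrC.
  by have /andP[] := truncn_itv (mp0 v w).
have pq v w : (p v w - q v w <= m%:R^-1)%R.
  rewrite lerBlDl /q -[X in (_ + X)%R]mul1r -mulrDl ler_pdivlMr// mulrC natr1.
  by have /andP[_ /ltW] := truncn_itv (mp0 v w).
have Gq v : Gmeas G (q v).
  exact: (Gmeas_nat_fun sG (F := fun k => k%:R / m%:R)%R).
have mq v : measurable_fun setT (q v) := Gmeas_measurable GM (Gq v).
pose ratio v w : R := (q v w / p v w)%R.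
have ratio01 v w : (0 <= ratio v w <= 1)%R.
  rewrite divr_ge0//=.
  have [p00|pn0] := eqVneq (p v w) 0%R; first by rewrite /ratio p00 invr0 mulr0.
  by rewrite ler_pdivrMr ?mul1r// lt_neqAle eq_sym pn0 p0.
have pratio v w : (p v w * ratio v w = q v w)%R.
  rewrite /ratio; have [p00|pn0] := eqVneq (p v w) 0%R; last by rewrite mulrC divfK.
  by apply/eqP; rewrite p00 mul0r eq_le q0 -p00 qp.
have Gratio v : Gmeas G (ratio v).
  apply/(GmeasP sG); apply: measurable_funM; first exact/(GmeasP sG).
  under eq_fun do rewrite -powR_inv1//.
  apply: (measurableT_comp (measurable_powR _)).
  exact/(GmeasP sG).
have mratio v : measurable_fun setT (ratio v) := Gmeas_measurable GM (Gratio v).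
pose alpha w : R := (\sum_v phi v w * ratio v w)%R.
have alphaE w (v : 'I_K') : S' w = v -> alpha w = ratio v w.
  move=> Sv; rewrite /alpha (bigD1 v)//= /phi Sv eqxx mul1r big1 ?addr0// => u.
  by rewrite -val_eqE/= eq_sym => /negbTE ->; rewrite mul0r.
have alpha01 w : (0 <= alpha w <= 1)%R by rewrite (alphaE w (Ordinal (S'K w))).
have alphaC w : (1 - alpha w = \sum_v (1 - ratio v w) * phi v w)%R.
  rewrite -[X in (X - _ = _)%R](phi1 w) /alpha -sumrB; apply: eq_bigr => v _; ring.
have Halpha : Gmeas H alpha.
  apply/(GmeasP sH); apply: measurable_sum => v; apply: measurable_funM.
    exact/(GmeasP sH).
  by apply/(GmeasP sH); apply: subset_trans (Gratio v) GH.
(* Any outcome in state [j] represents it, since the digits depend on the state only; states that do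
   not occur get the default [point]. *)
pose r j := xget point [set w | S w = j].
have rE w v : dig v (r (S w)) = dig v w.
  apply: (Sd (Some v)); rewrite /r.
  by apply: (@xgetPex _ point [set w' | S w' = S w]); exists w.
pose l j (v : nat) : R := if insub v is Some v' then q v' (r j) else 0%R.
have lE w (v : 'I_K') : l (S w) v = q v w by rewrite /l valK /q rE.
pose l0 j : R := (1 - \sum_v q v (r j))%R.
have l0E w : l0 (S w) = (\sum_v (p v w - q v w))%R.
  rewrite sumrB p1 /l0; congr (_ - _)%R.
  by apply: eq_bigr => v _; rewrite /q rE.
have key B : G B -> \int[P]_(w in B) (1 - alpha w)%:E =
    \int[P]_(w in B) (l0 (S w))%:E.
  move=> GB; have mB := GM GB.
  under eq_integral do rewrite alphaC -sumEFin.
  under [RHS]eq_integral do rewrite l0E -sumEFin.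
  have r0 v w : (0 <= 1 - ratio v w)%R by rewrite subr_ge0; case/andP: (ratio01 v w).
  have mr v : measurable_fun setT (fun w => 1 - ratio v w)%R by exact: measurable_funB.
  rewrite !ge0_integral_sum//.
  + apply: eq_bigr => v _.
    rewrite (integral_Gmeas_mulr sG GM (phi := phi v) (psi := p v)
      (g := fun w => (1 - ratio v w)%R))//.
    * by apply: eq_integral => w _; rewrite mulrBl mul1r mulrC pratio.
    * by move=> A GA; rewrite pE.
    * apply/(GmeasP sG); apply: measurable_funB => //; exact/(GmeasP sG).
  + by move=> v; apply/measurable_EFinP; apply: measurable_funTS; exact: measurable_funB.
  + by move=> v w _; rewrite lee_fin subr_ge0.
  + by move=> v; apply/measurable_EFinP; apply: measurable_funTS; exact: measurable_funM.
  + by move=> v w _; rewrite lee_fin mulr_ge0.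
exists K, S, alpha, l, l0; split => //.
- by move=> w w' e; exact: (Sd None w w' e).
- split => //.
  + rewrite key; last exact: Gset_setT.
    apply: (@le_trans _ _ (\int[P]_w (cst delta%:E w))); last first.
      by rewrite integral_cst// [X in _ * X](probability_setT P) mule1.
    apply: ge0_le_integral => //.
    * by move=> w _; rewrite lee_fin l0E sumr_ge0// => v _; rewrite subr_ge0.
    * apply/measurable_EFinP; apply: (Gmeas_measurable GM).
      exact: (Gmeas_nat_fun sG (F := l0)).
    * move=> w _; rewrite lee_fin l0E; apply: le_trans Km.
      apply: (@le_trans _ _ (\sum_(v < K') m%:R^-1)%R).
        by apply: ler_sum => v _; exact: pq.
      by rewrite sumr_const card_ord -[leLHS]mulr_natl lexx.
  + move=> B v GB; have mB := GM GB.
    have [vK|vK] := ltnP v K'; last first.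
      have lv w : l (S w) v = 0%R by rewrite /l insubN// -leqNgt.
      under [RHS]eq_integral do rewrite lv.
      apply: eq_integral => w _; congr (_%:E).
      by rewrite (ltn_eqF (leq_trans (S'K w) vK)) mul0r.
    under [RHS]eq_integral do rewrite (lE _ (Ordinal vK)).
    transitivity (\int[P]_(w in B) (ratio (Ordinal vK) w * phi (Ordinal vK) w)%:E).
      apply: eq_integral => w _; congr (_%:E); rewrite /phi /=.
      have [Sv|] := eqVneq (S' w) v; last by rewrite mul0r mulr0.
      by rewrite mul1r mulr1 (alphaE w (Ordinal vK)).
    rewrite (integral_Gmeas_mulr sG GM (phi := phi (Ordinal vK))
      (psi := p (Ordinal vK)) (g := ratio (Ordinal vK)))//.
    * by apply: eq_integral => w _; rewrite mulrC pratio.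
    * by move=> A GA; rewrite pE.
    * by move=> w; case/andP: (ratio01 (Ordinal vK) w).
- split.
  + by move=> j v; rewrite /l; case: insub.
  + by move=> j; rewrite subr_ge0 -(p1 (r j)); exact: ler_sum.
Qed.

End coding_step.

Section coding_states.
Context (R : realType) (n : nat) (X : filtered_process R n.+1).

(** Natural times allow successors and descending induction; beyond [n], [inord] falls back to time
    0, whence the side conditions [t <= n]. *)
Definition Fnat (t : nat) : set (set (fp_space X)) := fp_filtration X (inord t).

Lemma Fnat_sigma_algebra t : sigma_algebra setT (Fnat t).
Proof. exact: fp_sigma_algebra. Qed.

Lemma Fnat_measurable t : Fnat t `<=` measurable.
Proof. exact: fp_sub_measurable. Qed.

Lemma Fnat_le s t : (s <= t <= n)%N -> Fnat s `<=` Fnat t.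
Proof.
move=> /andP[st tn]; apply: fp_filtration_le.
by rewrite !inordK ?ltnS// (leq_trans st).
Qed.

Lemma Fnat_ord (t : 'I_n.+1) : Fnat t = fp_filtration X t.
Proof. by rewrite /Fnat inord_val. Qed.

(** The construction runs backward from time [n], because the state at [t] encodes the conditional
    law of the state at [t + 1]. The final state encodes [g] only. *)
Lemma coding_states (g : nat -> fp_space X -> nat) (b : nat) (delta : R) :
  (0 < delta)%R -> (forall t w, (g t w <= b)%N) ->
  (forall t v, (t <= n)%N -> Fnat t [set w | g t w = v]) ->
  exists K (S : nat -> fp_space X -> nat) (alpha : nat -> fp_space X -> R)
    (l : nat -> nat -> nat -> R) (l0 : nat -> nat -> R),
  [/\ forall t w, (t <= n)%N -> (0 < S t w < K.+1)%N,
      forall t v, (t <= n)%N -> Fnat t [set w | S t w = v],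
      forall t w w', (t <= n)%N -> S t w = S t w' -> g t w = g t w',
      forall t, (t < n)%N -> survival (fp_prob X) (Fnat t) (Fnat t.+1)
        (S t) (S t.+1) delta (alpha t) (l t) (l0 t) &
      (forall t j v, 0 <= l t j v) /\ (forall t j, 0 <= l0 t j)].
Proof.
move=> delta0 gb Fg.
suff H k : (k <= n)%N -> exists K (S : nat -> fp_space X -> nat)
    (alpha : nat -> fp_space X -> R) (l : nat -> nat -> nat -> R) (l0 : nat -> nat -> R),
  [/\ forall t w, (n - k <= t <= n)%N -> (0 < S t w < K.+1)%N,
      forall t v, (n - k <= t <= n)%N -> Fnat t [set w | S t w = v],
      forall t w w', (n - k <= t <= n)%N -> S t w = S t w' -> g t w = g t w',
      forall t, (n - k <= t < n)%N -> survival (fp_prob X) (Fnat t) (Fnat t.+1)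
        (S t) (S t.+1) delta (alpha t) (l t) (l0 t) &
      (forall t j v, 0 <= l t j v) /\ (forall t j, 0 <= l0 t j)].
  have [K [S [alpha [l [l0 [H1 H2 H3 H4 H5]]]]]] := H n (leqnn n).
  rewrite subnn in H1 H2 H3 H4.
  by exists K, S, alpha, l, l0.
elim: k => [_|k ih kn].
  have [|_ v|K [S [S0 FS Sg]]] := @finite_code _ _ _ (Fnat_sigma_algebra n)
    unit (fun=> g n) b; [by move=> _ w; exact: gb|exact: Fg|].
  exists K, (fun=> S), (fun _ _ => 0), (fun _ _ _ => 0), (fun _ _ => 0).
  rewrite subn0; split => //.
  - by move=> t w _; have /andP[-> /= h] := S0 w; exact: leqW.
  - by move=> t v; rewrite -eqn_leq => /eqP <-; exact: FS.
  - by move=> t w w'; rewrite -eqn_leq => /eqP <-; exact: (Sg tt).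
  - by move=> t /andP[nt tn]; move: (leq_trans tn nt); rewrite ltnn.
have [K' [S' [alpha' [l' [l0' [H1 H2 H3 H4 [H5 H6]]]]]]] := ih (ltnW kn).
set t0 := (n - k.+1)%N.
have t0k : (n - k = t0.+1)%N by rewrite /t0 subnSK.
have t0n : (t0 < n)%N by rewrite -t0k leq_subr.
have t0n1 : (n - k <= t0.+1 <= n)%N by rewrite t0k leqnn.
have [||v||v|K [S [alpha [l [l0 [S0 FS Sg sv [lge l0ge]]]]]]] :=
  @coding_step R _ _ (fp_prob X) (Fnat t0) (Fnat t0.+1) (Fnat_sigma_algebra t0)
    (@Fnat_measurable t0) (Fnat_sigma_algebra t0.+1) (@Fnat_measurable t0.+1) _
    (S' t0.+1) K'.+1 (g t0) b delta delta0.
- by apply: Fnat_le; rewrite leqnSn.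
- by move=> w; have /andP[] := H1 t0.+1 w t0n1.
- exact: H2.
- by move=> w; exact: gb.
- by apply: Fg; exact: ltnW.
pose upd (A : Type) (a : A) (u : nat -> A) t := if t == t0 then a else u t.
exists (maxn K K'), (upd _ S S'), (upd _ alpha alpha'), (upd _ l l'), (upd _ l0 l0').
have late t m : (t0 <= t <= m)%N -> t != t0 -> (n - k <= t <= m)%N.
  by move=> /andP[t0t ->] tt0; rewrite t0k andbT ltn_neqAle eq_sym tt0.
split.
- move=> t w tn; rewrite /upd; case: eqVneq => [_|tt0].
    have /andP[-> /= h] := S0 w.
    by apply: (leq_trans h); rewrite leqW// leq_maxl.
  have /andP[-> /= h] := H1 t w (late _ _ tn tt0).
  by apply: (leq_trans h); rewrite ltnS leq_maxr.
- move=> t v tn; rewrite /upd; case: eqVneq => [->|tt0]; first exact: FS.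
  exact: H2 (late _ _ tn tt0).
- move=> t w w' tn; rewrite /upd; case: eqVneq => [->|tt0]; first exact: Sg.
  exact: H3 (late _ _ tn tt0).
- move=> t /andP[t0t tn].
  have tS : t.+1 != t0 by rewrite gtn_eqF.
  rewrite /upd (negbTE tS); case: eqVneq => [->//|tt0].
  apply: H4; rewrite tn andbT.
  by have /andP[] := @late t t (introT andP (conj t0t (leqnn t))) tt0.
- by split=> [t j v|t j]; rewrite /upd; case: eqVneq.
Qed.

End coding_states.

Fixpoint agree (s r : nat -> nat) (t : nat) : bool :=
  (s t == r t) && (if t is t'.+1 then agree s r t' else true).

Lemma agreeP (s r : nat -> nat) t :
  reflect (forall u, (u <= t)%N -> s u = r u) (agree s r t).
Proof.
elim: t => [|t ih] /=.
  rewrite andbT; apply: (iffP eqP) => [e u|h]; last exact: h.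
  by rewrite leqn0 => /eqP ->.
apply: (iffP andP) => [[/eqP e /ih h] u|h].
  by rewrite leq_eqVlt => /predU1P[->//|]; rewrite ltnS; exact: h.
by split; [exact/eqP/h|apply/ih => u ut; apply: h; rewrite leqW].
Qed.

Lemma agree_eqr (s r r' : nat -> nat) t :
  (forall u, (u <= t)%N -> r u = r' u) -> agree s r t = agree s r' t.
Proof.
by move=> e; apply/agreeP/agreeP => h u ut; rewrite h// e.
Qed.

(** * The weights of the killed path of states *)

Section survival_weights.
Context (R : realType) (n : nat) (X : filtered_process R n.+1).
Local Notation T := (fp_space X).
Local Notation P := (fp_prob X).
Local Notation F := (@Fnat R n X).
Variables (K : nat) (S : nat -> T -> nat) (alpha : nat -> T -> R).
Variables (l : nat -> nat -> nat -> R) (l0 : nat -> nat -> R) (delta : R).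
Hypothesis SK : forall t w, (t <= n)%N -> (0 < S t w < K.+1)%N.
Hypothesis FS : forall t v, (t <= n)%N -> F t [set w | S t w = v].
Hypothesis sv : forall t, (t < n)%N -> survival P (F t) (F t.+1)
  (S t) (S t.+1) delta (alpha t) (l t) (l0 t).
Hypotheses (l_ge0 : forall t j v, 0 <= l t j v) (l0_ge0 : forall t j, 0 <= l0 t j).
Variable z : 'I_n.+1 -> 'I_K.+1 -> R.
Hypothesis z_inj : forall t, injective (z t).

(* The path of states is killed after time [tau] with probability [death tau],
   never surviving time [n]; the state [0] stands for a killed path. *)
Definition surv (t : nat) (w : T) : R := if (t < n)%N then alpha t w else 0.
Definition alive (t : nat) (w : T) : R := \prod_(i < t) surv i w.
Definition death (t : nat) (w : T) : R := alive t w * (1 - surv t w).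
Definition killed (tau : nat) (w : T) (t : nat) : nat :=
  if (t <= tau)%N then S t w else 0%N.

Local Notation I := {ffun 'I_n.+1 -> 'I_K.+1}.
Definition idx (s : I) (t : nat) : nat := s (inord t).
Definition killed_idx (tau : nat) (w : T) : I := [ffun t : 'I_n.+1 => inord (killed tau w t)].

Lemma surv01 t w : 0 <= surv t w <= 1.
Proof.
rewrite /surv; case: ltnP => [tn|_]; last by rewrite lexx ler01.
by have [_ + _ _ _] := sv tn; exact.
Qed.

Lemma alive_ge0 t w : 0 <= alive t w.
Proof. by apply: prodr_ge0 => i _; case/andP: (surv01 i w). Qed.

Lemma alive_le1 t w : alive t w <= 1.
Proof. by apply: prodr_ile1 => i _; exact: surv01. Qed.

Lemma death_ge0 t w : 0 <= death t w.
Proof.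
by rewrite mulr_ge0 ?alive_ge0// subr_ge0; case/andP: (surv01 t w).
Qed.

Lemma aliveS t w : alive t.+1 w = alive t w * surv t w.
Proof. by rewrite /alive big_ord_recr. Qed.

(** A telescoping sum, which closes because [surv n] is 0: every path is killed by time [n]. *)
Lemma sum_death t w : (t <= n.+1)%N ->
  \sum_(t <= i < n.+1) death i w = alive t w.
Proof.
move=> tn; rewrite (eq_bigr (fun i => (- alive i.+1 w) - (- alive i w))); last first.
  by move=> i _; rewrite aliveS /death; ring.
rewrite telescope_sumr//.
have -> : alive n.+1 w = 0 by rewrite aliveS /surv ltnn mulr0.
by rewrite oppr0 sub0r opprK.
Qed.

Lemma alive0 w : alive 0 w = 1.
Proof. by rewrite /alive big_ord0. Qed.

Lemma killed_lt tau w t : (t <= n)%N -> (killed tau w t < K.+1)%N.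
Proof. by move=> tn; rewrite /killed; case: ifP => // _; have /andP[] := SK w tn. Qed.

Lemma killed_idxE tau w t : (t <= n)%N -> idx (killed_idx tau w) t = killed tau w t.
Proof. by move=> tn; rewrite /idx ffunE inordK// inordK// killed_lt. Qed.

Definition surv_weight (s : I) (w : T) : R :=
  \sum_(0 <= tau < n.+1) death tau w * (killed_idx tau w == s)%:R.

Definition class_weight (t : nat) (s : I) (w : T) : R :=
  \sum_(s' | agree (idx s) (idx s') t) surv_weight s' w.

Lemma sum_surv_weight (Q : pred I) w :
  \sum_(s | Q s) surv_weight s w =
  \sum_(0 <= tau < n.+1) death tau w * (Q (killed_idx tau w))%:R.
Proof.
rewrite /surv_weight exchange_big /=; apply: eq_bigr => tau _.
rewrite -mulr_sumr; congr (_ * _).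
have [Qk|Qk] := boolP (Q (killed_idx tau w)).
  rewrite (bigD1 (killed_idx tau w))//= eqxx big1 ?addr0// => s /andP[_].
  by rewrite eq_sym => /negbTE ->.
rewrite big1// => s Qs; case: eqP => // e; by rewrite e Qs in Qk.
Qed.

Lemma surv_weight_ge0 s w : 0 <= surv_weight s w.
Proof. by apply: sumr_ge0 => tau _; rewrite mulr_ge0 ?death_ge0. Qed.

Lemma surv_weight_sum1 w : \sum_s surv_weight s w = 1.
Proof.
rewrite sum_surv_weight; under eq_bigr do rewrite mulr1.
by rewrite sum_death// alive0.
Qed.

(** Paths killed after time [t] or later look the same up to [t], and their probabilities add up to
    [alive t]. *)
Lemma class_weightE t s w : (t <= n)%N ->
  class_weight t s w =
  \sum_(0 <= tau < t) death tau w * (agree (idx s) (killed tau w) t)%:R +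
  alive t w * (agree (idx s) (killed t w) t)%:R.
Proof.
move=> tn; rewrite /class_weight sum_surv_weight.
rewrite (big_cat_nat (leq0n t) (leqW tn))/=; congr (_ + _).
  apply: eq_bigr => tau _; congr (_ * (nat_of_bool _)%:R); apply: agree_eqr => u ut.
  by rewrite killed_idxE// (leq_trans ut).
rewrite -(sum_death w (leqW tn)) mulr_suml; apply: eq_big_nat => tau /andP[ttau _].
congr (_ * (nat_of_bool _)%:R); apply: agree_eqr => u ut.
by rewrite killed_idxE ?(leq_trans ut)// /killed ut (leq_trans ut).
Qed.

Lemma class_weight_last s w : class_weight n s w = surv_weight s w.
Proof.
rewrite /class_weight (eq_bigl (pred1 s)) ?big_pred1_eq// => s' /=.
apply/agreeP/eqP => [h|->//].
apply/ffunP => t; apply: val_inj => /=; have := h t; rewrite /idx inord_val => ->//.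
by rewrite -ltnS.
Qed.

(** Live states are positive, so a path at 0 at time [t] was killed before and can only stay at
    0. *)
Lemma class_weightS_dead t s w : (t < n)%N -> idx s t = 0 ->
  class_weight t.+1 s w = (idx s t.+1 == 0%N)%:R * class_weight t s w.
Proof.
move=> tn st0; rewrite !class_weightE ?(ltnW tn)// big_nat_recr//=.
have St : (S t w == 0%N) = false.
  by apply/negbTE; rewrite -lt0n; have /andP[] := SK w (ltnW tn).
have nag : agree (idx s) (killed t w) t = false.
  by apply/negbTE/agreeP => /(_ t (leqnn t)); rewrite st0 /killed leqnn => /esym/eqP; rewrite St.
have nag' : agree (idx s) (killed t.+1 w) t = false.
  by rewrite -nag; apply: agree_eqr => u ut; rewrite /killed ut leqW.
rewrite nag nag' !andbF !mulr0 !addr0 mulr_sumr; apply: eq_big_nat => tau /andP[_ taut].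
rewrite {1}/killed leqNgt (leqW taut)/= mulrCA; congr (_ * _).
by rewrite -mulnb natrM.
Qed.

Lemma class_weight_alive t s w : (t <= n)%N -> idx s t != 0 ->
  class_weight t s w = alive t w * (agree (idx s) (killed t w) t)%:R.
Proof.
move=> tn st0; rewrite class_weightE// big_nat_cond big1 ?add0r// => tau.
move=> /andP[/andP[_ taut] _].
suff -> : agree (idx s) (killed tau w) t = false by rewrite mulr0.
apply/negbTE/agreeP => /(_ t (leqnn t)); rewrite /killed leqNgt taut/= => e.
by rewrite e eqxx in st0.
Qed.

(** From a live state, the path either dies, with factor [1 - alpha t], or survives and moves on to
    [S t.+1]. *)
Lemma class_weightS_alive t s w : (t < n)%N -> idx s t != 0 ->
  class_weight t.+1 s w = class_weight t s w *
    ((idx s t.+1 == 0%N)%:R * (1 - alpha t w) +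
     (S t.+1 w == idx s t.+1)%:R * alpha t w).
Proof.
move=> tn st0; rewrite (class_weight_alive w (ltnW tn) st0) class_weightE//.
rewrite big_nat_recr//= big_nat_cond big1 ?add0r; last first.
  move=> tau /andP[/andP[_ taut] _].
  suff -> : agree (idx s) (killed tau w) t = false by rewrite andbF mulr0.
  apply/negbTE/agreeP => /(_ t (leqnn t)); rewrite /killed leqNgt taut/= => e.
  by rewrite e eqxx in st0.
have -> : agree (idx s) (killed t.+1 w) t = agree (idx s) (killed t w) t.
  by apply: agree_eqr => u ut; rewrite /killed ut leqW.
rewrite /killed ltnn leqnn /death aliveS /surv tn [S _ _ == _]eq_sym.
by case: (agree _ _ _); rewrite ?andbT ?andbF/=; ring.
Qed.

Lemma Gmeas_bool (G : set (set T)) (b : T -> bool) : sigma_algebra setT G ->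
  G [set w | b w] -> Gmeas G (fun w => (b w)%:R : R).
Proof.
move=> sG Gb; rewrite (_ : (fun w => _) = \1_[set w | b w]).
  apply/(GmeasP sG); apply: measurable_indic; exact: (sub_measurable_Gset sG).
by apply/funext => w; rewrite indicE; congr ((nat_of_bool _)%:R); apply/idP/idP; rewrite inE.
Qed.

Lemma Gmeas_mul (G : set (set T)) (u v : T -> R) : sigma_algebra setT G ->
  Gmeas G u -> Gmeas G v -> Gmeas G (fun w => u w * v w).
Proof.
move=> sG Gu Gv; apply/(GmeasP sG).
by apply: measurable_funM; exact/(GmeasP sG).
Qed.

Lemma Gmeas_Fnat_le s t (u : T -> R) : (s <= t <= n)%N -> Gmeas (F s) u -> Gmeas (F t) u.
Proof. by move=> st Gu; apply: subset_trans Gu (Fnat_le st). Qed.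

Lemma surv_Gmeas t : (t < n)%N -> Gmeas (F t.+1) (surv t).
Proof.
move=> tn; have [h _ _ _ _] := sv tn.
by rewrite (_ : surv t = alpha t)//; apply/funext => w; rewrite /surv tn.
Qed.

Lemma alive_Gmeas t : (t <= n)%N -> Gmeas (F t) (alive t).
Proof.
elim: t => [_|t ih tn].
  rewrite (_ : alive 0 = cst 1); last by apply/funext => w; rewrite alive0.
  apply/(GmeasP (@Fnat_sigma_algebra _ _ X 0)); exact: measurable_cst.
rewrite (_ : alive t.+1 = fun w => alive t w * surv t w).
  apply: Gmeas_mul; first exact: Fnat_sigma_algebra.
  - by apply: Gmeas_Fnat_le (ih (ltnW tn)); rewrite leqnSn.
  - exact: surv_Gmeas.
by apply/funext => w; rewrite aliveS.
Qed.

Lemma death_Gmeas t : (t < n)%N -> Gmeas (F t.+1) (death t).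
Proof.
move=> tn; apply: Gmeas_mul; first exact: Fnat_sigma_algebra.
  by apply: Gmeas_Fnat_le (alive_Gmeas (ltnW tn)); rewrite leqnSn.
have sG := @Fnat_sigma_algebra _ _ X t.+1.
apply/(GmeasP sG); apply: measurable_funB; first exact: measurable_cst.
exact/(GmeasP sG)/surv_Gmeas.
Qed.

Lemma agree_Fset tau t (s : I) : (t <= n)%N ->
  F t [set w | agree (idx s) (killed tau w) t].
Proof.
have one u : (u <= n)%N -> F u [set w | idx s u == killed tau w u].
  move=> un; rewrite /killed; case: (leqP u tau) => _.
    rewrite (_ : [set w | _] = [set w | S u w = idx s u]); first exact: FS.
    by apply/seteqP; split => w /=; rewrite eq_sym => /eqP.
  case: (idx s u == 0%N).
    rewrite (_ : [set w | _] = setT).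
      exact: Gset_setT (@Fnat_sigma_algebra _ _ X u).
    by apply/seteqP; split.
  rewrite (_ : [set w | _] = ~` setT).
    apply: (Gset_setC (@Fnat_sigma_algebra _ _ X u)).
    exact: Gset_setT (@Fnat_sigma_algebra _ _ X u).
  by apply/seteqP; split => // w /= [].
elim: t => [n0|t ih tn] /=.
  rewrite (_ : [set w | _] = [set w | idx s 0 == killed tau w 0]); first exact: one.
  by apply/seteqP; split => w /=; rewrite andbT.
rewrite (_ : [set w | _] = [set w | idx s t.+1 == killed tau w t.+1] `&`
    [set w | agree (idx s) (killed tau w) t]).
  apply: (Gset_setI (@Fnat_sigma_algebra _ _ X t.+1)); first exact: one.
  by apply: (Fnat_le _ (ih (ltnW tn))); rewrite leqnSn.
by apply/seteqP; split => w /= => [/andP[]//|[a b]]; rewrite a.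
Qed.

Lemma class_weight_Gmeas t s : (t <= n)%N -> Gmeas (F t) (class_weight t s).
Proof.
move=> tn; have sG := @Fnat_sigma_algebra _ _ X t.
rewrite (_ : class_weight t s = fun w =>
  \sum_(0 <= tau < t) death tau w * (agree (idx s) (killed tau w) t)%:R +
  alive t w * (agree (idx s) (killed t w) t)%:R); last first.
  by apply/funext => w; rewrite class_weightE.
have Ga tau : Gmeas (F t) (fun w => (agree (idx s) (killed tau w) t)%:R : R).
  by apply: Gmeas_bool => //; exact: agree_Fset.
apply/(GmeasP sG); apply: measurable_funD; last first.
  apply/(GmeasP sG); apply: Gmeas_mul => //; exact: alive_Gmeas.
under eq_fun do rewrite big_mkord.
apply: measurable_sum => tau; apply/(GmeasP sG); apply: Gmeas_mul => //.
apply: (@Gmeas_Fnat_le tau.+1); first by rewrite ltn_ord.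
exact/death_Gmeas/(leq_trans (ltn_ord tau)).
Qed.

Lemma class_weight_measurable t s : (t <= n)%N -> measurable_fun setT (class_weight t s).
Proof.
move=> tn; apply: (Gmeas_measurable (@Fnat_measurable _ _ X t)).
exact: class_weight_Gmeas.
Qed.

Lemma class_weight_ge0 t s w : 0 <= class_weight t s w.
Proof. by apply: sumr_ge0 => s' _; exact: surv_weight_ge0. Qed.

(** The exact Markov property. The constant [c] does not depend on [B]: it is the transition
    probability from [idx s t] to [idx s t.+1] in the encoded law. *)
Lemma class_weight_step t s : (t < n)%N -> exists2 c : R, 0 <= c &
  forall B, F t B -> (\int[P]_(w in B) (class_weight t.+1 s w)%:E =
                      c%:E * \int[P]_(w in B) (class_weight t s w)%:E)%E.
Proof.
move=> tn; have mcw := class_weight_measurable s (ltnW tn).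
have [st0|st0] := eqVneq (idx s t) 0%N.
  exists (idx s t.+1 == 0%N)%:R => // B FB; have mB := Fnat_measurable FB.
  under eq_integral do rewrite (class_weightS_dead _ tn st0) EFinM.
  rewrite ge0_integralZl_EFin//.
  - by move=> w _; rewrite lee_fin class_weight_ge0.
  - by apply/measurable_EFinP; exact: measurable_funTS.
pose c0 : R := (idx s t.+1 == 0%N)%:R.
pose psi j := c0 * l0 t j + l t j (idx s t.+1).
have c00 : 0 <= c0 by [].
have psi0 j : 0 <= psi j by rewrite addr_ge0// mulr_ge0.
exists (psi (idx s t)) => // B FB; have mB := Fnat_measurable FB.
have [Galpha alpha01 _ alphaE alphaCE] := sv tn.
have alpha0 w : 0 <= alpha t w by case/andP: (alpha01 w).
have alpha1 w : 0 <= 1 - alpha t w by rewrite subr_ge0; case/andP: (alpha01 w).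
have malpha := Gmeas_measurable (@Fnat_measurable _ _ X t.+1) Galpha.
have malphaC : measurable_fun setT (fun w => 1 - alpha t w) by exact: measurable_funB.
have sG := @Fnat_sigma_algebra _ _ X t.
have mS (h : nat -> R) : measurable_fun setT (fun w => h (S t w)).
  apply: (Gmeas_measurable (@Fnat_measurable _ _ X t)).
  by apply: (Gmeas_nat_fun sG (F := h)) => v; exact/FS/ltnW.
have meqS : measurable_fun setT (fun w => (S t.+1 w == idx s t.+1)%:R : R).
  apply: (Gmeas_measurable (@Fnat_measurable _ _ X t.+1)).
  apply: (Gmeas_nat_fun (@Fnat_sigma_algebra _ _ X t.+1)
    (F := fun k => (k == idx s t.+1)%:R)) => v; exact: FS.
pose phi w : R := c0 * (1 - alpha t w) + (S t.+1 w == idx s t.+1)%:R * alpha t w.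
have phi0 w : 0 <= phi w by rewrite addr_ge0// mulr_ge0.
have mphi : measurable_fun setT phi.
  apply: measurable_funD; first exact: measurable_funM.
  exact: measurable_funM.
(* Where the class weight does not vanish, the current state is [idx s t], so [psi (S t w)] is the
   constant [psi (idx s t)]. *)
transitivity (\int[P]_(w in B) (class_weight t s w * psi (S t w))%:E)%E; last first.
  rewrite -ge0_integralZl_EFin//; last 2 first.
  - by move=> w _; rewrite lee_fin class_weight_ge0.
  - by apply/measurable_EFinP; exact: measurable_funTS.
  apply: eq_integral => w _; rewrite -EFinM; congr (_%:E).
  rewrite (class_weight_alive w (ltnW tn) st0).
  have [/agreeP h|_] := boolP (agree _ _ _); last by rewrite !mulr0 mul0r.
  by rewrite [RHS]mulrC (h t (leqnn t)) /killed leqnn.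
transitivity (\int[P]_(w in B) (class_weight t s w * phi w)%:E)%E.
  by apply: eq_integral => w _; rewrite (class_weightS_alive w tn st0).
apply: (integral_Gmeas_mulr sG (@Fnat_measurable _ _ X t)
  (phi := phi) (psi := fun w => psi (S t w)) (g := class_weight t s)) => //.
- move=> A FA; have mA := Fnat_measurable FA.
  under eq_integral do rewrite EFinD.
  under [RHS]eq_integral do rewrite EFinD.
  rewrite !ge0_integralD//.
  + congr (_ + _)%E; last exact: alphaE.
    under eq_integral do rewrite EFinM.
    under [RHS]eq_integral do rewrite EFinM.
    rewrite !ge0_integralZl_EFin//; first by rewrite alphaCE.
    * by move=> w _; rewrite lee_fin.
    * by apply/measurable_EFinP; exact: measurable_funTS.
    * by move=> w _; rewrite lee_fin.
    * by apply/measurable_EFinP; exact: measurable_funTS.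
  + by move=> w _; rewrite lee_fin mulr_ge0.
  + by apply/measurable_EFinP; apply: measurable_funTS; exact: measurable_funM.
  + by move=> w _; rewrite lee_fin.
  + apply/measurable_EFinP.
    exact: (measurable_funTS (mS (fun j => l t j (idx s t.+1)))).
  + by move=> w _; rewrite lee_fin mulr_ge0.
  + by apply/measurable_EFinP; apply: measurable_funTS; exact: measurable_funM.
  + by move=> w _; rewrite lee_fin mulr_ge0.
  + by apply/measurable_EFinP; apply: measurable_funTS; exact: measurable_funM.
- exact: class_weight_ge0.
- by apply: class_weight_Gmeas; exact: ltnW.
Qed.

(** The steps from [t] to [n] are composed. As [c] is the same for all [B], comparing [B] with the
    whole space gives [wt_causal]. *)
Lemma class_weight_steps t s : (t <= n)%N -> exists c : R,
  forall B, F t B -> (\int[P]_(w in B) (surv_weight s w)%:E =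
                      c%:E * \int[P]_(w in B) (class_weight t s w)%:E)%E.
Proof.
move=> tn; have [k kE] : exists k, (n - t)%N = k by exists (n - t)%N.
elim: k t tn kE => [|k ih] t tn kE.
  have -> : t = n by apply/eqP; rewrite eqn_leq tn -subn_eq0 kE.
  exists 1 => B FB; rewrite mul1e; apply: eq_integral => w _.
  by rewrite class_weight_last.
have tn' : (t < n)%N by rewrite -subn_gt0 kE.
have [|c cE] := ih t.+1 tn'; first by rewrite subnS kE.
have [c' c'0 c'E] := class_weight_step s tn'.
exists (c * c') => B FB; rewrite EFinM -muleA -c'E// -cE//.
by apply: (Fnat_le _ FB); rewrite leqnSn.
Qed.

Definition surv_mass (s : I) : R := fine (\int[P]_w (surv_weight s w)%:E)%E.

Lemma surv_weight_measurable s : measurable_fun setT (surv_weight s).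
Proof.
rewrite (_ : surv_weight s = class_weight n s); first exact: class_weight_measurable.
by apply/funext => w; rewrite class_weight_last.
Qed.

Lemma surv_weight_Gmeas s : Gmeas (F n) (surv_weight s).
Proof.
rewrite (_ : surv_weight s = class_weight n s); first exact: class_weight_Gmeas.
by apply/funext => w; rewrite class_weight_last.
Qed.

Lemma surv_massE s : (\int[P]_w (surv_weight s w)%:E = (surv_mass s)%:E)%E.
Proof.
rewrite /surv_mass fineK// integrable_fin_num//.
apply: ge0_integrable_le1 => //; first exact: surv_weight_measurable.
move=> w; rewrite surv_weight_ge0/= -(surv_weight_sum1 w) (bigD1 s)//= lerDl.
by apply: sumr_ge0 => s' _; exact: surv_weight_ge0.
Qed.

Lemma integral_class_weight t s B : measurable B ->
  (\int[P]_(w in B) (class_weight t s w)%:E =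
   \sum_(s' | agree (idx s) (idx s') t) \int[P]_(w in B) (surv_weight s' w)%:E)%E.
Proof.
move=> mB; rewrite /class_weight.
under eq_integral do rewrite -sumEFin big_mkcond.
rewrite ge0_integral_sum//; last 2 first.
- move=> s'; case: (agree _ _ _) => //.
  by apply/measurable_EFinP; apply: measurable_funTS; exact: surv_weight_measurable.
- by move=> s' w _; case: (agree _ _ _) => //; rewrite lee_fin surv_weight_ge0.
by rewrite [RHS]big_mkcond; apply: eq_bigr => s' _; case: (agree _ _ _); rewrite ?integral0.
Qed.

Lemma surv_mass_ge0 s : 0 <= surv_mass s.
Proof.
by apply: fine_ge0; apply: integral_ge0 => w _; rewrite lee_fin surv_weight_ge0.
Qed.

Lemma surv_mass_sum1 : \sum_s surv_mass s = 1.
Proof.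
apply: EFin_inj; rewrite -sumEFin; under eq_bigr do rewrite -surv_massE.
rewrite -ge0_integral_sum//.
- under eq_integral do rewrite sumEFin surv_weight_sum1.
  by rewrite integral_cst// mul1e [LHS](probability_setT P).
- by move=> s; apply/measurable_EFinP; exact: surv_weight_measurable.
- by move=> s w _; rewrite lee_fin surv_weight_ge0.
Qed.

Definition surv_pt (s : I) : n.+1.-tuple R := [tuple z t (s t) | t < n.+1].

Lemma surv_pt_inj : injective surv_pt.
Proof.
move=> s s' e; apply/ffunP => t; apply: (@z_inj t).
by have := congr1 (fun x => tnth x t) e; rewrite !tnth_mktuple.
Qed.

Definition surv_model : fmodel R n :=
  @FModel R n I surv_pt surv_mass surv_pt_inj surv_mass_ge0 surv_mass_sum1.

Lemma same_past_surv (t : 'I_n.+1) (s s' : fm_idx surv_model) :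
  same_past t s s' = agree (idx s) (idx s') t.
Proof.
apply/eqP/agreeP => [/pastP h u ut|h].
  have un : (u < n.+1)%N by exact: leq_ltn_trans ut (ltn_ord t).
  have := h (Ordinal un) ut; rewrite !tnth_mktuple => /z_inj e.
  by rewrite /idx (_ : inord u = Ordinal un) ?e//; apply: val_inj; rewrite /= inordK.
apply/pastP => u ut; rewrite !tnth_mktuple; congr (z _ _).
by apply: val_inj; have := h u ut; rewrite /idx inord_val.
Qed.

Lemma surv_is_weight : is_weight (f := surv_model) (X := X) surv_weight.
Proof.
split.
- by move=> s; rewrite -Fnat_ord; exact: surv_weight_Gmeas.
- exact: surv_weight_ge0.
- exact: surv_weight_sum1.
- exact: surv_massE.
- move=> t s; have tn : (t <= n)%N by rewrite -ltnS.
  have cwE w : \sum_(j | same_past t s j) surv_weight j w = class_weight t s w.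
    by rewrite /class_weight; apply: eq_bigl => j; rewrite same_past_surv.
  exists (class_weight t s); split.
  + by rewrite -Fnat_ord; exact: class_weight_Gmeas.
  + move=> w; rewrite class_weight_ge0/= -(surv_weight_sum1 w) /class_weight.
    rewrite [leRHS](bigID (fun s' => agree (idx s) (idx s') t))/= lerDl.
    by apply: sumr_ge0 => s' _; exact: surv_weight_ge0.
  + by move=> A FA; apply: eq_integral => w _; rewrite cwE.
- move=> t s B FB; have tn : (t <= n)%N by rewrite -ltnS.
  have mB := fp_sub_measurable FB; rewrite -Fnat_ord in FB.
  have cwE w : \sum_(j | same_past t s j) surv_weight j w = class_weight t s w.
    by rewrite /class_weight; apply: eq_bigl => j; rewrite same_past_surv.
  under [in RHS]eq_integral do rewrite cwE.
  have [c cE] := class_weight_steps s tn.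
  have -> : ((\sum_(j | same_past t s j) surv_mass j)%:E =
      \int[P]_w (class_weight t s w)%:E)%E.
    rewrite integral_class_weight// -sumEFin.
    under eq_bigl do rewrite same_past_surv.
    by apply: eq_bigr => j _; rewrite surv_massE.
  have FT : F t setT by exact: Gset_setT (@Fnat_sigma_algebra _ _ X t).
  rewrite -[(fm_wt s)%:E]surv_massE (cE _ FT) (cE _ FB).
  by rewrite muleCA muleA.
Qed.

(** The union bound for the times of death. *)
Lemma one_sub_alive t w : 1 - alive t w <= \sum_(i < t) (1 - surv i w).
Proof.
elim: t => [|t ih]; first by rewrite alive0 subrr big_ord0.
rewrite big_ord_recr/= aliveS.
have -> : 1 - alive t w * surv t w = 1 - alive t w + alive t w * (1 - surv t w) by ring.
apply: lerD => //; rewrite ler_piMl ?alive_le1// subr_ge0.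
by case/andP: (surv01 t w).
Qed.

Lemma sum_death_before (t : nat) w : (t <= n)%N ->
  \sum_(0 <= tau < n.+1 | (tau < t)%N) death tau w <= \sum_(i < n) (1 - surv i w).
Proof.
move=> tn; have -> : \sum_(0 <= tau < n.+1 | (tau < t)%N) death tau w = 1 - alive t w.
  have e : \sum_(0 <= tau < t) death tau w + alive t w = 1.
    have := sum_death w (leq0n n.+1); rewrite (big_cat_nat (leq0n t) (leqW tn))/=.
    by rewrite (sum_death w (leqW tn)) alive0.
  rewrite -e addrK (big_cat_nat (leq0n t) (leqW tn))/= [X in _ + X]big_nat_cond.
  rewrite [X in _ + X]big1 ?addr0.
    rewrite big_nat_cond [RHS]big_nat_cond; apply: eq_bigl => i.
    by rewrite leq0n /= andbb andbT.
  by move=> i /andP[/andP[ti _]]; rewrite ltnNge ti.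
apply: (le_trans (one_sub_alive t w)).
rewrite -!(big_mkord predT (fun i => 1 - surv i w)) (big_cat_nat (leq0n t) tn)/= lerDl.
by apply: sumr_ge0 => i _; rewrite subr_ge0; case/andP: (surv01 i w).
Qed.

Lemma surv_weight_pcost (p : R) w :
  \sum_s surv_weight s w * pcost p (tnth (surv_pt s)) (fp_path w) =
  \sum_(0 <= tau < n.+1) death tau w *
    pcost p (fun t => z t (killed_idx tau w t)) (fp_path w).
Proof.
under eq_bigr do rewrite /surv_weight mulr_suml.
rewrite exchange_big /=; apply: eq_bigr => tau _.
rewrite (bigD1 (killed_idx tau w))//= eqxx mulr1 big1 ?addr0; last first.
  by move=> s; rewrite eq_sym => /negbTE ->; rewrite mulr0 mul0r.
congr (_ * _); apply: eq_bigr => t _; congr (`| _ - _ | `^ p).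
by rewrite tnth_mktuple.
Qed.

End survival_weights.

Section tail_integral.
Local Open Scope ereal_scope.
Context (R : realType) d (T : measurableType d) (P : probability T R).

(** Continuity from above of the finite measure of density [M], along the sets [k < M], which
    decrease to the empty set. *)
Lemma integral_tail (M : T -> R) (e : R) : (0 < e)%R ->
  measurable_fun setT M -> (forall w, (0 <= M w)%R) -> \int[P]_w (M w)%:E < +oo ->
  exists k : nat, \int[P]_(w in [set w | (k%:R < M w)%R]) (M w)%:E <= e%:E.
Proof.
move=> e0 mM M0 intM.
pose F (k : nat) := [set w | (k%:R < M w)%R].
have mF k : measurable (F k).
  rewrite (_ : F k = M @^-1` `]k%:R, +oo[%classic).
    by rewrite -[X in measurable X]setTI; exact: mM.
  by apply/seteqP; split => w; rewrite /F /= in_itv/= andbT.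
have F0 : \bigcap_k F k = set0.
  apply/seteqP; split => // w /(_ (Num.truncn (M w)).+1 Logic.I).
  rewrite /F /= => h; have /andP[_ h'] := truncn_itv (M0 w).
  by have := lt_trans h h'; rewrite ltxx.
have cvgF : mdensity P M0 mM \o F @ \oo --> (0 : \bar R).
  rewrite -(measure0 (mdensity P M0 mM)) -F0.
  apply: nonincreasing_cvg_mu => //.
  - apply: le_lt_trans intM; apply: ge0_subset_integral => //.
    + exact/measurable_EFinP.
    + by move=> w _; rewrite lee_fin.
  - by rewrite F0.
  - move=> i j ij; apply/subsetPset => w; rewrite /F /=; apply: le_lt_trans.
    by rewrite ler_nat.
have /fine_cvgP[finF cvgF'] := cvgF.
have : \forall k \near \oo, (fine ((mdensity P M0 mM \o F) k) < e)%R.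
  by apply: (cvgr_lt 0%R) => //.
move=> /(filterI finF)[k _ /(_ k (leqnn k)) [/= fk lek]].
by exists k; have := ltW lek; rewrite -lee_fin fineK.
Qed.

End tail_integral.

(** * Approximation of a process by a model: grid and error budget *)

Section model_approx.
Context (R : realType) (n : nat) (p : R).
Hypothesis p_ge1 : 1 <= p.
Variable X : FPp n.+1 p.
Local Notation T := (fp_space X).
Local Notation P := (fp_prob X).
Local Notation Xn t := (fp_process X (inord t)).

Let p_gt0 : 0 < p. Proof. exact: lt_le_trans ltr01 p_ge1. Qed.

Definition moment (w : T) : R := \sum_(t < n.+1) `|fp_process X t w| `^ p.

Lemma moment_ge0 w : 0 <= moment w.
Proof. by apply: sumr_ge0 => t _; exact: powR_ge0. Qed.

Lemma measurable_moment : measurable_fun setT moment.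
Proof.
apply: measurable_sum => t; apply: (measurableT_comp (measurable_powR p)).
by apply: measurableT_comp => //; exact: fp_process_measurable.
Qed.

Lemma moment_lty : (\int[P]_w (moment w)%:E < +oo)%E.
Proof. by have := FPp_moment X; rewrite unlock. Qed.

(* the level of the grid of mesh [h] on [-V, V] containing [x] *)
Definition grid (V h x : R) : nat :=
  Num.truncn (if `|x| <= V then (x + V) / h else 0).

Lemma grid_le V h x : 0 < V -> 0 < h -> (grid V h x <= Num.truncn (2 * V / h))%N.
Proof.
move=> V0 h0; rewrite /grid; case: ifPn => [xV|_]; last by rewrite truncn0.
apply: le_truncn; rewrite ler_pM2r ?invr_gt0// mulr_natl mulr2n lerD2r.
exact: le_trans (ler_norm x) xV.
Qed.

Lemma grid_fiber V h t v : 0 < h -> (t <= n)%N ->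
  Fnat (X := X) t [set w | grid V h (Xn t w) = v].
Proof.
move=> h0 tn; have sG := @Fnat_sigma_algebra _ _ X t.
have GX : Gmeas (Fnat (X := X) t) (Xn t) by exact: fp_process_Gmeas.
apply: (@truncn_fiber R _ T (Fnat t) (fun w => if `|Xn t w| <= V then (Xn t w + V) / h else 0) v).
  move=> w; case: ifPn => // xV; rewrite divr_ge0 ?(ltW h0)//.
  by rewrite -lerBlDr sub0r lerNl (le_trans _ xV)// -normrN ler_norm.
have mX := (GmeasP sG _).1 GX.
apply/(GmeasP sG); apply: measurable_fun_ifT => //.
- by apply: measurable_fun_ler => //; exact: measurableT_comp.
- by apply: measurable_funM => //; exact: measurable_funD.
Qed.

Lemma grid_itv V h x : 0 < h -> `|x| <= V ->
  h * (grid V h x)%:R - V <= x < h * (grid V h x)%:R + h - V.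
Proof.
move=> h0 xV; rewrite /grid xV.
have xV0 : 0 <= (x + V) / h.
  rewrite divr_ge0 ?(ltW h0)//.
  by rewrite -lerBlDr sub0r lerNl (le_trans _ xV)// -normrN ler_norm.
have /andP[a b] := truncn_itv xV0.
rewrite lerBlDr mulrC -ler_pdivlMr// a/= ltrBrDr.
by move: b; rewrite ltr_pdivrMr// -natr1 mulrDl mul1r [_%:R * h]mulrC.
Qed.

(* the three cases: alive and in range, dead and in range, out of range *)
Lemma point_cost (V h x r : R) (a : nat) (dead : bool) : 1 <= V -> 0 < h <= 1 ->
  0 <= r < 1 -> a = (if dead then 0%N else grid V h x) -> (dead -> r = 0) ->
  `|h * (a%:R + r) - V - x| `^ p <=
  (2 * h) `^ p + dead%:R * (2 * V) `^ p + 2 `^ p * (`|x| `^ p * (V < `|x|)%R%:R).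
Proof.
move=> V1 /andP[h0 h1] /andP[r0 r1] aE rE.
have V0 : 0 < V by exact: lt_le_trans V1.
have mono (u v : R) : 0 <= v -> `|u| <= v -> `|u| `^ p <= v `^ p.
  by move=> v0 uv; apply: ge0_ler_powR; rewrite ?nnegrE// ltW.
have [xV|xV] := leP `|x| V.
  rewrite mulr0 mulr0 addr0; case: dead aE rE => [-> ->//|-> _].
    rewrite addr0 mulr0 sub0r mul1r; apply: (@le_trans _ _ ((2 * V) `^ p)).
      apply: mono; first by rewrite mulr_ge0// ltW.
      rewrite -opprD normrN; apply: (le_trans (ler_normD _ _)).
      by rewrite (ger0_norm (ltW V0)); lra.
    by rewrite lerDr powR_ge0.
  rewrite mul0r addr0; apply: mono; first by rewrite mulr_ge0// ltW.
  have /andP[l u] := grid_itv h0 xV.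
  have hr : 0 <= h * r <= h by rewrite mulr_ge0 ?(ltW h0)//= ler_piMr ?ltW.
  rewrite mulrDr ler_norml; apply/andP; split; lra.
rewrite mulr1; apply: (@le_trans _ _ (2 `^ p * `|x| `^ p)); last first.
  by rewrite lerDr addr_ge0// ?mulr_ge0// powR_ge0.
rewrite -powRM//; apply: mono; first by rewrite mulr_ge0.
(* Out of range the index is 0, so the point [h r - V] has absolute value at most [V < |x|], and its
   distance to [x] is at most [2 |x|]. *)
have -> : a = 0%N.
  by rewrite aE; case: dead aE rE => // _ _; rewrite /grid leNgt xV/= truncn0.
rewrite add0r; apply: (le_trans (ler_normB _ _)).
rewrite mulr_natl mulr2n lerD2r; apply: le_trans (ltW xV).
have hr : 0 <= h * r <= 1.
  by rewrite mulr_ge0 ?(ltW h0)//= mulr_ile1// ltW.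
rewrite ler_norml; apply/andP; split; lra.
Qed.

(** A coordinate beyond [V] makes the moment exceed [V^p], and [V^p >= V >= k] since [V >= 1]. *)
Lemma moment_tail (k : nat) (V : R) w : 1 <= V -> k%:R <= V ->
  \sum_(t < n.+1) `|fp_process X t w| `^ p * (V < `|fp_process X t w|)%R%:R <=
  moment w * \1_[set w | k%:R < moment w] w.
Proof.
move=> V1 kV; have V0 : 0 < V by exact: lt_le_trans V1.
have xm t : `|fp_process X t w| `^ p <= moment w.
  by rewrite /moment (bigD1 t)//= lerDl sumr_ge0// => s _; exact: powR_ge0.
rewrite indicE; case: (boolP (w \in _)) => [_|].
  rewrite mulr1; apply: ler_sum => t _.
  by rewrite ler_piMr ?powR_ge0//; case: (_ < _).
rewrite notin_setE/= => nk; rewrite mulr0 big1// => t _.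
case: ltP => [xV|_]; last by rewrite mulr0.
exfalso; apply: nk; apply: lt_le_trans (xm t).
apply: (le_lt_trans kV); apply: (@le_lt_trans _ _ (V `^ p)).
  exact: le1r_powR.
by apply: gt0_ltr_powR => //; rewrite nnegrE ltW.
Qed.

(** The budget [e^p] is split into three equal parts, for the range, the mesh and the deaths, chosen
    in this order: the mesh is capped by 1 to suit the range [V >= 1], and the death rate depends on
    [V]. *)
Lemma model_approx (e : R) : 0 < e -> exists f : fmodel R n, near_model p f X e.
Proof.
move=> e0; pose N : R := n.+1%:R; have N0 : 0 < N by rewrite ltr0n.
have ep0 : 0 < e `^ p by exact: powR_gt0.
have two0 : 0 < 2 `^ p :> R by exact: powR_gt0.
have [k kE] := @integral_tail R _ _ P moment (e `^ p / 3 / 2 `^ p)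
  (divr_gt0 (divr_gt0 ep0 (ltr0n _ 3)) two0) measurable_moment moment_ge0 moment_lty.
pose V : R := Num.max 1 k%:R.
have V1 : 1 <= V by rewrite le_max lexx.
have kV : k%:R <= V by rewrite le_max lexx orbT.
have V0 : 0 < V by exact: lt_le_trans V1.
pose c := (e `^ p / 3 / N) `^ p^-1.
have c0 : 0 < c by rewrite powR_gt0// !divr_gt0.
pose h := Num.min 1 (c / 2).
have h0 : 0 < h by rewrite lt_min ltr01 divr_gt0.
have h1 : h <= 1 by rewrite ge_min lexx.
have hp : N * (2 * h) `^ p <= e `^ p / 3.
  rewrite mulrC -ler_pdivlMr//; apply: (@le_trans _ _ (c `^ p)).
    apply: ge0_ler_powR; rewrite ?nnegrE ?mulr_ge0 ?(ltW c0) ?(ltW h0) ?(ltW p_gt0)//.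
    by rewrite mulrC -ler_pdivlMr// ge_min lexx orbT.
  by rewrite -powRrM mulVf ?gt_eqF// powRr1// !divr_ge0// ltW.
(* A death costs at most [(2 V)^p] in each of [N] coordinates, and there are fewer than [N]
   transitions at which it can occur, each with probability at most [delta]. *)
pose q : R := N * (N * (2 * V) `^ p).
have q0 : 0 < q by rewrite !mulr_gt0// powR_gt0// mulr_gt0.
pose delta := e `^ p / 3 / q.
have delta0 : 0 < delta by rewrite !divr_gt0.
pose g t (w : T) := grid V h (Xn t w).
have [K [S [alpha [l [l0 [SK FS Sg sv [lge l0ge]]]]]]] :=
  @coding_states R n X g (Num.truncn (2 * V / h)) delta delta0
    (fun t w => grid_le _ V0 h0) (fun t v tn => grid_fiber V v h0 tn).
(* The grid index encoded in the state [j], read off any outcome in that state; the killed state is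
   placed at index 0. *)
pose A (t j : nat) := if j is 0 then 0%N else g t (xget point [set w | S t w = j]).
have AE t w : (t <= n)%N -> A t (S t w) = g t w.
  move=> tn; have /andP[S0 _] := SK t w tn.
  rewrite /A; case E: (S t w) S0 => [//|j] _; apply: Sg => //.
  rewrite E; apply: (@xgetPex _ point [set w' | S t w' = j.+1]).
  by exists w.
have K0 : 0 < K.+1%:R :> R by rewrite ltr0n.
(* the summand [j / K.+1] makes distinct states distinct points *)
pose z (t : 'I_n.+1) (j : 'I_K.+1) : R := h * ((A t j)%:R + j%:R / K.+1%:R) - V.
have z_inj t : injective (z t).
  move=> i j /addIr /(mulfI (lt0r_neq0 h0)) e1.
  have : (A t i)%:R * K.+1%:R + i%:R = (A t j)%:R * K.+1%:R + j%:R :> R.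
    have := congr1 ( *%R^~ K.+1%:R) e1.
    by rewrite !mulrDl !divfK// lt0r_neq0.
  (* After clearing the denominator, the state is the residue modulo [K.+1]. *)
  rewrite -!natrM -!natrD => /eqP; rewrite eqr_nat => /eqP /(congr1 (modn^~ K.+1)).
  by rewrite !modnMDl !modn_small// => /val_inj.
exists (surv_model SK FS sv z_inj).
exists (surv_weight S alpha); first exact: surv_is_weight.
rewrite (weight_costE p (surv_is_weight SK FS sv lge l0ge z_inj)).
have sge0 i w : 0 <= 1 - surv alpha i w.
  by rewrite subr_ge0; case/andP: (surv01 sv i w).
have msurv i : (i < n)%N -> measurable_fun setT (fun w => 1 - surv alpha i w).
  move=> ni; apply: measurable_funB => //.
  by apply: (Gmeas_measurable (@Fnat_measurable _ _ X i.+1)); exact: (surv_Gmeas sv).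
pose B := [set w : T | k%:R < moment w].
have mB : measurable B.
  rewrite (_ : B = moment @^-1` `]k%:R, +oo[%classic).
    by rewrite -[X in measurable X]setTI; exact: measurable_moment.
  by apply/seteqP; split => w; rewrite /B /= in_itv/= andbT.
(* A bound of the cost for each outcome, with one summand for the mesh, one for the deaths and one
   for the range. *)
pose U w : R := N * (2 * h) `^ p +
  (N * (2 * V) `^ p * \sum_(i < n) (1 - surv alpha i w) +
   2 `^ p * (moment w * \1_B w)).
have UE : (\int[P]_w (U w)%:E <= (e `^ p)%:E)%E.
  have mS : measurable_fun setT (fun w => \sum_(i < n) (1 - surv alpha i w)).
    by apply: measurable_sum => i; exact: msurv.
  have S0 w : 0 <= \sum_(i < n) (1 - surv alpha i w) by exact: sumr_ge0.
  have mI : measurable_fun setT (fun w => moment w * \1_B w).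
    by apply: measurable_funM; [exact: measurable_moment|exact: measurable_indic].
  have I0 w : 0 <= moment w * \1_B w by rewrite mulr_ge0// moment_ge0.
  under eq_integral do rewrite /U !EFinD.
  have NV0 : 0 <= N * (2 * V) `^ p by rewrite mulr_ge0 ?powR_ge0// ltW.
  have Nh0 : 0 <= N * (2 * h) `^ p by rewrite mulr_ge0 ?powR_ge0// ltW.
  rewrite ge0_integralD//; last 2 first.
  - by move=> w _; rewrite -EFinD lee_fin addr_ge0// mulr_ge0// ltW.
  - apply/measurable_EFinP; apply: measurable_funD; exact: measurable_funM.
  rewrite ge0_integralD//; last 4 first.
  - by move=> w _; rewrite lee_fin mulr_ge0.
  - by apply/measurable_EFinP; exact: measurable_funM.
  - by move=> w _; rewrite lee_fin mulr_ge0// ltW.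
  - by apply/measurable_EFinP; exact: measurable_funM.
  rewrite integral_cst// [X in (_ * X)%E](probability_setT P) mule1.
  have -> : e `^ p = e `^ p / 3 + (e `^ p / 3 + e `^ p / 3) by field.
  rewrite !EFinD; apply: leeD; first by rewrite lee_fin.
  apply: leeD.
  - under eq_integral do rewrite EFinM.
    rewrite ge0_integralZl_EFin//; last 2 first.
    + by move=> w _; rewrite lee_fin.
    + exact/measurable_EFinP.
    under eq_integral do rewrite -sumEFin.
    rewrite ge0_integral_sum//; last 2 first.
    + by move=> i; apply/measurable_EFinP; exact: msurv.
    + by move=> i w _; rewrite lee_fin.
    apply: (@le_trans _ _ ((N * (2 * V) `^ p)%:E * (\sum_(i < n) delta%:E))%E).
      apply: lee_wpmul2l; first by rewrite lee_fin.
      apply: lee_sum => i _; have [_ _ h3 _ _] := sv i (ltn_ord i).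
      apply: le_trans h3; rewrite le_eqVlt; apply/orP; left; apply/eqP.
      by apply: eq_integral => w _; rewrite /surv ltn_ord.
    rewrite sumEFin sumr_const card_ord -EFinM lee_fin.
    apply: (@le_trans _ _ (N * (2 * V) `^ p * (N * delta))).
      apply: ler_wpM2l => //; rewrite -mulr_natl; apply: ler_wpM2r; first exact: ltW.
      by rewrite ler_nat.
    rewrite (_ : _ * _ = q * delta); last by rewrite /q; ring.
    by rewrite /delta mulrC divfK// gt_eqF.
  - under eq_integral do rewrite EFinM.
    rewrite ge0_integralZl_EFin//; last 2 first.
    + by move=> w _; rewrite lee_fin.
    + exact/measurable_EFinP.
    rewrite integral_mul_indic// setTI.
    apply: (@le_trans _ _ ((2 `^ p)%:E * (e `^ p / 3 / 2 `^ p)%:E)%E).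
      by apply: lee_wpmul2l => //; rewrite lee_fin ltW.
    by rewrite -EFinM lee_fin mulrC divfK// gt_eqF.
have mU : measurable_fun setT U.
  apply: measurable_funD => //; apply: measurable_funD; apply: measurable_funM => //.
    by apply: measurable_sum => i; exact: msurv.
  by apply: measurable_funM; [exact: measurable_moment|exact: measurable_indic].
apply: le_trans UE; apply: ge0_le_integral => //.
- move=> w _; rewrite lee_fin; apply: sumr_ge0 => s _.
  by rewrite mulr_ge0 ?pcost_ge0// (surv_weight_ge0 sv).
- apply/measurable_EFinP; apply: measurable_sum => s; apply: measurable_funM.
    exact: (surv_weight_measurable SK FS sv).
  exact: measurable_cost_model.
- exact/measurable_EFinP.
move=> w _; rewrite lee_fin (surv_weight_pcost S alpha z p w).
have D0 tau : 0 <= death alpha tau w by exact: (death_ge0 sv).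
pose x (t : 'I_n.+1) := fp_process X t w.
pose E : R := \sum_(t < n.+1) 2 `^ p * (`|x t| `^ p * (V < `|x t|)%R%:R).
have pc tau : pcost p (fun t => z t (killed_idx K S tau w t)) (fp_path w) <=
    N * (2 * h) `^ p + (\sum_(t < n.+1) (tau < t)%N%:R * (2 * V) `^ p + E).
  rewrite /pcost /N mulr_natl -[X in _ *+ X](card_ord n.+1) -sumr_const -!big_split/=.
  apply: ler_sum => t _; rewrite addrA.
  have tn : (t <= n)%N by rewrite -ltnS.
  have kiE : killed_idx K S tau w t = killed S tau w t :> nat.
    by have := killed_idxE SK tau w tn; rewrite /idx inord_val.
  have := @point_cost V h (x t) ((killed S tau w t)%:R / K.+1%:R)
    (A t (killed S tau w t)) (tau < t)%N V1 (introT andP (conj h0 h1)).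
  rewrite /z kiE; apply.
  - rewrite divr_ge0//= ltr_pdivrMr// mul1r ltr_nat; exact: killed_lt.
  - rewrite /killed leqNgt; case: (tau < t)%N => //=.
    by rewrite AE// /g inord_val.
  - by rewrite /killed ltnNge => /negbTE ->; rewrite mul0r.
apply: (@le_trans _ _ (\sum_(0 <= tau < n.+1) death alpha tau w *
    (N * (2 * h) `^ p + (\sum_(t < n.+1) (tau < t)%N%:R * (2 * V) `^ p + E)))).
  by apply: ler_sum => tau _; apply: ler_wpM2l.
have D1 : \sum_(0 <= tau < n.+1) death alpha tau w = 1.
  by rewrite (sum_death alpha w (leq0n n.+1)) alive0.
under eq_bigr do rewrite !mulrDr.
rewrite !big_split/= -!mulr_suml D1 !mul1r /U lerD2l; apply: lerD; last first.
  rewrite /E -mulr_sumr; apply: ler_wpM2l; first exact: ltW.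
  exact: moment_tail.
under eq_bigr do rewrite mulr_sumr.
rewrite exchange_big/=.
apply: (@le_trans _ _ (\sum_(t < n.+1) (2 * V) `^ p * \sum_(i < n) (1 - surv alpha i w))).
  apply: ler_sum => t _.
  under eq_bigr do rewrite mulrA mulrC.
  rewrite -mulr_sumr; apply: ler_wpM2l; first exact: powR_ge0.
  apply: le_trans (sum_death_before sv w (t := t) _); last by rewrite -ltnS.
  rewrite [leRHS]big_mkcond/=; apply: ler_sum => tau _.
  by case: (tau < t)%N; rewrite ?mulr1 ?mulr0.
by rewrite sumr_const card_ord -[leLHS]mulr_natl mulrA.
Qed.

End model_approx.

(** * The metric on classes *)

Section finiteness.
Context (R : realType) (n : nat) (p : R) (p_ge1 : 1 <= p).

Let p_gt0 : 0 < p. Proof. exact: lt_le_trans ltr01 p_ge1. Qed.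

Definition origin_pt (i : unit) : n.+1.-tuple R := [tuple 0 | t < n.+1].

Let origin_inj : injective origin_pt. Proof. by move=> [] []. Qed.

Let origin_sum : \sum_(i : unit) (1 : R) = 1.
Proof. by rewrite sumr_const card_unit. Qed.

Definition origin_model : fmodel R n :=
  @FModel R n unit origin_pt (fun=> 1) origin_inj (fun=> ler01) origin_sum.

(** The coupling with the zero path costs exactly the p-th moment. Hence all distances are finite,
    by gluing along this model. *)
Lemma near_model_origin (X : FPp n.+1 p) :
  exists2 c, 0 < c & near_model p origin_model X c.
Proof.
pose m := fine (\int[fp_prob X]_w (moment w)%:E)%E.
have m0 : 0 <= m by apply/fine_ge0/integral_ge0 => w _; rewrite lee_fin moment_ge0.
have mE : (\int[fp_prob X]_w (moment w)%:E = m%:E)%E.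
  rewrite /m fineK// ge0_fin_numE; first exact: moment_lty.
  by apply: integral_ge0 => w _; rewrite lee_fin moment_ge0.
have m1 : 0 < 1 + m by rewrite ltr_wpDr.
have sumE (t : 'I_n.+1) (i : fm_idx origin_model) :
    \sum_(j : fm_idx origin_model | same_past t i j) 1 = 1 :> R.
  rewrite (eq_bigl predT) => [|[]]; first exact: origin_sum.
  by case: i; exact/eqP.
(* The added 1 keeps the radius positive when the moment is 0. *)
exists ((1 + m) `^ p^-1); first exact: powR_gt0.
exists (fun=> cst 1).
  split => //.
  - move=> i; apply/(GmeasP (fp_sigma_algebra X _)); exact: measurable_cst.
  - move=> i; have := integral_cst (fp_prob X) (@measurableT _ (fp_space X)) 1%:E.
    by rewrite [X in (_ * X)%E](probability_setT (fp_prob X)) mule1.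
  - move=> t i; exists (cst 1); split.
    + apply/(GmeasP (fp_sigma_algebra X _)); exact: measurable_cst.
    + by move=> w; rewrite ler01 lexx.
    + by move=> A _; apply: eq_integral => w _; rewrite sumE.
  - move=> t i B FB; rewrite (sumE t i).
    by congr (_ * _)%E; apply: eq_integral => w _; rewrite sumE.
rewrite -powRrM mulVf ?gt_eqF// powRr1 ?(ltW m1)// /weight_cost.
rewrite (bigD1 tt)//= big1 ?adde0; last by case.
apply: (@le_trans _ _ m%:E); last by rewrite lee_fin lerDr.
rewrite -mE le_eqVlt; apply/orP; left; apply/eqP; apply: eq_integral => w _.
congr (_%:E); rewrite mul1r; apply: eq_bigr => t _.
by rewrite tnth_mktuple sub0r normrN.
Qed.

Lemma AW_fin_num (X Y : FPp n.+1 p) : AW p X Y \is a fin_num.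
Proof.
have [a a0 fX] := near_model_origin X; have [b b0 fY] := near_model_origin Y.
rewrite ge0_fin_numE ?AW_ge0//.
exact: le_lt_trans (near_model_AW p_ge1 a0 b0 fX fY) (ltry _).
Qed.

End finiteness.

Section metric_properties.
Local Open Scope ereal_scope.
Context (R : realType) (n : nat) (p : R) (p_ge1 : (1 <= p)%R).

(** Two copies of [X] are glued along a model within [e / 2] of [X]. *)
Lemma AW_refl (X : FPp n.+1 p) : AW p X X = 0.
Proof.
apply/eqP; rewrite eq_le AW_ge0 andbT; apply/lee_addgt0Pr => e e0.
have e20 : (0 < e / 2)%R by rewrite divr_gt0.
have [f fX] := model_approx p_ge1 X e20.
by rewrite add0e [in leRHS](splitr e); exact: (near_model_AW p_ge1 e20 e20 fX fX).
Qed.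

(** A model near [Y] is transported to [X] and to [Z], and the two results are glued. Transport
    starts from [Y] on both sides, whence the order of the arguments; symmetry follows by
    specialisation. *)
Let AW_triangle_sym (X Y Z : FPp n.+1 p) : AW p X Z <= AW p Y X + AW p Y Z.
Proof.
have [fin1 fin2] := (AW_fin_num p_ge1 Y X, AW_fin_num p_ge1 Y Z).
apply/lee_addgt0Pr => e e0.
(* Four errors: the radius of the model counts twice, and each distance is exceeded once. *)
have e40 : (0 < e / 4)%R by rewrite divr_gt0.
have [f fY] := model_approx p_ge1 Y e40.
have lt1 : AW p Y X < (fine (AW p Y X) + e / 4)%:E.
  by rewrite EFinD fineK// lteDl// lte_fin.
have lt2 : AW p Y Z < (fine (AW p Y Z) + e / 4)%:E.
  by rewrite EFinD fineK// lteDl// lte_fin.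
have fX := near_model_lt p_ge1 e40 fY lt1.
have fZ := near_model_lt p_ge1 e40 fY lt2.
have pos (A B : FPp n.+1 p) : (0 < e / 4 + (fine (AW p A B) + e / 4))%R.
  by rewrite addr_gt0// ltr_wpDl//; exact/fine_ge0/AW_ge0.
apply: (le_trans (near_model_AW p_ge1 (pos _ _) (pos _ _) fX fZ)).
rewrite -[in leRHS](fineK fin1) -[in leRHS](fineK fin2) -!EFinD lee_fin; lra.
Qed.

Lemma AW_sym (X Y : FPp n.+1 p) : AW p X Y = AW p Y X.
Proof.
have le (A B : FPp n.+1 p) : AW p A B <= AW p B A.
  by have := AW_triangle_sym A B B; rewrite AW_refl adde0.
by apply/eqP; rewrite eq_le !le.
Qed.

Lemma AW_triangle (X Y Z : FPp n.+1 p) : AW p X Z <= AW p X Y + AW p Y Z.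
Proof. by rewrite (AW_sym X Y); exact: AW_triangle_sym. Qed.

Lemma AW_congr (X X' Y Y' : FPp n.+1 p) : AW p X X' = 0 -> AW p Y Y' = 0 ->
  AW p X Y = AW p X' Y'.
Proof.
have le (A A' B B' : FPp n.+1 p) : AW p A A' = 0 -> AW p B B' = 0 ->
    AW p A B <= AW p A' B'.
  move=> AA BB; apply: (le_trans (AW_triangle A A' B)); rewrite AA add0e.
  by apply: (le_trans (AW_triangle A' B' B)); rewrite (AW_sym B' B) BB adde0.
by move=> XX YY; apply/eqP; rewrite eq_le !le// AW_sym.
Qed.

Lemma FP_class_ofP (X Y : FPp n.+1 p) : FP_class_of X = FP_class_of Y <-> AW p X Y = 0.
Proof.
split=> [e|XY]; first by rewrite -/(FP_class_of X Y) e; exact: AW_refl.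
apply/funext => Z; apply/propext; rewrite /FP_class_of.
by rewrite (AW_congr XY (AW_refl Z)).
Qed.

Lemma FP_eqP (C D : FP n.+1 p) : proj1_sig C = proj1_sig D -> C = D.
Proof.
case: C D => [C hC] [D hD] /= e; move: hC hD; rewrite e => hC hD.
by congr exist; exact: Prop_irrelevance.
Qed.

Lemma FP_classP (X Y : FPp n.+1 p) : FP_class X = FP_class Y <-> AW p X Y = 0.
Proof.
split=> [/(congr1 (@proj1_sig _ _)) /FP_class_ofP//|/FP_class_ofP e].
exact: FP_eqP.
Qed.

Lemma FP_reprK (C : FP n.+1 p) : FP_class (FP_repr C) = C.
Proof. by apply: FP_eqP; rewrite /FP_repr; case: cid. Qed.

Lemma AW_FP_class (X Y : FPp n.+1 p) : AW_FP (FP_class X) (FP_class Y) = AW p X Y.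
Proof.
have repr0 (Z : FPp n.+1 p) : AW p (FP_repr (FP_class Z)) Z = 0.
  by apply/FP_classP; rewrite FP_reprK.
by rewrite /AW_FP; apply: AW_congr.
Qed.

Lemma AW_FP_metric : is_metric (@AW_FP R n.+1 p).
Proof.
split.
- by move=> C D; rewrite AW_fin_num// AW_ge0.
- move=> C D; rewrite -{2}(FP_reprK C) -{2}(FP_reprK D).
  by split => [/FP_classP//|/FP_classP].
- by move=> C D; exact: AW_sym.
- by move=> C D E; exact: AW_triangle.
Qed.

End metric_properties.

(** * Laws as a dense subset: injectivity and density *)

Section laws.
Local Open Scope ereal_scope.
Context (R : realType) (n : nat) (p : R) (p_ge1 : (1 <= p)%R).
Local Notation T := (path_space R n.+1).

Let p_gt0 : (0 < p)%R. Proof. exact: lt_le_trans ltr01 p_ge1. Qed.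

Lemma near_model_same_law (mu nu : probability T R) (f : fmodel R n) (c : R) :
  same_law mu nu -> near_model p f (canonical_process mu) c ->
  near_model p f (canonical_process nu) c.
Proof.
move=> mn [k wk ck].
have intE (D : set T) (g : T -> \bar R) : measurable D ->
    \int[nu]_(x in D) g x = \int[mu]_(x in D) g x.
  by move=> mD; apply: eq_measure_integral => A mA _; rewrite [RHS]mn.
have mF t (B : set T) : canonical_filtration (R := R) t B -> measurable B.
  exact: canonical_sub_measurable.
exists k; last first.
  apply: le_trans ck; rewrite le_eqVlt; apply/orP; left; apply/eqP.
  by apply: eq_bigr => i _; exact: intE.
split.
- exact: wt_meas wk.
- exact: wt_ge0 wk.
- exact: wt_sum1 wk.
- by move=> i; rewrite -(wt_mass wk); exact: intE.
- move=> t i; have [s [Gs s01 sE]] := wt_adapted wk t i.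
  exists s; split => // A FA; have mA := mF _ _ FA.
  by rewrite [LHS]intE// [RHS]intE//; exact: sE.
- move=> t i B FB; have mB := mF _ _ FB; have := wt_causal wk i FB => h.
  by rewrite [X in _ * X = _]intE// [X in _ = _ * X]intE.
Qed.

Lemma AW_same_law (mu nu : Pp n.+1 p) : same_law mu nu ->
  AW p (Pp_to_FPp mu) (Pp_to_FPp nu) = 0.
Proof.
move=> mn; apply/eqP; rewrite eq_le AW_ge0 andbT; apply/lee_addgt0Pr => e e0.
have e20 : (0 < e / 2)%R by rewrite divr_gt0.
have [f fX] := model_approx p_ge1 (Pp_to_FPp mu) e20.
rewrite add0e [in leRHS](splitr e); apply: (near_model_AW p_ge1 e20 e20 fX).
exact: near_model_same_law fX.
Qed.

Definition box (a : 'I_n.+1 -> R) : set T := [set x | forall t, (tnth x t < a t)%R].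

Definition boxes : set (set T) := [set B | exists a, B = box a].

Lemma measurable_box a : measurable (box a).
Proof.
rewrite (_ : box a = \bigcap_(t in [set: 'I_n.+1]) ((fun x : T => tnth x t) @^-1` `]-oo, a t[)).
  apply: fin_bigcap_measurable => [|t _]; first exact: finite_finset.
  rewrite -[X in measurable X]setTI; exact: measurable_tnth.
apply/seteqP; split => x h t => [_|]; first by rewrite /= in_itv/=; exact: h.
by have := h t Logic.I; rewrite /= in_itv.
Qed.

(** A half-space bounding one coordinate is the increasing union of the boxes whose other sides are
    the integers [k]. *)
Lemma measurable_boxes : measurable = <<s boxes >> :> set (set T).
Proof.
apply/seteqP; split; last first.
  apply: smallest_sub; first exact: sigma_algebra_measurable.
  by move=> _ [a ->]; exact: measurable_box.
apply: smallest_sub; first exact: smallest_sigma_algebra.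
rewrite -bigcup_mkord_ord => _ [i Ii [C mC <-]]; rewrite setTI.
set j := inord i.
pose T' := g_sigma_algebraType boxes.
suff mj : measurable_fun [set: T'] (fun x : T' => tnth (x : T) j).
  by have := mj measurableT C mC; rewrite setTI.
apply: (measurability (@RGenInftyO.G R)); first exact: RGenInftyO.measurableE.
move=> _ [_ [r ->] <-]; rewrite setTI.
pose a (k : nat) (t : 'I_n.+1) : R := if t == j then r else k%:R.
rewrite (_ : _ @^-1` _ = \bigcup_k (box (a k) : set T')); last first.
  apply/seteqP; split => [x|x [k _ /(_ j)]]; rewrite /= in_itv/=; last first.
    by rewrite /a eqxx.
  move=> xr; exists (\max_(t < n.+1) (Num.truncn `|tnth (x : T) t|%R).+1) => // t.
  rewrite /a; have [->//|_] := eqVneq t j.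
  apply: (le_lt_trans (ler_norm _)).
  have /andP[_ h] := truncn_itv (normr_ge0 (tnth (x : T) t)).
  apply: (lt_le_trans h); rewrite ler_nat.
  by apply: (@leq_bigmax _ (fun t => (Num.truncn `|tnth (x : T) t|%R).+1)).
apply: bigcupT_measurable => k.
by apply: sub_sigma_algebra; exists (a k).
Qed.

Lemma boxes_setI : setI_closed boxes.
Proof.
move=> _ _ [a ->] [b ->]; exists (fun t => Num.min (a t) (b t)).
apply/seteqP; split => x /= => [[xa xb] t|h]; first by rewrite lt_min xa xb.
by split => t; have := h t; rewrite lt_min => /andP[].
Qed.

(** A Prokhorov-type estimate. For a coupling of cost at most [(e e)^p], Markov's inequality bounds
    the probability of a cost of at least [e^p] by [e^p], which is at most [e]; elsewhere no
    coordinate moves by [e] or more. *)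
Lemma AW0_box (mu nu : Pp n.+1 p) a (e : R) : (0 < e <= 1)%R ->
  AW p (Pp_to_FPp mu) (Pp_to_FPp nu) = 0 ->
  mu (box (fun t => a t - e)%R) <= nu (box a) + e%:E.
Proof.
move=> /andP[e0 e1] AW0.
have [pi [[mu_pi nu_pi] _ _] cost] :
    exists2 pi : probability (coupling_space (Pp_to_FPp mu) (Pp_to_FPp nu)) R,
    Cpl_bc pi & transport_cost p pi <= ((e * e) `^ p)%:E.
  by apply: AW_lt => //; rewrite AW0 lte_fin mulr_gt0.
rewrite transport_costE in cost.
set S := coupling_space _ _ in pi mu_pi nu_pi cost *.
pose D (w : S) := pcost p (fp_path w.1) (fp_path w.2).
have mD : measurable_fun setT D by exact: measurable_cost_coupling.
have D0 w : (0 <= D w)%R by exact: pcost_ge0.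
pose G := [set w : S | (e `^ p <= D w)%R].
have mG : measurable G.
  rewrite (_ : G = D @^-1` `[(e `^ p)%R, +oo[%classic).
    by rewrite -[X in measurable X]setTI; exact: mD.
  by apply/seteqP; split => w; rewrite /G /= in_itv/= andbT.
have ep0 : (0 < e `^ p)%R by exact: powR_gt0.
have piG : pi G <= e%:E.
  have : (e `^ p)%:E * pi G <= ((e * e) `^ p)%:E.
    apply: le_trans cost; rewrite -integral_cst//.
    apply: (@le_trans _ _ (\int[pi]_(w in G) (D w)%:E)).
      apply: ge0_le_integral => //.
      - by move=> w _; rewrite /cst lee_fin ltW.
      - by apply/measurable_EFinP; exact: measurable_funTS.
    apply: ge0_subset_integral => //; first exact/measurable_EFinP.
    by move=> w _; rewrite lee_fin.
  rewrite powRM ?(ltW e0)// EFinM lee_pmul2l ?lte_fin//.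
  move=> h; apply: (le_trans h); rewrite lee_fin.
  by rewrite -[leRHS]powRr1 ?(ltW e0)// ger_powR ?e0.
have mB := measurable_box a.
have mB' := measurable_box (fun t => a t - e)%R.
apply: (@le_trans _ _ (pi (snd @^-1` box a `|` G))); last first.
  apply: (le_trans (measureU2 _ _ _)) => //.
    by rewrite -[X in measurable X]setTI; exact: measurable_snd.
  by apply: leeD => //; rewrite -[leRHS](nu_pi _ mB).
rewrite -(mu_pi _ mB'); apply: le_measure; rewrite ?inE.
- by rewrite -[X in measurable X]setTI; exact: measurable_fst.
- by apply: measurableU => //; rewrite -[X in measurable X]setTI; exact: measurable_snd.
move=> w wB; have [?|Dw] := leP (e `^ p)%R (D w); [by right|left => t].
have h := wB t; rewrite -(subrK (tnth w.1 t) (tnth w.2 t)).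
suff : (`|tnth w.1 t - tnth w.2 t| < e)%R.
  by move=> /ltr_normlP[+ _]; move: h; rewrite /=; lra.
rewrite ltNge; apply/negP => le_e.
move: Dw; apply/negP; rewrite -leNgt /D /pcost (bigD1 t)//=.
apply: ler_wpDr; first by apply: sumr_ge0 => s _; exact: powR_ge0.
by apply: ge0_ler_powR; rewrite ?nnegrE ?(ltW p_gt0) ?(ltW e0).
Qed.

(** The boxes are open, so the shrunken boxes increase to them and continuity from below suffices,
    whatever mass lies on the boundary. *)
Lemma AW0_box_le (mu nu : Pp n.+1 p) a :
  AW p (Pp_to_FPp mu) (Pp_to_FPp nu) = 0 -> mu (box a) <= nu (box a).
Proof.
move=> AW0; pose B k := box (fun t => a t - k.+1%:R^-1)%R.
have BE : \bigcup_k B k = box a.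
  apply/seteqP; split => x.
    by move=> [k _ h] t; apply: (lt_le_trans (h t)); rewrite gerBl.
  move=> xa.
  pose m := \max_(t < n.+1) (Num.truncn (a t - tnth x t)^-1%R).
  exists m => // t; rewrite ltrBrDl -ltrBrDr.
  have d0 : (0 < a t - tnth x t)%R by rewrite subr_gt0.
  rewrite invf_plt ?posrE//.
  have /andP[_ h] := truncn_itv (ltW (divr_gt0 ltr01 d0)).
  rewrite div1r in h; apply: (lt_le_trans h); rewrite ler_nat ltnS.
  exact: (@leq_bigmax _ (fun t => Num.truncn (a t - tnth x t)^-1%R)).
have cvg : mu \o B @ \oo --> mu (box a).
  rewrite -BE; apply: nondecreasing_cvg_mu.
  - by move=> k; exact: measurable_box.
  - by rewrite BE; exact: measurable_box.
  - move=> i j ij; apply/subsetPset => x h t; apply: (lt_le_trans (h t)).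
    by rewrite lerD2l lerN2 lef_pV2 ?posrE// ler_nat.
apply/lee_addgt0Pr => e e0; rewrite -(cvg_lim _ cvg)//.
apply: lime_le; first by apply/cvg_ex; exists (mu (box a)).
have [m _ hm] : \forall k \near \oo, (k.+1%:R^-1 < e)%R by exact: near_infty_natSinv_lt (PosNum e0).
near=> k.
apply: (le_trans (AW0_box (nu := nu) a (e := k.+1%:R^-1) _ AW0)).
  by rewrite invr_gt0 ltr0n invf_le1 ?ltr0n// ler1n.
rewrite leeD2l// lee_fin ltW//; apply: hm => /=.
by near: k; exists m.
Unshelve. all: by end_near. Qed.

(** At distance 0 the laws agree on boxes, by [AW0_box_le] in both directions, and boxes form a
    generating class closed under intersection. *)
Lemma Pp_to_FP_inj (mu nu : Pp n.+1 p) : Pp_to_FP mu = Pp_to_FP nu <-> same_law mu nu.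
Proof.
split=> [/(FP_classP p_ge1) AW0 A mA|mn]; last exact/(FP_classP p_ge1)/AW_same_law.
have AW0' : AW p (Pp_to_FPp nu) (Pp_to_FPp mu) = 0 by rewrite AW_sym.
apply: (measure_unique boxes (fun k => box (fun=> k%:R))) => //.
- exact: measurable_boxes.
- exact: boxes_setI.
- by move=> k; exists (fun=> k%:R).
- apply/seteqP; split => // x _.
  exists (\max_(t < n.+1) (Num.truncn `|tnth x t|%R).+1) => // t.
  apply: (le_lt_trans (ler_norm _)).
  have /andP[_ h] := truncn_itv (normr_ge0 (tnth x t)).
  apply: (lt_le_trans h); rewrite ler_nat.
  by apply: (@leq_bigmax _ (fun t => (Num.truncn `|tnth x t|%R).+1)).
- by move=> _ [a ->]; apply/eqP; rewrite eq_le !AW0_box_le.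
- by move=> k; apply: (le_lt_trans (probability_le1 _ _)); rewrite ?ltry//; exact: measurable_box.
Qed.

Lemma fm_law_moment (f : fmodel R n) :
  'E_(fm_law f)[(fun w => \sum_(t < n.+1) `|tnth w t| `^ p)%R] < +oo.
Proof.
rewrite unlock (ge0_integral_fm_law f (A := setT)) ?ltry//.
  apply: measurable_sum => t; apply: (measurableT_comp (measurable_powR p)).
  by apply: measurableT_comp => //; exact: measurable_tnth.
by move=> x; apply: sumr_ge0 => t _; exact: powR_ge0.
Qed.

Definition fm_Pp (f : fmodel R n) : Pp n.+1 p := @MkPp R n.+1 p (fm_law f) (fm_law_moment f).

Lemma near_model_AW_fm (f : fmodel R n) (X : filtered_process R n.+1) (c : R) :
  (0 < c)%R -> near_model p f X c -> AW p X (Pp_to_FPp (fm_Pp f)) <= (c + c)%:E.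
Proof.
move=> c0 fX; apply: (near_model_AW p_ge1 c0 c0 fX).
exact: near_model_self.
Qed.

Lemma laws_dense : is_dense (@AW_FP R n.+1 p)
  (fun C => exists mu : Pp n.+1 p, C = Pp_to_FP mu).
Proof.
move=> C e e0; have e30 : (0 < e / 3)%R by rewrite divr_gt0.
have [f fC] := model_approx p_ge1 (FP_repr C) e30.
exists (Pp_to_FP (fm_Pp f)); first by exists (fm_Pp f).
rewrite -(FP_reprK C) AW_FP_class//.
by apply: (le_lt_trans (near_model_AW_fm e30 fC)); rewrite lte_fin; lra.
Qed.

End laws.

(** * Chains of models *)

Section class_averages.
Context (R : realType) (n : nat) (f : fmodel R n) (t : 'I_n.+1).

Definition past_invariant (h : fm_idx f -> R) := forall i j, same_past t i j -> h i = h j.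

Definition class_size (i : fm_idx f) : R := \sum_(j | same_past t i j) 1.

Lemma class_size_gt0 i : 0 < class_size i.
Proof.
rewrite /class_size (bigD1 i)/=; last exact: same_past_refl.
by rewrite ltr_pwDl// sumr_ge0.
Qed.

Lemma class_sum_invariant (F : fm_idx f -> R) :
  past_invariant (fun i => \sum_(j | same_past t i j) F j).
Proof. by move=> i j ij; apply: eq_bigl => k; rewrite (same_past_eq ij). Qed.

(** Double counting: each class occurs once per member on the right, which the division by
    [class_size] undoes. Only the class sums of [F] matter against an invariant [h]. *)
Lemma sum_invariant (F h : fm_idx f -> R) : past_invariant h ->
  \sum_i F i * h i = \sum_i (h i / class_size i) * \sum_(j | same_past t i j) F j.
Proof.
move=> hI; under [RHS]eq_bigr do rewrite mulr_sumr big_mkcond.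
rewrite exchange_big/=; apply: eq_bigr => j _.
rewrite (eq_bigr (fun i => if same_past t j i then h j / class_size j * F j else 0)).
  rewrite -big_mkcond/= (eq_bigr (fun i => h j / class_size j * F j * 1));
    last by move=> i _; rewrite mulr1.
  rewrite -mulr_sumr -/(class_size j) mulrAC divfK 1?mulrC// gt_eqF//.
  exact: class_size_gt0.
move=> i _; rewrite same_past_sym; case: ifP => // ij.
by rewrite (hI _ _ ij) [class_size j](class_sum_invariant (fun=> 1) ij).
Qed.

End class_averages.

Section bicausal_matrices.
Context (R : realType) (n : nat).

(** [bm_fwd] and [bm_bwd] are the two causality conditions in terms of functions: the conditional
    expectation of a function of the past on one side, given the whole path on the other, depends on
    the past only. Multiplying by the mass avoids conditioning on null paths. *)
Record bicausal_matrix (f g : fmodel R n) (a : fm_idx f -> fm_idx g -> R) : Prop := BicausalMatrix {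
  bm_ge0 : forall i j, 0 <= a i j;
  bm_fst : forall i, \sum_j a i j = fm_wt i;
  bm_snd : forall j, \sum_i a i j = fm_wt j;
  bm_fwd : forall t h, (forall j, 0 <= h j) -> past_invariant t h ->
    exists h', [/\ forall i, 0 <= h' i, past_invariant t h' &
      forall i, \sum_j a i j * h j = fm_wt i * h' i];
  bm_bwd : forall t h, (forall i, 0 <= h i) -> past_invariant t h ->
    exists h', [/\ forall j, 0 <= h' j, past_invariant t h' &
      forall j, \sum_i a i j * h i = fm_wt j * h' j]
}.

Lemma canonical_Gmeas_past t (s : path_space R n.+1 -> R) x y :
  Gmeas (canonical_filtration (R := R) t) s -> past t x = past t y -> s x = s y.
Proof.
move=> Gs xy; have Fs : canonical_filtration (R := R) t (s @^-1` [set s x]).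
  by apply: Gs; exists [set s x] => //; rewrite setTI.
by rewrite (canonical_filtration_past Fs xy (erefl : (s @^-1` [set s x]) x)).
Qed.

(** The matrix is [fm_wt j] times the weight evaluated at the j-th path of [g]. The forward
    condition comes from [wt_causal], the backward one from [wt_adapted]. *)
Lemma near_model_matrix (p c : R) (f g : fmodel R n) :
  near_model p f (fm_process g) c ->
  exists2 a, bicausal_matrix (f := f) (g := g) a &
    \sum_i \sum_j a i j * pcost p (tnth (fm_pt i)) (tnth (fm_pt j)) <= c `^ p.
Proof.
move=> [k wk ck]; pose zt (j : fm_idx g) : fp_space (fm_process g) := fm_pt j.
pose a (i : fm_idx f) (j : fm_idx g) := fm_wt j * k i (zt j).
have a0 i j : 0 <= a i j by rewrite mulr_ge0 ?fm_ge0// (wt_ge0 wk).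
have intE (A : set (fp_space (fm_process g))) (u : fp_space (fm_process g) -> R) :
    measurable A -> measurable_fun setT u -> (forall x, 0 <= u x) ->
    (\int[fp_prob (fm_process g)]_(x in A) (u x)%:E =
     (\sum_j fm_wt j * \1_A (zt j) * u (zt j))%:E)%E.
  exact: ge0_integral_fm_law.
have mk i := wt_measurable wk i.
have afst i : \sum_j a i j = fm_wt i.
  apply: EFin_inj; rewrite -(wt_mass wk i) intE//; last exact: wt_ge0 wk i.
  by congr (_%:E); apply: eq_bigr => j _; rewrite indicT mulr1.
have asnd j : \sum_i a i j = fm_wt j.
  by rewrite -mulr_sumr (wt_sum1 wk) mulr1.
have ws t i x : 0 <= \sum_(i' | same_past t i i') k i' x by exact: wt_sum_ge0 wk _ _.
have mws t i := wt_sum_measurable wk (same_past t i).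
exists a; last first.
  rewrite -lee_fin; apply: le_trans ck; rewrite /weight_cost -sumEFin.
  apply: lee_sum => i _; rewrite intE//.
  - rewrite lee_fin; apply: ler_sum => j _; rewrite indicT mulr1 /a -!mulrA.
    by rewrite lexx.
  - by apply: measurable_funM => //; exact: measurable_cost_model.
  - by move=> x; rewrite mulr_ge0 ?pcost_ge0// (wt_ge0 wk).
split => //.
- move=> t h h0 hI.
  pose mm (i : fm_idx f) := \sum_(i' | same_past t i i') fm_wt i'.
  pose num i := \sum_(i' | same_past t i i') \sum_j a i' j * h j.
  have num0 i : 0 <= num i.
    by apply: sumr_ge0 => i' _; apply: sumr_ge0 => j _; rewrite mulr_ge0.
  have mm0 i : 0 <= mm i by apply: sumr_ge0 => i' _; exact: fm_ge0.
  exists (fun i => num i / mm i); split.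
  + by move=> i; rewrite divr_ge0.
  + move=> i i' ii'; rewrite /num /mm.
    by rewrite (class_sum_invariant (fun i => \sum_j a i j * h j) ii') (class_sum_invariant _ ii').
  + move=> i.
    have [m0|mn0] := eqVneq (mm i) 0.
      have mi0 : fm_wt i = 0.
        apply/eqP; rewrite eq_le fm_ge0 andbT -m0 /mm (bigD1 i)/= ?same_past_refl//.
        by rewrite lerDl sumr_ge0// => i' _; exact: fm_ge0.
      rewrite mi0 mul0r big1// => j _.
      suff -> : a i j = 0 by rewrite mul0r.
      apply/eqP; rewrite eq_le a0 andbT -mi0 -(afst i) (bigD1 j)//= lerDl.
      by rewrite sumr_ge0.
    apply: (mulfI mn0); rewrite [RHS]mulrCA [X in _ = _ * X]mulrC divfK//.
    (* By [sum_invariant], it is enough that the class sums of [F] vanish; this is [wt_causal] on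
       the event of having the past of the j-th path. *)
    pose F j := mm i * a i j - fm_wt i * \sum_(i' | same_past t i i') a i' j.
    suff : \sum_j F j * h j = 0.
      rewrite /F; under eq_bigr do rewrite mulrBl.
      rewrite sumrB => /subr0_eq; rewrite mulr_sumr.
      under [X in X = _ -> _]eq_bigr do rewrite -mulrA.
      move=> ->; rewrite /num exchange_big/= mulr_sumr; apply: eq_bigr => j _.
      by rewrite -mulrA mulr_suml.
    rewrite (sum_invariant F hI) big1// => j _; rewrite [X in _ * X](_ : _ = 0) ?mulr0//.
    have FB := @canonical_filtration_class R n t (zt j).
    have mB := canonical_sub_measurable FB.
    have BE j' : \1_[set y | past t y = past t (zt j)] (zt j') = (same_past t j j')%:R :> R.
      rewrite indicE; congr ((nat_of_bool _)%:R); apply/idP/idP; rewrite inE /same_past.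
        by move=> /= ->.
      by move=> /eqP ->.
    have := @wt_causal _ _ _ _ _ wk t i _ FB.
    rewrite !intE//; last exact: (wt_ge0 wk i).
    rewrite -!EFinM => -[]; rewrite -/(mm i) => e.
    rewrite /F sumrB -!mulr_sumr; apply/eqP; rewrite subr_eq0; apply/eqP.
    transitivity (mm i * \sum_j' fm_wt j' *
        \1_[set y | past t y = past t (zt j)] (zt j') * k i (zt j')).
      congr (_ * _); rewrite big_mkcond; apply: eq_bigr => j' _; rewrite BE /a.
      by case: same_past; rewrite ?mulr1 ?mulr0 ?mul0r.
    rewrite e; congr (_ * _); rewrite [RHS]big_mkcond; apply: eq_bigr => j' _; rewrite BE.
    case: same_past; rewrite ?mulr1 ?mulr0 ?mul0r// mulr_sumr.
    exact: eq_bigr.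
- move=> t h h0 hI.
  have /choice[s sP] := wt_adapted wk t.
  (* The class sums of the weights are replaced by their adapted versions [s i], with which they
     agree at every path of positive mass. *)
  exists (fun j => \sum_i h i / class_size t i * s i (zt j)); split.
  + move=> j; apply: sumr_ge0 => i _; rewrite mulr_ge0 ?divr_ge0 ?(ltW (class_size_gt0 t i))//.
    by have [_ s01 _] := sP i; case/andP: (s01 (zt j)).
  + move=> j j' /eqP jj'; apply: eq_bigr => i _; congr (_ * _).
    by have [Gs _ _] := sP i; exact: (canonical_Gmeas_past Gs jj').
  + move=> j; rewrite (sum_invariant (fun i => a i j) hI) mulr_sumr; apply: eq_bigr => i _.
    rewrite [RHS]mulrCA; congr (_ * _).
    have [Gs s01 sE] := sP i.
    have FA := @canonical_filtration_class R n ord_max (zt j).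
    have mA := canonical_sub_measurable FA.
    have AE j' : \1_[set y | past ord_max y = past ord_max (zt j)] (zt j') = (j' == j)%:R :> R.
      rewrite indicE; congr ((nat_of_bool _)%:R); apply/idP/idP; rewrite inE.
        by move=> /= /past_last/fm_inj ->.
      by move=> /eqP ->.
    have := sE _ FA; rewrite !intE//; last 2 first.
    * exact: (fp_Gmeas_measurable Gs).
    * by move=> x; case/andP: (s01 x).
    have pick1 (u : fm_idx g -> R) : \sum_j' fm_wt j' *
        \1_[set y | past ord_max y = past ord_max (zt j)] (zt j') * u j' = fm_wt j * u j.
      rewrite (bigD1 j)//= AE eqxx mulr1 big1 ?addr0// => j' jj'.
      by rewrite AE (negbTE jj') mulr0 mul0r.
    rewrite (pick1 (fun j' => \sum_(i' | same_past t i i') k i' (zt j'))).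
    rewrite (pick1 (fun j' => s i (zt j'))) => -[<-].
    by rewrite mulr_sumr.
Qed.

End bicausal_matrices.

(** * Sampling a Markov chain from one uniform variable *)

Section select.
Context (R : realType) (I : finType) (i0 : I) (q : I -> R).

(* The cells [cum i, cum i + q i) partition [0, 1); if [r] is uniform, then its
   rescaled position [rest r] in its cell is uniform and independent of the cell. *)
Definition cum (i : I) : R := \sum_(j | (enum_rank j < enum_rank i)%N) q j.

Definition in_cell (i : I) (r : R) : bool := cum i <= r < cum i + q i.

Definition select (r : R) : I := odflt i0 [pick i | in_cell i r].

Definition rest (r : R) : R := (r - cum (select r)) / q (select r).

Hypotheses (q_ge0 : forall i, 0 <= q i) (q_sum1 : \sum_i q i = 1).

Lemma cum_ge0 i : 0 <= cum i. Proof. by apply: sumr_ge0. Qed.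

Lemma cum_addE i : cum i + q i = \sum_(j | (enum_rank j <= enum_rank i)%N) q j.
Proof.
rewrite [RHS](bigD1 i)//= addrC; congr (_ + _); apply: eq_bigl => j.
rewrite ltn_neqAle andbC; congr (_ && ~~ _).
by rewrite val_eqE (inj_eq enum_rank_inj).
Qed.

Lemma sum_rank_le (A B : pred I) : (forall i, A i -> B i) ->
  \sum_(j | A j) q j <= \sum_(j | B j) q j.
Proof.
move=> AB; rewrite big_mkcond [leRHS]big_mkcond; apply: ler_sum => j _.
by case: ifPn => [/AB ->//|_]; case: (B j).
Qed.

Lemma cum_add_le1 i : cum i + q i <= 1.
Proof. by rewrite cum_addE -q_sum1; apply: sum_rank_le. Qed.

Lemma in_cell_uniq i j r : in_cell i r -> in_cell j r -> i = j.
Proof.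
have lt (k l : I) : (enum_rank k < enum_rank l)%N -> in_cell k r -> ~~ in_cell l r.
  move=> kl /andP[_ rk]; rewrite /in_cell negb_and -ltNge; apply/orP; left.
  apply: (lt_le_trans rk); rewrite cum_addE; apply: sum_rank_le => m mk.
  exact: leq_ltn_trans kl.
move=> ir jr; apply: enum_rank_inj; apply: val_inj.
case: (ltngtP (enum_rank i) (enum_rank j)) => // h.
- by have := lt _ _ h ir; rewrite jr.
- by have := lt _ _ h jr; rewrite ir.
Qed.

(** If no cell contained [r], all partial sums of [q] would stay below [r] by induction, including
    the total sum 1. *)
Lemma in_cell_ex r : 0 <= r < 1 -> exists i, in_cell i r.
Proof.
move=> /andP[r0 r1]; apply: contrapT => none.
pose C k := \sum_(j | (enum_rank j < k)%N) q j.
suff : C #|I| <= r.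
  rewrite /C (eq_bigl predT) ?q_sum1; first by rewrite leNgt r1.
  by move=> j; rewrite ltn_ord.
suff H k : (k <= #|I|)%N -> C k <= r by exact: H.
elim: k => [_|k ih kI]; first by rewrite /C big_pred0.
have := ih (ltnW kI); pose i := enum_val (Ordinal kI).
have ik : enum_rank i = k :> nat by rewrite /i enum_valK.
have -> : C k = cum i by apply: eq_bigl => j; rewrite ik.
have -> : C k.+1 = cum i + q i by rewrite cum_addE; apply: eq_bigl => j; rewrite ik.
by move=> ci; rewrite leNgt; apply/negP => h; apply: none; exists i; rewrite /in_cell ci.
Qed.

Lemma selectP r : 0 <= r < 1 -> in_cell (select r) r.
Proof.
move=> /in_cell_ex[i ir]; rewrite /select; case: pickP => [//|/(_ i)].
by rewrite ir.
Qed.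

Lemma selectE i r : 0 <= r < 1 -> (select r == i) = in_cell i r.
Proof.
move=> r01; apply/eqP/idP => [<-|ir]; first exact: selectP.
exact: in_cell_uniq (selectP r01) ir.
Qed.

Lemma in_cell_gt0 i r : in_cell i r -> 0 < q i.
Proof. by move=> /andP[a b]; rewrite -(ltrDl (cum i)); exact: le_lt_trans b. Qed.

Lemma rest01 r : 0 <= r < 1 -> 0 <= rest r < 1.
Proof.
move=> r01; have := selectP r01 => h; have q0 := in_cell_gt0 h; case/andP: h => h1 h2.
rewrite /rest divr_ge0 ?(ltW q0) ?subr_ge0//= ltr_pdivrMr// mul1r ltrBlDl//.
Qed.

Lemma select_restP i (a b r : R) : 0 <= r < 1 -> 0 <= a -> b <= 1 ->
  (select r = i /\ a <= rest r < b) <-> cum i + a * q i <= r < cum i + b * q i.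
Proof.
move=> r01 a0 b1; split=> [[<-]|/andP[h1 h2]].
  have q0 := in_cell_gt0 (selectP r01).
  by rewrite /rest ler_pdivlMr// ltr_pdivrMr// lerBrDl ltrBlDl.
have ir : in_cell i r.
  apply/andP; split; first by apply: le_trans h1; rewrite lerDl mulr_ge0.
  by apply: (lt_le_trans h2); rewrite lerD2l ler_piMl.
have si : select r = i by apply/eqP; rewrite selectE.
have q0 := in_cell_gt0 ir.
by split => //; rewrite /rest si ler_pdivlMr// ltr_pdivrMr// lerBrDl ltrBlDl h1.
Qed.

Section law.
Context d (T : measurableType d) (P : probability T R) (r : T -> R).
Hypotheses (mr : measurable_fun setT r) (r01 : forall w, 0 <= r w < 1).

Lemma measurable_between (u : T -> R) (a b : R) : measurable_fun setT u ->
  measurable [set w | a <= u w < b].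
Proof.
move=> mu; rewrite (_ : [set _ | _] = u @^-1` `[a, b[%classic).
  by rewrite -[X in measurable X]setTI; exact: mu.
by apply/seteqP; split => w; rewrite /= in_itv.
Qed.

Lemma measurable_select i : measurable [set w | select (r w) = i].
Proof.
rewrite (_ : [set _ | _] = [set w | cum i <= r w < cum i + q i]).
  exact: measurable_between.
by apply/seteqP; split => w /= => [/eqP|h]; [|apply/eqP]; rewrite selectE.
Qed.

Lemma measurable_rest : measurable_fun setT (fun w => rest (r w)).
Proof.
rewrite (_ : (fun w => _) = fun w =>
    \sum_i \1_[set w | select (r w) = i] w * ((r w - cum i) / q i)).
  apply: measurable_sum => i; apply: measurable_funM.
    by apply: measurable_indic; exact: measurable_select.
  by apply: measurable_funM => //; exact: measurable_funB.
apply/funext => w; rewrite (bigD1 (select (r w)))//= indicE mem_set// mul1r.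
rewrite big1 ?addr0// => i ni; rewrite indicE memNset ?mul0r// => e.
by rewrite e eqxx in ni.
Qed.

Local Open Scope ereal_scope.

(** Uniformity of [r] conditionally on [D], tested on intervals and without division, so that null
    sets [D] are allowed. *)
Definition uniform_on (D : set T) : Prop := forall a b : R,
  (0 <= a)%R -> (a <= b)%R -> (b <= 1)%R ->
  P (D `&` [set w | (a <= r w < b)%R]) = (b - a)%:E * P D.

(** The event confines [r] to a subinterval of the i-th cell, of length [(b - a) q i]. *)
Lemma select_rest_law D i (a b : R) : uniform_on D ->
  (0 <= a)%R -> (a <= b)%R -> (b <= 1)%R ->
  P (D `&` [set w | select (r w) = i] `&` [set w | (a <= rest (r w) < b)%R]) =
  ((b - a) * q i)%:E * P D.
Proof.
move=> uD a0 ab b1.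
rewrite -setIA (_ : _ `&` [set w | (a <= rest (r w) < b)%R] =
    [set w | (cum i + a * q i <= r w < cum i + b * q i)%R]).
  rewrite uD.
  - by congr (_%:E * _); ring.
  - by rewrite addr_ge0 ?cum_ge0// mulr_ge0.
  - by rewrite lerD2l ler_wpM2r.
  - by apply: le_trans (cum_add_le1 i); rewrite lerD2l ler_piMl.
by apply/seteqP; split => w /= h; apply/(select_restP i (r01 w) a0 b1).
Qed.

Lemma select_law D i : uniform_on D ->
  P (D `&` [set w | select (r w) = i]) = (q i)%:E * P D.
Proof.
move=> uD; have := select_rest_law i uD (lexx 0%R) ler01 (lexx 1%R).
rewrite subr0 mul1r => <-; congr (P _); rewrite -[LHS]setIT; congr (_ `&` _).
by apply/seteqP; split => w //= _; exact: rest01.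
Qed.

End law.

End select.

Section chain.
Local Open Scope ereal_scope.
Context (R : realType) (n : nat) (f : nat -> fmodel R n).
Variable a : forall k, fm_idx (f k) -> fm_idx (f k.+1) -> R.
Arguments a : clear implicits.
Hypothesis ba : forall k, bicausal_matrix (a k).
Context d (T : measurableType d) (P : probability T R) (U : T -> R).
Hypotheses (mU : measurable_fun setT U) (U01 : forall w, (0 <= U w < 1)%R).
Hypothesis U_law : uniform_on P U setT.

(* the fallback makes the row of a null index a probability as well *)
Definition cond_wt k (i : fm_idx (f k)) (j : fm_idx (f k.+1)) : R :=
  if fm_wt i == 0%R then fm_wt j else (a k i j / fm_wt i)%R.

Lemma cond_wt_ge0 k i j : (0 <= @cond_wt k i j)%R.
Proof.
rewrite /cond_wt; case: ifP => _; first exact: fm_ge0.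
by rewrite divr_ge0 ?fm_ge0// (bm_ge0 (ba k)).
Qed.

Lemma cond_wt_sum1 k i : (\sum_j @cond_wt k i j = 1)%R.
Proof.
rewrite /cond_wt; have [_|m0] := eqVneq (fm_wt i) 0%R; first exact: fm_sum.
by rewrite -mulr_suml (bm_fst (ba k)) divff.
Qed.

Lemma cond_wtE k i j : (fm_wt i * @cond_wt k i j = a k i j)%R.
Proof.
rewrite /cond_wt; have [m0|m0] := eqVneq (fm_wt i) 0%R; last by rewrite mulrC divfK.
rewrite m0 mul0r; apply/esym/eqP; rewrite eq_le (bm_ge0 (ba k)) andbT.
rewrite -m0 -(bm_fst (ba k) i) (bigD1 j)//= lerDl sumr_ge0// => j' _.
exact: (bm_ge0 (ba k)).
Qed.

Definition fm_default (g : fmodel R n) : fm_idx g := xchoose (fm_idx_inhabited g).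

(** The state and the randomness still available. Each step consumes the position of the residue
    among the cells and passes on its rescaled position, so [U] alone drives the whole chain. *)
Fixpoint chain (k : nat) (w : T) : fm_idx (f k) * R :=
  match k with
  | 0 => (select (fm_default (f 0)) (@fm_wt _ _ (f 0)) (U w),
          rest (fm_default (f 0)) (@fm_wt _ _ (f 0)) (U w))
  | k'.+1 => let: (y, r) := chain k' w in
    (select (fm_default (f k'.+1)) (@cond_wt k' y) r,
     rest (fm_default (f k'.+1)) (@cond_wt k' y) r)
  end.

Definition state k (w : T) : fm_idx (f k) := (chain k w).1.
Definition residue k (w : T) : R := (chain k w).2.

Lemma stateS k w : state k.+1 w =
  select (fm_default (f k.+1)) (@cond_wt k (state k w)) (residue k w).
Proof. by rewrite /state /residue /=; case: (chain k w). Qed.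

Lemma residueS k w : residue k.+1 w =
  rest (fm_default (f k.+1)) (@cond_wt k (state k w)) (residue k w).
Proof. by rewrite /state /residue /=; case: (chain k w). Qed.

Lemma residue01 k w : (0 <= residue k w < 1)%R.
Proof.
elim: k => [|k ih].
  by apply: rest01 => //; exact: fm_sum.
by rewrite residueS; apply: rest01 => //; exact: cond_wt_sum1.
Qed.

Lemma measurable_chain k :
  (forall i, measurable [set w | state k w = i]) /\ measurable_fun setT (residue k).
Proof.
elim: k => [|k [mY mr]].
  split=> [i|].
    by apply: measurable_select => //; [exact: fm_ge0|exact: fm_sum].
  by apply: measurable_rest => //; [exact: fm_ge0|exact: fm_sum].
split=> [i|].
  rewrite (_ : [set _ | _] = \bigcup_(j in [set: fm_idx (f k)]) ([set w | state k w = j] `&`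
      [set w | select (fm_default (f k.+1)) (@cond_wt k j) (residue k w) = i])).
    apply: fin_bigcup_measurable => [|j _]; first exact: finite_finset.
    apply: measurableI => //; apply: measurable_select => //.
    - exact: cond_wt_ge0.
    - exact: cond_wt_sum1.
    - exact: residue01.
  apply/seteqP; split => w /=.
    by rewrite stateS => h; exists (state k w).
  by move=> [j _ [<-]]; rewrite stateS.
rewrite (_ : residue _ = fun w => (\sum_j \1_[set w | state k w = j] w *
    rest (fm_default (f k.+1)) (@cond_wt k j) (residue k w))%R).
  apply: measurable_sum => j; apply: measurable_funM; first exact: measurable_indic.
  apply: measurable_rest => //.
  - exact: cond_wt_ge0.
  - exact: cond_wt_sum1.
  - exact: residue01.
apply/funext => w; rewrite residueS (bigD1 (state k w))//= indicE mem_set// mul1r.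
rewrite big1 ?addr0// => j nj; rewrite indicE memNset ?mul0r// => e.
by rewrite e eqxx in nj.
Qed.

Lemma measurable_state k i : measurable [set w | state k w = i].
Proof. exact: (measurable_chain k).1. Qed.

Lemma measurable_stateP k (A : pred (fm_idx (f k))) : measurable [set w | A (state k w)].
Proof.
rewrite (_ : [set _ | _] = \bigcup_(j in [set j | A j]) [set w | state k w = j]).
  by apply: fin_bigcup_measurable => [|j _]; [exact: finite_finset|exact: measurable_state].
apply/seteqP; split => w => [h|[j Aj wj]]; first by exists (state k w).
by rewrite /mkset (wj : state k w = j).
Qed.

Lemma measurable_residue k : measurable_fun setT (residue k).
Proof. exact: (measurable_chain k).2. Qed.

Lemma state_split k (A : pred (fm_idx (f k))) (D : set T) : measurable D ->
  P (D `&` [set w | A (state k w)]) = \sum_(i | A i) P (D `&` [set w | state k w = i]).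
Proof.
move=> mD.
have mA := measurable_stateP A.
transitivity (\int[P]_(w in D) \sum_(i | A i) (\1_[set w | state k w = i] w)%:E).
  rewrite setIC -integral_indic//; apply: eq_integral => w _; rewrite sumEFin; congr (_%:E).
  under eq_bigr do rewrite indicE.
  have [Aw|nAw] := boolP (A (state k w)).
    rewrite indicE mem_set// (bigD1 (state k w))//= mem_set// big1 ?addr0// => j /andP[_ nj].
    by rewrite memNset// => e; rewrite e eqxx in nj.
  rewrite indicE memNset; last exact/negP.
  by rewrite big1// => j Aj; rewrite memNset// => e; rewrite e Aj in nAw.
under eq_integral do rewrite big_mkcond.
rewrite ge0_integral_sum//; last 2 first.
- move=> i; case: (A i) => //; apply/measurable_EFinP; apply: measurable_funTS.
  by apply: measurable_indic; exact: measurable_state.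
- by move=> i w _; case: (A i).
rewrite [RHS]big_mkcond; apply: eq_bigr => i _; case: (A i); last by rewrite integral0.
rewrite (setIC D) integral_indic//; exact: measurable_state.
Qed.

(* the residue after time [k] is independent of an event fixed by time [k] *)
Definition settled k (E : set T) : Prop := measurable E /\
  forall i, uniform_on P (residue k) (E `&` [set w | state k w = i]).

Lemma settled0 : settled 0 setT.
Proof.
split=> // i c b c0 cb b1; rewrite !setTI.
have -> : [set w | state 0 w = i] = setT `&` [set w | state 0 w = i] by rewrite setTI.
rewrite (select_rest_law _ (@fm_ge0 _ _ (f 0)) (fm_sum (f 0)) U01 i U_law)//.
rewrite (select_law _ (@fm_ge0 _ _ (f 0)) (fm_sum (f 0)) U01 i U_law).
by rewrite EFinM muleA.
Qed.

Lemma stateS_law k E i j : settled k E ->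
  P (E `&` [set w | state k w = i] `&` [set w | state k.+1 w = j]) =
  (cond_wt i j)%:E * P (E `&` [set w | state k w = i]).
Proof.
move=> [_ uE]; rewrite -(select_law (fm_default (f k.+1)) (@cond_wt_ge0 k i)
  (@cond_wt_sum1 k i) (residue01 k) j (uE i)).
by congr (P _); apply/seteqP; split => w [[Ew /= <-]]; rewrite stateS.
Qed.

(** Within the cell of the new state the rescaled residue is uniform again, which renews the
    randomness for the next step. *)
Lemma settledS_state k E i : settled k E -> settled k.+1 (E `&` [set w | state k w = i]).
Proof.
move=> sE; have [mE uE] := sE; split.
  by apply: measurableI => //; exact: measurable_state.
move=> j c b c0 cb b1; rewrite stateS_law// muleA -EFinM.
rewrite -(select_rest_law (fm_default (f k.+1)) (@cond_wt_ge0 k i)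
  (@cond_wt_sum1 k i) (residue01 k) j (uE i) c0 cb b1).
by congr (P _); apply/seteqP; split => w [[[Ew /= <-]]]; rewrite /= stateS residueS.
Qed.

Lemma settledS k E (A : pred (fm_idx (f k))) : settled k E ->
  settled k.+1 (E `&` [set w | A (state k w)]).
Proof.
move=> sE; have [mE _] := sE; split.
  by apply: measurableI => //; exact: measurable_stateP.
have sw (B C : set T) : (B `&` [set w | A (state k w)]) `&` C =
    (B `&` C) `&` [set w | A (state k w)].
  by rewrite setIAC.
move=> j c b c0 cb b1.
have mj := measurable_state (k := k.+1) j.
have mb := measurable_between c b (measurable_residue k.+1).
have m1 : measurable (E `&` [set w | state k.+1 w = j]) by exact: measurableI.
have m2 := measurableI _ _ m1 mb.
rewrite !sw !state_split//.
rewrite ge0_sume_distrr//; apply: eq_bigr => i _.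
have [_ /(_ j c b c0 cb b1)] := settledS_state i sE.
by rewrite !(setIAC _ _ [set w | state k w = i]).
Qed.

End chain.

Section path_events.
Local Open Scope ereal_scope.
Context (R : realType) (n : nat) (f : nat -> fmodel R n).
Variable a : forall k, fm_idx (f k) -> fm_idx (f k.+1) -> R.
Arguments a : clear implicits.
Hypothesis ba : forall k, bicausal_matrix (a k).
Context d (T : measurableType d) (P : probability T R) (U : T -> R).
Hypotheses (mU : measurable_fun setT U) (U01 : forall w, (0 <= U w < 1)%R).
Hypothesis U_law : uniform_on P U setT.

Local Notation Y k w := (state a U k w).
Local Notation "[ 'at' k i ]" := [set w | Y k w = i] (k at level 9, i at level 9).

Let mY k i : measurable [at k i].
Proof. exact: measurable_state. Qed.

Let mYP k (A : pred (fm_idx (f k))) : measurable [set w | A (Y k w)].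
Proof. exact: measurable_stateP. Qed.

Let state_splitT k (D : set T) : measurable D -> P D = \sum_i P (D `&` [at k i]).
Proof.
move=> mD; have := state_split ba P mU U01 (k := k) xpredT mD.
by rewrite (_ : [set w | _] = setT) ?setIT//; apply/seteqP; split.
Qed.

Definition path_event (A : forall k, pred (fm_idx (f k))) (l m : nat) : set T :=
  [set w | forall k, (l <= k < m)%N -> A k (Y k w)].

Lemma path_event_nil A l : path_event A l l = setT.
Proof.
by apply/seteqP; split => // w _ k /andP[lk kl]; have := leq_ltn_trans lk kl; rewrite ltnn.
Qed.

Lemma path_event_cat A l k m : (l <= k <= m)%N ->
  path_event A l m = path_event A l k `&` path_event A k m.
Proof.
move=> /andP[lk km]; apply/seteqP; split => w => [h|[h1 h2] j /andP[lj jm]].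
  by split => j /andP[lj jm]; apply: h; rewrite ?lj ?jm ?(leq_trans jm)// (leq_trans lk).
by have [jk|kj] := ltnP j k; [apply: h1; rewrite lj|apply: h2; rewrite kj].
Qed.

Lemma path_event1 A k : path_event A k k.+1 = [set w | A k (Y k w)].
Proof.
apply/seteqP; split => w /= => [|Aw j /andP[kj]]; first by apply; rewrite leqnn ltnSn.
by rewrite ltnS => jk; have -> : j = k by apply/eqP; rewrite eqn_leq jk.
Qed.

Lemma path_eventS A m : path_event A 0 m.+1 = path_event A 0 m `&` [set w | A m (Y m w)].
Proof. by rewrite (@path_event_cat A 0 m) ?leqnSn// path_event1. Qed.

Lemma measurable_path_event A l m : measurable (path_event A l m).
Proof.
rewrite (_ : path_event A l m =
    \bigcap_(k in [set k | (l <= k < m)%N]) [set w | A k (Y k w)]) //.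
by apply: bigcap_measurableType => k _; exact: mYP.
Qed.

Lemma settled_path A m : settled a P U m (path_event A 0 m).
Proof.
elim: m => [|m ih]; first by rewrite path_event_nil; exact: settled0.
by rewrite path_eventS; exact: settledS.
Qed.

Lemma settledT m : settled a P U m setT.
Proof.
have := settled_path (fun k => xpredT) m.
by rewrite (_ : path_event _ _ _ = setT)//; apply/seteqP; split.
Qed.

Lemma state0_law i : P [at 0 i] = (fm_wt i)%:E.
Proof.
have := select_law (fm_default (f 0)) (@fm_ge0 _ _ (f 0)) (fm_sum (f 0)) U01 i U_law.
by rewrite [X in _ = _ * X](probability_setT P) mule1 setTI.
Qed.

Lemma state_law k i : P [at k i] = (fm_wt i)%:E.
Proof.
elim: k i => [|k ih] j; first exact: state0_law.
rewrite (state_splitT k (mY j)).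
rewrite -(bm_snd (ba k)) -sumEFin; apply: eq_bigr => i _.
rewrite setIC -[X in P (X `&` _)]setTI (stateS_law ba U01 i j (settledT k)).
by rewrite setTI ih -EFinM mulrC cond_wtE.
Qed.

Lemma state_joint_law k i j : P ([at k i] `&` [at k.+1 j]) = (a k i j)%:E.
Proof.
rewrite -[X in P (X `&` _)]setTI (stateS_law ba U01 i j (settledT k)).
by rewrite setTI state_law -EFinM mulrC cond_wtE.
Qed.

Section one_time.
Variables (t : 'I_n.+1) (A : forall k, pred (fm_idx (f k))).
Arguments A : clear implicits.
Hypothesis At : forall k i j, same_past t i j -> A k i = A k j.

(* given the present, a past event only depends on the past up to [t] *)
Lemma backward_law m : exists g : fm_idx (f m) -> R,
  [/\ forall i, (0 <= g i)%R, past_invariant t g &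
   forall i, P (path_event A 0 m `&` [at m i]) = (fm_wt i * g i)%:E].
Proof.
elim: m => [|m [g [g0 gI gE]]].
  exists (fun=> 1%R); split => // i.
  by rewrite path_event_nil setTI mulr1 state0_law.
have hI : past_invariant t (fun i => (A m i)%:R * g i)%R.
  by move=> i j ij; rewrite (At ij) (gI _ _ ij).
have h0 i : (0 <= (A m i)%:R * g i)%R by rewrite mulr_ge0.
have [g' [g'0 g'I g'E]] := bm_bwd (ba m) h0 hI.
exists g'; split => // j; rewrite -g'E path_eventS setIAC.
have mE := measurableI _ _ (measurable_path_event A 0 m) (mY (k := m.+1) j).
rewrite (state_split ba P mU U01 (A m) mE) -sumEFin big_mkcond; apply: eq_bigr => i _.
case: (A m i); last by rewrite mul0r mulr0.
rewrite setIAC (stateS_law ba U01 i j (settled_path A m)) gE -EFinM mul1r.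
by rewrite mulrA [(cond_wt _ _ _ * _)%R]mulrC cond_wtE.
Qed.

(** Iterating [bm_fwd] shows that the conditional probability of a future event depends on the past
    up to [t] of the present state. A state of mass 0 is excluded, as its row in [cond_wt] is only
    the fallback. *)
Lemma forward_law c m : exists h : fm_idx (f m) -> R,
  [/\ forall i, (0 <= h i)%R, past_invariant t h &
   forall E i, settled a P U m E -> fm_wt i != 0%R ->
     P (E `&` [at m i] `&` path_event A m (m + c)) = (h i)%:E * P (E `&` [at m i])].
Proof.
elim: c m => [|c ih] m.
  by exists (fun=> 1%R); split => // E i _ _; rewrite addn0 path_event_nil setIT mul1e.
have [h' [h'0 h'I h'E]] := ih m.+1.
have [h [h0 hI hE]] := bm_fwd (ba m) h'0 h'I.
exists (fun i => (A m i)%:R * h i)%R; split.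
- by move=> i; rewrite mulr_ge0.
- by move=> i j ij; rewrite (At ij) (hI _ _ ij).
move=> E i sE mi0.
rewrite (@path_event_cat A m m.+1) ?leqnSn ?addnS ?ltnS ?leq_addr// path_event1.
have [Ai|nAi] := boolP (A m i); last first.
  rewrite mul0r mul0e (_ : _ `&` _ = set0) ?measure0//.
  by apply/seteqP; split => // w [[_ /= wi] [/= + _]]; rewrite wi (negbTE nAi).
rewrite mul1r (_ : _ `&` (_ `&` _) = E `&` [at m i] `&` path_event A m.+1 (m.+1 + c)); last first.
  rewrite addSn; apply/seteqP; split => w => [[? [_ ?]]//|[[Ew wi] ?]].
  by do 2?split => //; rewrite /= (wi : Y m w = i).
have sE' := settledS_state ba mU U01 i sE.
have [mE' _] := sE'.
have mp := measurable_path_event A m.+1 (m.+1 + c).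
rewrite (state_splitT m.+1 (measurableI _ _ mE' mp)).
rewrite (eq_bigr (fun j => (h' j * cond_wt a i j)%:E * P (E `&` [at m i]))); last first.
  move=> j _; have [mj0|mj0] := eqVneq (fm_wt j) 0%R.
    have k0 : cond_wt a i j = 0%R.
      apply: (mulfI mi0); rewrite cond_wtE// mulr0; apply/eqP.
      rewrite eq_le (bm_ge0 (ba m)) andbT -mj0 -(bm_snd (ba m) j) (bigD1 i)//= lerDl.
      by rewrite sumr_ge0// => i' _; exact: bm_ge0 (ba m) _ _.
    rewrite k0 mulr0 mul0e; apply: (subset_measure0 (B := E `&` [at m i] `&` [at m.+1 j])) => //.
    - by apply: measurableI => //; exact: measurableI.
    - exact: measurableI.
    - by move=> w [[? _] ?].
    - by apply: etrans (stateS_law ba U01 i j sE) _; rewrite k0 mul0e.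
  by rewrite setIAC h'E// (stateS_law ba U01 i j sE) muleA -EFinM.
rewrite -ge0_sume_distrl; last first.
  by move=> j _; rewrite lee_fin mulr_ge0// cond_wt_ge0.
congr (_ * _); rewrite sumEFin; congr (_%:E); apply: (mulfI mi0).
rewrite -hE mulr_sumr; apply: eq_bigr => j _.
by rewrite mulrCA cond_wtE// mulrC.
Qed.

(** Past and future of the chain are independent given the state at [k], so the invariant factors of
    [backward_law] and [forward_law] multiply. *)
Lemma path_event_law m k : exists g : fm_idx (f k) -> R,
  past_invariant t g /\ forall i, P (path_event A 0 (k + m) `&` [at k i]) = (fm_wt i * g i)%:E.
Proof.
have [g [g0 gI gE]] := backward_law k; have [h [h0 hI hE]] := forward_law m k.
exists (fun i => h i * g i)%R; split.
  by move=> i j ij; rewrite (hI _ _ ij) (gI _ _ ij).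
move=> i; rewrite (@path_event_cat A 0 k) ?leq_addr// setIAC.
have mE := measurable_path_event A 0 k.
have [mi0|mi0] := eqVneq (fm_wt i) 0%R; last first.
  by rewrite hE//; [rewrite gE -EFinM mulrCA|exact: settled_path].
rewrite mi0 mul0r.
apply: (subset_measure0 (B := path_event A 0 k `&` [at k i])) => //.
- by apply: measurableI; [exact: measurableI|exact: measurable_path_event].
- exact: measurableI.
- by apply: etrans (gE i) _; rewrite mi0 mul0r.
Qed.

End one_time.

(** Events on finitely many members of the chain that only look at the coordinates up to [t]. They
    are closed under intersection and generate the filtration of the limit. *)
Definition cylinders (t : 'I_n.+1) : set (set T) :=
  [set B | exists A m, (forall k i j, same_past t i j -> A k i = A k j) /\
    B = path_event A 0 m].

Lemma cylinders_setI t : setI_closed (cylinders t).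
Proof.
move=> _ _ [A [m [At ->]]] [A' [m' [A't ->]]].
exists (fun k i => ((k < m)%N ==> A k i) && ((k < m')%N ==> A' k i)), (maxn m m').
split=> [k i j ij|]; first by rewrite (At _ _ _ ij) (A't _ _ _ ij).
apply/seteqP; split => w => [[h h'] k _|h].
  by apply/andP; split; apply/implyP => km; [exact: h|exact: h'].
split=> k /andP[_ km].
- have km' : (0 <= k < maxn m m')%N by rewrite leq_max km.
  by have /andP[/implyP + _] := h k km'; exact.
- have km' : (0 <= k < maxn m m')%N by rewrite leq_max km orbT.
  by have /andP[_ /implyP] := h k km'; exact.
Qed.

Lemma cylinders_measurable t : cylinders t `<=` measurable.
Proof. by move=> _ [A [m [_ ->]]]; exact: measurable_path_event. Qed.

Lemma cylinders_le (s t : 'I_n.+1) : (s <= t)%N -> cylinders s `<=` cylinders t.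
Proof.
move=> st _ [A [m [As ->]]]; exists A, m; split => // k i j ij; apply: As.
move: ij; rewrite /same_past => /eqP/pastP ij; apply/eqP/pastP => u us.
by apply: ij; exact: leq_trans st.
Qed.

Lemma cylinders_pt t k (Q : pred (n.+1.-tuple R)) :
  (forall x y, past t x = past t y -> Q x = Q y) ->
  cylinders t [set w | Q (fm_pt (Y k w))].
Proof.
move=> Qt; exists (fun l i => (l == k) ==> Q (fm_pt i)), k.+1; split.
  by move=> l i j /eqP ij; rewrite (Qt _ _ ij).
apply/seteqP; split => w /= => [Qw l _|/(_ k)]; last by rewrite leq0n ltnSn eqxx; exact.
by apply/implyP => /eqP ->.
Qed.

(** The identity [wt_causal] for the weights of the chain. Both sides are finite measures in [B],
    and on cylinders they agree because the factor of [path_event_law] is constant on the class of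
    [i]. *)
Lemma cylinder_law t k (i : fm_idx (f k)) B : <<s cylinders t >> B ->
  (\sum_(j | same_past t i j) fm_wt j)%:E * P (B `&` [at k i]) =
  (fm_wt i)%:E * P (B `&` [set w | same_past t i (Y k w)]).
Proof.
move=> tB.
have mm0 : (0 <= \sum_(j | same_past t i j) fm_wt j)%R.
  by apply: sumr_ge0 => j _; exact: fm_ge0.
have mC : measurable [set w | same_past t i (Y k w)] by exact: mYP.
pose m1 : {measure set T -> \bar R} := mscale (NngNum mm0) (mrestr P (mY i)).
pose m2 : {measure set T -> \bar R} := mscale (NngNum (fm_ge0 i)) (mrestr P mC).
rewrite -[LHS]/(m1 B) -[RHS]/(m2 B).
apply: (g_sigma_algebra_measure_unique (cylinders t) (@cylinders_measurable t) (fun=> setT)) => //.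
- by move=> _; exists (fun=> xpredT), 0%N; split => //; rewrite path_event_nil.
- by rewrite bigcup_const//; exists 0%N.
- exact: cylinders_setI.
- move=> _ [A [m [At ->]]]; rewrite /m1 /m2 /mscale /mrestr /=.
  (* Trivial conditions are added from [m] on, so that the window extends to [k + m] and contains
     the time [k]. *)
  pose A' l (j : fm_idx (f l)) := (l < m)%N ==> A l j.
  have A't l p q : same_past t p q -> A' l p = A' l q by move=> /At pq; rewrite /A' pq.
  have [g [gI gE]] := path_event_law A't m k.
  have -> : path_event A 0 m = path_event A' 0 (k + m).
    apply/seteqP; split => w h l /andP[_ lm]; first by apply/implyP => lm'; exact: h.
    have /implyP : A' l (Y l w) by apply: h; rewrite /= ltn_addl.
    by exact.
  have mE := measurable_path_event A' 0 (k + m).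
  transitivity ((\sum_(j | same_past t i j) fm_wt j)%:E * (fm_wt i * g i)%:E).
    by congr (_ * _); exact: gE.
  transitivity ((fm_wt i)%:E * (\sum_(j | same_past t i j) fm_wt j * g i)%:E).
    by rewrite -!EFinM -mulr_suml; congr (_%:E); ring.
  congr (_ * _); apply/esym.
  apply: etrans (state_split ba P mU U01 (same_past t i) mE) _.
  by rewrite -sumEFin; apply: eq_bigr => j ij; rewrite gE (gI _ _ ij).
- move=> _; rewrite -[ltLHS]/((\sum_(j | same_past t i j) fm_wt j)%:E * P (setT `&` [at k i])).
  by rewrite setTI state_law -EFinM ltry.
Qed.

End path_events.

Lemma limn_esup_between (R : realType) (u : nat -> R) (k : nat) (l h : R) :
  (forall m, (k <= m)%N -> l <= u m <= h) ->
  l <= fine (limn_esup (fun m => (u m)%:E)) <= h.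
Proof.
move=> uk; pose v m := (u m)%:E.
have [lv vh] : (l%:E <= limn_esup v)%E /\ (limn_esup v <= h%:E)%E.
  rewrite limn_esup_lim; split.
    apply: lime_ge; first exact: is_cvg_esups.
    exists k => // m /= km; apply: (@le_trans _ _ (v m)).
      by rewrite lee_fin; case/andP: (uk m km).
    by apply: ereal_sup_ubound; exists m => /=.
  apply: lime_le; first exact: is_cvg_esups.
  exists k => // m /= km; apply: ge_ereal_sup => _ [j /= mj <-].
  by rewrite lee_fin; case/andP: (uk j (leq_trans km mj)).
have vf : limn_esup v \is a fin_num.
  by rewrite fin_numE gt_eqF ?lt_eqF// ?(lt_le_trans (ltNyr l))// (le_lt_trans vh)// ltry.
by rewrite -!lee_fin fineK// lv.
Qed.

Lemma geometric_dist (R : realType) (u : nat -> R) (C : R) :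
  (forall k, `|u k - u k.+1| <= C * 2^-1 ^+ k) ->
  forall k m, (k <= m)%N -> `|u k - u m| <= 2 * C * 2^-1 ^+ k.
Proof.
move=> uC; have C0 : 0 <= C by have := uC 0%N; rewrite expr0 mulr1; exact: le_trans.
(* The subtracted term makes the induction on [c] close. *)
have H k c : `|u k - u (k + c)%N| <= 2 * C * (2^-1 ^+ k - 2^-1 ^+ (k + c)).
  elim: c => [|c ih]; first by rewrite addn0 !subrr mulr0 normr0.
  rewrite addnS -(subrK (u (k + c)%N) (u k)) -addrA.
  apply: (le_trans (ler_normD _ _)); apply: (le_trans (lerD ih (uC _))).
  by rewrite exprS; lra.
move=> k m km; rewrite -(subnKC km); apply: (le_trans (H _ _)).
apply: ler_wpM2l; first by rewrite mulr_ge0.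
by rewrite lerBlDr lerDl exprn_ge0.
Qed.

(** * The limit of a chain of models *)

Section limit_process.
Local Open Scope ereal_scope.
Context (R : realType) (n : nat) (p : R) (p_ge1 : (1 <= p)%R).
Variable f : nat -> fmodel R n.
Variable a : forall k, fm_idx (f k) -> fm_idx (f k.+1) -> R.
Arguments a : clear implicits.
Hypothesis ba : forall k, bicausal_matrix (a k).
Hypothesis a_cost : forall k, (\sum_i \sum_j a k i j *
  pcost p (tnth (fm_pt i)) (tnth (fm_pt j)) <= (4^-1 ^+ k) `^ p)%R.
Context d (T : measurableType d) (P : probability T R) (U : T -> R).
Hypotheses (mU : measurable_fun setT U) (U01 : forall w, (0 <= U w < 1)%R).
Hypothesis U_law : uniform_on P U setT.

Let p_gt0 : (0 < p)%R. Proof. exact: lt_le_trans ltr01 p_ge1. Qed.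

Local Notation Y k w := (state a U k w).
Local Notation N := (n.+1%:R : R).

Let mY k i : measurable [set w | Y k w = i].
Proof. exact: measurable_state. Qed.

Definition chain_coord (k : nat) (w : T) : 'I_n.+1 -> R := tnth (fm_pt (Y k w)).

(** The upper limit exists and is measurable without any convergence; [fine] turns infinite values
    into 0. *)
Definition lim_coord (t : 'I_n.+1) (w : T) : R :=
  fine (limn_esup (fun k => (chain_coord k w t)%:E)).

Definition lim_filtration (t : 'I_n.+1) : set (set T) := <<s cylinders a U t >>.

Lemma lim_sigma_algebra t : sigma_algebra setT (lim_filtration t).
Proof. exact: smallest_sigma_algebra. Qed.

Lemma lim_measurable t : lim_filtration t `<=` measurable.
Proof.
apply: smallest_sub; first exact: sigma_algebra_measurable.
by move=> B; exact: (cylinders_measurable ba mU U01).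
Qed.

Lemma lim_filtration_le (s t : 'I_n.+1) : (s <= t)%N ->
  lim_filtration s `<=` lim_filtration t.
Proof.
move=> st; apply: sub_smallest2r; first exact: smallest_sigma_algebra.
by move=> B; exact: (cylinders_le st).
Qed.

Lemma chain_coord_Gmeas k t : Gmeas (lim_filtration t) (fun w => chain_coord k w t).
Proof.
move=> _ [C mC <-]; rewrite setTI; apply: sub_gen_smallest.
have := cylinders_pt a U (t := t) k (Q := fun x => `[< C (tnth x t) >]).
rewrite (_ : [set w | _] = (fun w => chain_coord k w t) @^-1` C).
  by apply=> x y /pastP ->.
by apply/seteqP; split => w /asboolP.
Qed.

Lemma lim_adapted t : preimage_set_system setT (lim_coord t) measurable `<=` lim_filtration t.
Proof.
suff : Gmeas (lim_filtration t) (lim_coord t) by [].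
apply/(GmeasP (lim_sigma_algebra t)); apply: (measurableT_comp (fine_measurable measurableT)).
apply: measurable_fun_limn_esup => k; apply/measurable_EFinP.
exact: ((GmeasP (lim_sigma_algebra t) _).1 (@chain_coord_Gmeas k t)).
Qed.

Definition lim_process : filtered_process R n.+1 :=
  FilteredProcess P lim_sigma_algebra lim_measurable lim_filtration_le lim_adapted.

Definition step_cost (k : nat) (w : T) : R := pcost p (chain_coord k w) (chain_coord k.+1 w).

(** The factor [2^k] balances two needs: if the sum is a finite D, then the k-th step is at most
    [D^(1/p) 2^-k]; and as the k-th expected cost is at most [(4^-k)^p], the expectation is at most
    the sum of the [2^-k]. *)
Definition total_cost (w : T) : \bar R :=
  \sum_(k <oo) ((2 ^+ k) `^ p * step_cost k w)%:E.

Lemma step_cost_ge0 k w : (0 <= step_cost k w)%R. Proof. exact: pcost_ge0. Qed.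

Lemma chain_coord_measurable k t : measurable_fun setT (fun w => chain_coord k w t).
Proof.
move=> _ B mB; apply: (@lim_measurable t); apply: chain_coord_Gmeas.
by exists B.
Qed.

Lemma step_cost_measurable k : measurable_fun setT (step_cost k).
Proof. by apply: measurable_pcost => t; exact: chain_coord_measurable. Qed.

Let term_ge0 k w : 0 <= ((2 ^+ k) `^ p * step_cost k w)%:E.
Proof. by rewrite lee_fin mulr_ge0 ?powR_ge0 ?step_cost_ge0. Qed.

Let term_measurable k : measurable_fun setT (fun w => ((2 ^+ k) `^ p * step_cost k w)%:E).
Proof.
by apply/measurable_EFinP; apply: measurable_funM => //; exact: step_cost_measurable.
Qed.

Lemma total_cost_measurable : measurable_fun setT total_cost.
Proof.
exact: (@ge0_emeasurable_sum _ T R setT (fun k w => ((2 ^+ k) `^ p * step_cost k w)%:E) xpredT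
  (fun k w _ _ => term_ge0 k w) (fun k _ => @term_measurable k)).
Qed.

Lemma integral_step_cost k : \int[P]_w (step_cost k w)%:E <= ((4^-1 ^+ k) `^ p)%:E.
Proof.
apply: le_trans (_ : _ <= (\sum_i \sum_j a k i j *
  pcost p (tnth (fm_pt i)) (tnth (fm_pt j)))%:E) _; last by rewrite lee_fin.
pose c i j := pcost p (tnth (fm_pt (i : fm_idx (f k)))) (tnth (fm_pt (j : fm_idx (f k.+1)))).
pose B i j := [set w | Y k w = i] `&` [set w | Y k.+1 w = j].
have mB i j : measurable (B i j) by apply: measurableI; exact: mY.
rewrite (eq_integral (fun w => \sum_i \sum_j (c i j * \1_(B i j) w)%:E)); last first.
  move=> w _; rewrite (bigD1 (Y k w))//= (bigD1 (Y k.+1 w))//= indicE mem_set// mulr1.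
  rewrite big1 ?adde0; last first.
    by move=> j nj; rewrite indicE memNset ?mulr0// => -[_ /= e]; rewrite e eqxx in nj.
  rewrite big1 ?adde0// => i ni; rewrite big1// => j _.
  by rewrite indicE memNset ?mulr0// => -[/= e _]; rewrite e eqxx in ni.
have mterm i j : measurable_fun setT (fun w => (c i j * \1_(B i j) w)%:E).
  by apply/measurable_EFinP; apply: measurable_funM => //; exact: measurable_indic.
have term0 i j w : 0 <= (c i j * \1_(B i j) w)%:E by rewrite lee_fin mulr_ge0 ?pcost_ge0.
rewrite ge0_integral_sum//; last 2 first.
- by move=> i; apply: emeasurable_sum => j.
- by move=> i w _; apply: sume_ge0 => j _.
rewrite -sumEFin; apply: lee_sum => i _.
rewrite ge0_integral_sum// -sumEFin; apply: lee_sum => j _.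
under eq_integral do rewrite EFinM.
rewrite ge0_integralZl_EFin ?pcost_ge0//; last by apply/measurable_EFinP; exact: measurable_indic.
rewrite integral_indic// setIT (mulrC (a k i j)) EFinM.
apply: lee_wpmul2l; first by rewrite lee_fin pcost_ge0.
by rewrite le_eqVlt; apply/orP; left; apply/eqP; exact: (state_joint_law ba mU U01 U_law).
Qed.

Lemma integral_total_cost : \int[P]_w total_cost w <= 2%:E.
Proof.
rewrite /total_cost integral_nneseries//.
apply: le_trans (_ : _ <= \sum_(k <oo) (2 / (2 ^ k.+1)%:R)%:E) _; last first.
  exact: epsilon_trick0.
apply: lee_nneseries => [k _ _|k _]; first by apply: integral_ge0 => w _; exact: term_ge0.
under eq_integral do rewrite EFinM.
rewrite ge0_integralZl_EFin ?powR_ge0//; last 2 first.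
- by move=> w _; rewrite lee_fin step_cost_ge0.
- by apply/measurable_EFinP; exact: step_cost_measurable.
apply: le_trans (lee_wpmul2l _ (integral_step_cost k)) _; first by rewrite lee_fin powR_ge0.
have h0 : (0 < 2^-1 ^+ k :> R)%R by rewrite exprn_gt0// invr_gt0.
rewrite -EFinM lee_fin -powRM ?exprn_ge0// -exprMn.
rewrite (_ : 2 * 4^-1 = 2^-1)%R; last by field.
apply: (@le_trans _ _ (2^-1 ^+ k)%R).
  rewrite -[leRHS]powRr1 ?(ltW h0)// ger_powR// h0 exprn_ile1//.
  by rewrite invf_le1// ler1n.
rewrite exprVn natrX exprS invfM mulrA divff// mul1r lexx//.
Qed.

(* The bound is void where [total_cost] is infinite, and elsewhere the
   coordinates converge: no almost sure statement is needed. *)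
Lemma lim_coord_cost k w :
  (pcost p (chain_coord k w) (lim_coord^~ w))%:E <=
  (N * (2 * 2^-1 ^+ k) `^ p)%:E * total_cost w.
Proof.
have h0 (j : nat) : (0 < 2^-1 ^+ j :> R)%R by rewrite exprn_gt0// invr_gt0.
have c0 : (0 < N * (2 * 2^-1 ^+ k) `^ p)%R by rewrite mulr_gt0// powR_gt0// mulr_gt0.
have D0 : 0 <= total_cost w by apply: nneseries_ge0 => j _ _; exact: term_ge0.
have [Dfin|] := boolP (total_cost w \is a fin_num); last first.
  rewrite ge0_fin_numE// -leNgt leye_eq => /eqP ->.
  by rewrite gt0_muley ?leey// lte_fin.
pose D := fine (total_cost w); have DE : total_cost w = D%:E by rewrite /D fineK.
have Dr0 : (0 <= D)%R by rewrite /D fine_ge0.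
have stepD j t : (`|chain_coord j w t - chain_coord j.+1 w t| <= D `^ p^-1 * 2^-1 ^+ j)%R.
  have : ((2 ^+ j) `^ p * `|chain_coord j w t - chain_coord j.+1 w t| `^ p <= D)%R.
    rewrite -lee_fin -DE.
    apply: le_trans (nneseries_lim_ge (m := 0%N) (P := xpredT)
      (u_ := fun j => ((2 ^+ j) `^ p * step_cost j w)%:E) j.+1 _); last first.
      by move=> i _ _; exact: term_ge0.
    rewrite big_nat_recr//=.
    apply: (@le_trans _ _ ((2 ^+ j) `^ p * step_cost j w)%:E).
      rewrite lee_fin ler_wpM2l ?powR_ge0// /step_cost /pcost (bigD1 t)//= lerDl.
      by apply: sumr_ge0 => s _; exact: powR_ge0.
    by apply: leeDr; apply: sume_ge0 => i _; exact: term_ge0.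
  have x0 : (0 <= 2 ^+ j * `|chain_coord j w t - chain_coord j.+1 w t|)%R.
    by rewrite mulr_ge0 ?exprn_ge0.
  rewrite -powRM ?exprn_ge0// => xD.
  have : (2 ^+ j * `|chain_coord j w t - chain_coord j.+1 w t| <= D `^ p^-1)%R.
    rewrite -[leLHS]powRr1// -[X in (_ `^ X)%R](mulfV (lt0r_neq0 p_gt0)) powRrM.
    by apply: ge0_ler_powR; rewrite ?nnegrE ?powR_ge0 ?invr_ge0 ?(ltW p_gt0).
  by rewrite exprVn ler_pdivlMr ?exprn_gt0// mulrC.
have coordD t : (`|chain_coord k w t - lim_coord t w| <= 2 * D `^ p^-1 * 2^-1 ^+ k)%R.
  pose r := (2 * D `^ p^-1 * 2^-1 ^+ k)%R.
  have := @limn_esup_between R (fun m => chain_coord m w t) k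
    (chain_coord k w t - r) (chain_coord k w t + r).
  rewrite -/(lim_coord t w) => h.
  rewrite distrC ler_norml lerBlDr lerBrDr [(_ + chain_coord _ _ _)%R]addrC.
  rewrite [(r + _)%R]addrC; apply: h => m km.
  have := geometric_dist (u := fun j => chain_coord j w t) (fun j => stepD j t) km.
  by rewrite distrC ler_norml lerBlDr lerBrDr -/r [(_ + chain_coord _ _ _)%R]addrC [(r + _)%R]addrC.
rewrite DE -EFinM lee_fin /pcost.
apply: (@le_trans _ _ (\sum_(t < n.+1) (2 * 2^-1 ^+ k) `^ p * D)%R); last first.
  by rewrite sumr_const card_ord -[leLHS]mulr_natl mulrA.
apply: ler_sum => t _.
have -> : D = ((D `^ p^-1) `^ p)%R by rewrite -powRrM mulVf ?gt_eqF// powRr1.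
rewrite -powRM ?powR_ge0// ?mulr_ge0 ?(ltW (h0 _))//.
apply: ge0_ler_powR; rewrite ?nnegrE ?(ltW p_gt0)//.
  by rewrite !mulr_ge0 ?powR_ge0 ?(ltW (h0 _)).
by apply: (le_trans (coordD t)); rewrite mulrAC.
Qed.

Let integral_state (B : set T) k (A : pred (fm_idx (f k))) : measurable B ->
  \int[P]_(w in B) ((A (Y k w))%:R)%:E = P (B `&` [set w | A (Y k w)]).
Proof.
move=> mB; rewrite setIC -integral_indic//; last exact: (measurable_stateP ba mU U01).
apply: eq_integral => w _; congr (_%:E); rewrite indicE; congr ((nat_of_bool _)%:R).
by apply/idP/idP; rewrite inE.
Qed.

(** [Y k] is a function of the limit's sample point, so its weights are indicators. Class sums are
    indicators of cylinders, hence adapted, and causality is [cylinder_law]. *)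
Lemma lim_is_weight k : is_weight (f := f k) (X := lim_process)
  (fun i w => (Y k w == i)%:R).
Proof.
have sumE t i w : (\sum_(j | same_past t i j) (Y k w == j)%:R = (same_past t i (Y k w))%:R :> R)%R.
  have [h|h] := boolP (same_past t i (Y k w)).
    rewrite (bigD1 (Y k w))//= eqxx big1 ?addr0// => j /andP[_ nj].
    by rewrite eq_sym (negbTE nj).
  rewrite big1// => j ij; case: eqP => // e; by rewrite e ij in h.
have Fpast t i : lim_filtration t [set w | same_past t i (Y k w)].
  apply: sub_gen_smallest.
  apply: (cylinders_pt a U k (Q := fun x => past t (fm_pt i) == past t x)) => x y.
  by move=> ->.
have eqE i w : (Y k w == i) = same_past ord_max i (Y k w).
  by apply/eqP/eqP => [->//|/past_last/fm_inj].
have Gb t i : Gmeas (lim_filtration t) (fun w => (same_past t i (Y k w))%:R : R).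
  exact: (@Gmeas_bool R n lim_process (lim_filtration t) _ (lim_sigma_algebra t)).
split.
- move=> i; rewrite (_ : (fun w => _) = fun w => (same_past ord_max i (Y k w))%:R).
    exact: Gb.
  by apply/funext => w; rewrite eqE.
- by move=> i w; case: (_ == _).
- move=> w; rewrite (bigD1 (Y k w))//= eqxx big1 ?addr0// => j nj.
  by rewrite eq_sym (negbTE nj).
- move=> i; rewrite [LHS](integral_state (fun j => j == i))// setTI.
  rewrite -(state_law ba mU U01 U_law i); congr (P _).
  by apply/seteqP; split => w /= => [/eqP|->].
- move=> t i; exists (fun w => (same_past t i (Y k w))%:R); split.
  + exact: Gb.
  + by move=> w; case: (same_past _ _ _); rewrite ?lexx ?ler01.
  + by move=> A FA; apply: eq_integral => w _; rewrite sumE.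
- move=> t i B FB; have mB := lim_measurable FB.
  under [in RHS]eq_integral do rewrite sumE.
  rewrite [X in _ * X](integral_state (fun j => j == i))//.
  rewrite [X in _ = _ * X](integral_state (same_past t i))//.
  rewrite -(cylinder_law ba mU U01 U_law i FB); congr (_ * P (_ `&` _)).
  by apply/seteqP; split => w /= => [/eqP|->].
Qed.

Lemma lim_weight_cost k : weight_cost p (f := f k) (X := lim_process)
  (fun i w => (Y k w == i)%:R) <= ((4 * N * 2^-1 ^+ k) `^ p)%:E.
Proof.
rewrite (weight_costE p (lim_is_weight k)).
have h0 : (0 < 2^-1 ^+ k :> R)%R by rewrite exprn_gt0// invr_gt0.
have c0 : (0 < N * (2 * 2^-1 ^+ k) `^ p)%R by rewrite mulr_gt0// powR_gt0// mulr_gt0.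
have mX t : measurable_fun setT (lim_coord t).
  exact: (@fp_process_measurable _ _ lim_process t).
rewrite (eq_integral (fun w => (pcost p (chain_coord k w) (lim_coord^~ w))%:E)); last first.
  move=> w _; congr (_%:E); rewrite (bigD1 (Y k w))//= eqxx mul1r big1 ?addr0//.
  by move=> i ni; rewrite eq_sym (negbTE ni) mul0r.
apply: le_trans (_ : _ <= \int[P]_w ((N * (2 * 2^-1 ^+ k) `^ p)%:E * total_cost w)) _.
  apply: ge0_le_integral => //.
  - by move=> w _; rewrite lee_fin pcost_ge0.
  - apply/measurable_EFinP; apply: measurable_pcost => t //; exact: chain_coord_measurable.
  - by apply: emeasurable_funM => //; exact: total_cost_measurable.
  - by move=> w _; exact: lim_coord_cost.
rewrite ge0_integralZl_EFin//; last 2 first.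
- by move=> w _; apply: nneseries_ge0 => j _ _; exact: term_ge0.
- exact: total_cost_measurable.
apply: le_trans (lee_wpmul2l _ integral_total_cost) _; first by rewrite lee_fin ltW.
rewrite -EFinM lee_fin.
(* The factor 2 bounds the expected total cost and [N] the number of coordinates; [2 N <= (2 N)^p]
   brings them inside the power. *)
have -> : (4 * N * 2^-1 ^+ k = 2 * N * (2 * 2^-1 ^+ k))%R by ring.
have N0 : (0 <= 2 * N)%R by rewrite mulr_ge0.
rewrite [leRHS]powRM//.
rewrite mulrAC mulrC [(_ * 2)%R]mulrC [leLHS]mulrC; apply: ler_wpM2r; first exact: powR_ge0.
apply: le1r_powR => //.
have N1 : (1 <= N)%R by rewrite ler1n.
lra.
Qed.

Lemma near_model_lim k : near_model p (f k) lim_process (4 * N * 2^-1 ^+ k).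
Proof. exists (fun i w => (Y k w == i)%:R); [exact: lim_is_weight|exact: lim_weight_cost]. Qed.

End limit_process.

(** * Completeness *)

Section near_model_facts.
Context (R : realType) (n : nat) (p : R) (p_ge1 : 1 <= p).

Let p_gt0 : 0 < p. Proof. exact: lt_le_trans ltr01 p_ge1. Qed.

Lemma near_model_le (f : fmodel R n) (X : filtered_process R n.+1) (b c : R) :
  0 <= b -> b <= c -> near_model p f X b -> near_model p f X c.
Proof.
move=> b0 bc [k wk kb]; exists k => //; apply: (le_trans kb); rewrite lee_fin.
by apply: ge0_ler_powR; rewrite ?nnegrE ?(ltW p_gt0)//; exact: le_trans bc.
Qed.

(** The triangle inequality through the model path, with [l = 1/2]: a model has finitely many paths,
    so their distances to the origin are bounded by the sum [M]. *)
Lemma near_model_moment (f : fmodel R n) (X : filtered_process R n.+1) (c : R) :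
  near_model p f X c ->
  ('E_(fp_prob X)[(fun w => \sum_(t < n.+1) `|fp_process X t w| `^ p)%R] < +oo)%E.
Proof.
move=> [k wk kc]; rewrite unlock.
pose K : R := 2^-1 `^ (1 - p); pose o : 'I_n.+1 -> R := fun=> 0.
pose M := \sum_(i : fm_idx f) pcost p o (tnth (fm_pt i)).
have K0 : 0 <= K by exact: powR_ge0.
have M0 : 0 <= M by apply: sumr_ge0 => i _; exact: pcost_ge0.
pose W w := \sum_i k i w * pcost p (tnth (fm_pt i)) (fp_path w).
have W0 w : 0 <= W w.
  by apply: sumr_ge0 => i _; rewrite mulr_ge0 ?pcost_ge0// (wt_ge0 wk).
have mW : measurable_fun setT W.
  apply: measurable_sum => i; apply: measurable_funM; first exact: (wt_measurable wk).
  exact: measurable_cost_model.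
have le w : \sum_(t < n.+1) `|fp_process X t w| `^ p <= K * M + K * W w.
  rewrite (_ : \sum_(t < n.+1) _ = pcost p o (fp_path w)); last first.
    by apply: eq_bigr => t _; rewrite sub0r normrN.
  rewrite -[leLHS]mul1r -(wt_sum1 wk w) mulr_suml.
  rewrite /W mulr_sumr -[X in _ <= X + _]mul1r -{1}(wt_sum1 wk w) mulr_suml -big_split/=.
  apply: ler_sum => i _; rewrite (mulrCA K) -mulrDr; apply: ler_wpM2l; first exact: (wt_ge0 wk).
  have half : 0 < (2^-1 : R) < 1 by rewrite invr_gt0 ltr0n invf_lt1 ?ltr0n// ltr1n.
  have := pcost_triangle p_ge1 o (tnth (fm_pt i)) (fp_path w) half.
  rewrite (_ : 1 - 2^-1 = 2^-1); last by field.
  rewrite -/K => h; apply: (le_trans h); rewrite lerD2r; apply: ler_wpM2l => //.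
  by rewrite /M (bigD1 i)//= lerDl sumr_ge0// => j _; exact: pcost_ge0.
apply: (@le_lt_trans _ _ (\int[fp_prob X]_w (K * M + K * W w)%:E)%E).
  apply: ge0_le_integral => //.
  - by move=> w _; rewrite lee_fin; apply: sumr_ge0 => t _; exact: powR_ge0.
  - apply/measurable_EFinP; apply: measurable_sum => t.
    apply: (measurableT_comp (measurable_powR p)).
    by apply: measurableT_comp => //; exact: fp_process_measurable.
  - by apply/measurable_EFinP; apply: measurable_funD => //; exact: measurable_funM.
  - by move=> w _; rewrite lee_fin.
under eq_integral do rewrite EFinD.
have mKW : measurable_fun setT (fun w => (K * W w)%:E).
  by apply/measurable_EFinP; exact: measurable_funM.
have KW0 w : setT w -> (0 <= (K * W w)%:E)%E by move=> _; rewrite lee_fin mulr_ge0.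
have KM0 (w : fp_space X) : setT w -> (0 <= (K * M)%:E)%E.
  by move=> _; rewrite lee_fin mulr_ge0.
rewrite (ge0_integralD (fp_prob X) measurableT KM0 (measurable_cst _) KW0 mKW).
rewrite integral_cst// [X in (_ * X)%E](probability_setT (fp_prob X)) mule1.
under eq_integral do rewrite EFinM.
rewrite ge0_integralZl_EFin//; last 2 first.
- by move=> w _; rewrite lee_fin.
- exact/measurable_EFinP.
apply: lte_add_pinfty; first by rewrite ltry.
apply: (@le_lt_trans _ _ (K%:E * (c `^ p)%:E)%E); last by rewrite -EFinM ltry.
by apply: lee_wpmul2l; [rewrite lee_fin|rewrite -(weight_costE p wk)].
Qed.

End near_model_facts.

Section unit_interval.
Context (R : realType).

Definition unit_measure : {measure set (measurableTypeR R) -> \bar R} :=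
  mrestr (@lebesgue_measure R) (measurable_itv `[0, 1[).

Definition unit_law : set (measurableTypeR R) -> \bar R := unit_measure.

HB.instance Definition _ := Measure.on unit_law.

Let unit_lawE (a b : R) : 0 <= a -> a <= b -> b <= 1 ->
  (lebesgue_measure `[a, b[%classic = (b - a)%:E)%E.
Proof.
move=> a0 ab b1; rewrite lebesgue_measure_itv/= lte_fin.
by case: ltP => // ba; rewrite (_ : b = a) ?subrr//; apply/eqP; rewrite eq_le ab ba.
Qed.

Let unit_law_setT : unit_law setT = 1%E.
Proof.
rewrite -[LHS]/(lebesgue_measure (setT `&` `[0%R, 1%R[%classic)) setTI.
by rewrite unit_lawE// subr0.
Qed.

HB.instance Definition _ := Measure_isProbability.Build _ _ _ unit_law unit_law_setT.

(** The chain needs a variable in [0, 1) at every sample point, hence the value 0 on the null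
    complement of [0, 1). *)
Definition unit_var (w : measurableTypeR R) : R := if 0 <= w < 1 then w else 0.

Lemma unit_var01 w : 0 <= unit_var w < 1.
Proof. by rewrite /unit_var; case: ifP => // _; rewrite lexx ltr01. Qed.

Lemma unit_var_measurable : measurable_fun setT unit_var.
Proof.
apply: measurable_fun_ifT => //; apply: measurable_and => //.
- exact: measurable_fun_ler.
- exact: measurable_fun_ltr.
Qed.

Lemma unit_var_uniform : uniform_on (unit_law : probability (measurableTypeR R) R) unit_var setT.
Proof.
move=> a b a0 ab b1; rewrite [X in (_ * X)%E]unit_law_setT mule1 setTI.
rewrite -(unit_lawE a0 ab b1) -[LHS]/(lebesgue_measure (_ `&` _)); congr (lebesgue_measure _).
apply/seteqP; split => w /=; rewrite !in_itv/= /unit_var.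
  by move=> [h w01]; rewrite w01 in h.
move=> /andP[aw wb].
have w01 : 0 <= w < 1 by rewrite (le_trans a0 aw) (lt_le_trans wb b1).
by rewrite w01 aw wb.
Qed.

End unit_interval.

Section completeness.
Context (R : realType) (n : nat) (p : R) (p_ge1 : 1 <= p).

Lemma model_limit (f : nat -> fmodel R n) :
  (forall k, near_model p (f k) (fm_process (f k.+1)) (4^-1 ^+ k)) ->
  exists X : FPp n.+1 p, forall k, near_model p (f k) X (4 * n.+1%:R * 2^-1 ^+ k).
Proof.
move=> fS; pose H k := cid2 (near_model_matrix (fS k)).
pose a k := s2val (H k).
have ba k : bicausal_matrix (a k) := s2valP (H k).
have ca k := s2valP' (H k).
have nl := near_model_lim p_ge1 ba ca (@unit_var_measurable R) (@unit_var01 R)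
  (@unit_var_uniform R).
by exists (MkFPp (near_model_moment p_ge1 (nl 0%N))).
Qed.

(** Along a fast subsequence each term is replaced by a model. [model_limit] produces the limit of
    these models, and the Cauchy property carries the convergence to the whole sequence. *)
Lemma AW_FP_complete : is_complete (@AW_FP R n.+1 p).
Proof.
move=> u cu.
(* Consecutive models end up within [2 c j + 3 c j.+1], which is [(11/20) 4^-j]; so division by 5
   keeps it below the required [4^-j]. *)
pose c (j : nat) : R := 4^-1 ^+ j / 5.
have e0 (j : nat) : 0 < 4^-1 ^+ j :> R by rewrite exprn_gt0// invr_gt0.
have c0 j : 0 < c j by rewrite divr_gt0.
have /choice[K KP] := fun j => cu (c j) (c0 j).
(* The maximum ensures that [phi j] is beyond [K i] for all [i <= j], so that consecutive terms of
   the subsequence are comparable. *)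
pose phi j := (\max_(i < j.+1) K i)%N.
have Kphi i j : (i <= j)%N -> (K i <= phi j)%N.
  by move=> ij; exact: (@leq_bigmax _ (fun i : 'I_j.+1 => K i) (Ordinal (ij : (i < j.+1)%N))).
pose X j := FP_repr (u (phi j)).
have uX j m : (K j <= m)%N -> (AW p (FP_repr (u m)) (X j) < (c j)%:E)%E.
  by move=> Km; apply: KP => //; exact: Kphi.
have /choice[f fP] := fun j => model_approx p_ge1 (X j) (c0 j).
have fS j : near_model p (f j) (fm_process (f j.+1)) (4^-1 ^+ j).
  have XX : (AW p (X j) (X j.+1) < (c j)%:E)%E.
    by rewrite AW_sym//; apply: uX; exact: Kphi (leqnSn j).
  have fX := near_model_lt p_ge1 (c0 j) (fP j) XX.
  have lt : (AW p (X j.+1) (Pp_to_FPp (fm_Pp p (f j.+1))) < (3 * c j.+1)%:E)%E.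
    apply: (le_lt_trans (near_model_AW_fm p_ge1 (c0 _) (fP j.+1))).
    by rewrite lte_fin; have := c0 j.+1; lra.
  have cc0 : 0 < c j + c j by rewrite addr_gt0.
  apply: near_model_le (near_model_lt p_ge1 cc0 fX lt) => //.
    by rewrite !addr_ge0 ?mulr_ge0// ltW.
  have := e0 j; rewrite /c exprS; lra.
have [Xoo fXoo] := model_limit fS.
exists (FP_class Xoo).
apply/fine_cvgP; split; first by apply: nearW => m; exact: AW_fin_num.
apply/cvgrPdist_lt => e egt0.
(* The final bound [2 c j + 4 N 2^-j], where [N] is [n.+1], is at most [C 2^-j]; and [j + 1 <= 2^j]
   makes this smaller than [e]. *)
pose C : R := 4 * n.+1%:R + 1.
have C0 : 0 < C by rewrite ltr_wpDl// mulr_ge0.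
pose j := Num.truncn (C / e).
have Cj : C * 2^-1 ^+ j < e.
  have /andP[_ h] := truncn_itv (ltW (divr_gt0 C0 egt0)).
  rewrite exprVn ltr_pdivrMr ?exprn_gt0// mulrC -ltr_pdivrMr//.
  apply: (lt_le_trans h); rewrite -natrX ler_nat; exact: ltn_expl.
exists (K j) => // m /= Km; rewrite sub0r normrN /=.
rewrite ger0_norm; last exact/fine_ge0/AW_ge0.
rewrite -lte_fin fineK; last exact: AW_fin_num.
rewrite -(FP_reprK (u m)) AW_FP_class//.
apply: (le_lt_trans (AW_triangle p_ge1 _ (X j) _)).
have h0 : 0 < 2^-1 ^+ j :> R by rewrite exprn_gt0// invr_gt0.
have N0 : 0 < 4 * n.+1%:R * 2^-1 ^+ j :> R by rewrite !mulr_gt0.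
have leX := near_model_AW p_ge1 (c0 j) N0 (fP j) (fXoo j).
have ltu := uX j m Km.
apply: (@lt_le_trans _ _ ((c j)%:E + (c j + 4 * n.+1%:R * 2^-1 ^+ j)%:E)%E).
  by rewrite lte_leD// AW_fin_num.
rewrite -EFinD lee_fin; apply: le_trans (ltW Cj); rewrite /C /c.
have : 4^-1 ^+ j <= 2^-1 ^+ j :> R.
  by apply: lerXn2r; rewrite ?nnegrE ?invr_ge0// lef_pV2 ?posrE// ler_nat.
by have := e0 j; lra.
Qed.

End completeness.

Theorem theorem1p2 (R : realType) (N : nat) (p : R)
    (N_gt0 : (0 < N)%N) (p_ge1 : 1 <= p) :
  [/\ (* AW_p descends to FP_p *)
      forall X Y : FPp N p, AW_FP (FP_class X) (FP_class Y) = AW p X Y,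
      (* AW_p is a metric on FP_p *)
      is_metric (@AW_FP R N p),
      (* P_p(R^N) is a subset of FP_p *)
      forall mu nu : Pp N p, Pp_to_FP mu = Pp_to_FP nu <-> same_law mu nu &
      (* FP_p is the completion of that subset *)
      is_completion_of (@AW_FP R N p)
        (fun C => exists mu : Pp N p, C = Pp_to_FP mu)].
Proof.
case: N N_gt0 => // n _; have metric := @AW_FP_metric R n p p_ge1.
split => //.
- exact: AW_FP_class.
- exact: Pp_to_FP_inj.
- by split => //; [exact: AW_FP_complete|exact: laws_dense].
Qed.
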